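(* For $n\to\infty$ the measures $\mu_n$ converge to a unique probability measure $\mu_\infty$ on $\mathrm{Sch}$, which for every $m\ge0$ satisfies $$\mu_\infty|_{\mathrm{Sch}_m}\ =\ \frac{C_\infty}{C_m^2}\cdot \mu_m|_{\mathrm{Sch}_m}.$$
   Context: Fix a prime $p>2$ and a group $\{1,\sigma\}$ of order $2$. All homomorphisms of pro-$p$-groups are continuous, all subgroups are closed, and ''generated'' means topologically generated. A $\sigma$-pro-$p$-group is a pro-$p$-group $G$ with an action of $\{1,\sigma\}$ (by continuous automorphisms), written $a\mapsto{}^\sigma a$; $\sigma$-homomorphisms and $\sigma$-isomorphisms are the $\sigma$-equivariant ones. Put $G^-:=\{a\in G\mid {}^\sigma a=a^{-1}\}$ (odd elements). Let $d_G:=\dim_{\mathbb F_p}H^1(G,\mathbb F_p)$ be the minimal number of generators of $G$. Let $D_i(G)$ ($i\ge1$) be the Zassenhaus filtration (dimension subgroups mod $p$): $D_1(G)=G$, and for $i\ge2$ the subgroup $D_i(G)$ is generated by the $p$-th powers of elements of $D_{\lceil i/p\rceil}(G)$ and all $[D_j(G),D_k(G)]$ with $j+k=i$. $F_n$ is the free pro-$p$-group on $x_1,\dots,x_n$, made a $\sigma$-pro-$p$-group by ${}^\sigma x_i=x_i^{-1}$. For $r=(r_1,\dots,r_n)\in(F_n^-)^n$ let $N_r$ be the normal subgroup of $F_n$ generated by all conjugates of $r_1,\dots,r_n$, and $G_r:=F_n/N_r$. A weak Schur $\sigma$-group is a $\sigma$-pro-$p$-group $\sigma$-isomorphic to some $G_r$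 with $n\ge0$, $r\in(F_n^-)^n$. $\mathrm{Sch}$ is the set of $\sigma$-isomorphism classes $[G]$ of weak Schur $\sigma$-groups, and $\mathrm{Sch}_m:=\{[G]\in\mathrm{Sch}\mid d_G=m\}$. $\mathrm{Sch}$ carries the topology with basis the sets $U_{i,G}:=\{[H]\in\mathrm{Sch}\mid H/D_i(H)\cong G/D_i(G)\ \sigma\text{-isomorphic}\}$ for all $i\ge2$ and all weak Schur $\sigma$-groups $G$. The Haar measure on $F_n^-$ is the unique Borel probability measure such that for every $\sigma$-invariant open normal subgroup $N\triangleleft F_n$ every fiber of the (surjective) map $F_n^-\to(F_n/N)^-$ has measure $1/|(F_n/N)^-|$. Let $\tilde\mu_n$ be the product measure on $(F_n^-)^n$ obtained from the Haar measure on each factor, and let $\mu_n$ be its pushforward under the continuous map $\Theta_n\colon(F_n^-)^n\to\mathrm{Sch}$, $r\mapsto[G_r]$; this is a probability measure on the Borel $\sigma$-algebra of $\mathrm{Sch}$. For a measure $\mu$ on $\mathrm{Sch}$, $\mu|_{\mathrm{Sch}_m}$ denotes its restriction to $\mathrm{Sch}_m$. For every integer $k\ge0$ and for $k=\infty$ put $C_k:=\prod_{i=1}^k(1-p^{-i})$. *)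

(* Defs.v *)
From HB Require Import structures.
From mathcomp Require Import all_boot all_order all_algebra finmap.
From mathcomp Require Import all_classical all_reals all_analysis.
From mathcomp Require Import zify.
Set Implicit Arguments.
Unset Strict Implicit.
Unset Printing Implicit Defensive.
Import Order.TTheory GRing.Theory Num.Theory.
Import numFieldNormedType.Exports.
Local Open Scope classical_set_scope.
Local Open Scope quotient_scope.
Local Open Scope group_scope.

HB.mixin Record Group_isTopologicalGroup G & Group G & Topological G := {
  mulg_continuous : continuous (fun z : G * G => z.1 * z.2);
  invg_continuous : continuous (fun x : G => x^-1)
}.

#[short(type="topGroupType")]
HB.structure Definition TopologicalGroup :=
  {G of Group G & Topological G & Group_isTopologicalGroup G}.

HB.mixin Record TopologicalGroup_isSigmaGroup G & TopologicalGroup G := {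
  sigma : G -> G;
  sigmaM : {morph sigma : x y / x * y};
  sigmaK : involutive sigma;
  sigma_continuous : continuous sigma
}.

#[short(type="sigmaGroupType")]
HB.structure Definition SigmaGroup :=
  {G of TopologicalGroup G & TopologicalGroup_isSigmaGroup G}.

Definition is_subgroup (G : groupType) (N : set G) :=
  [/\ N 1, forall x y, N x -> N y -> N (x * y) & forall x, N x -> N x^-1].

Definition is_normal (G : groupType) (N : set G) :=
  is_subgroup N /\ forall x y, N x -> N (x ^ y).

Definition cosets (G : groupType) (N : set G) : set (set G) :=
  [set [set x * z | z in N] | x in [set: G]].

Definition is_pro_p (p : nat) (G : topGroupType) :=
  [/\ compact [set: G], hausdorff_space G, totally_disconnected [set: G] &
      forall N : set G, open N -> is_normal N ->
        exists k : nat, (cosets N #= `I_(p ^ k)%N)%card].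

Definition is_free_pro_p (p n : nat) (F : topGroupType) (x : 'I_n -> F) :=
  is_pro_p p F /\
  forall (H : topGroupType) (y : 'I_n -> H), is_pro_p p H ->
    exists! f : F -> H,
      [/\ {morph f : a b / a * b}, continuous f & forall i, f (x i) = y i].

Definition sigma_isomorphic (G H : sigmaGroupType) :=
  exists (f : G -> H) (g : H -> G),
    [/\ {morph f : x y / x * y}, {morph f : x / sigma x >-> sigma x},
        continuous f, continuous g & cancel f g /\ cancel g f].

Definition closed_gen (G : topGroupType) (A : set G) : set G :=
  smallest [set N | closed N /\ is_subgroup N] A.

Section TopologicalGroupTheory.
Implicit Types G H : topGroupType.

Lemma morph1g (G H : groupType) (f : G -> H) :
  {morph f : x y / x * y} -> f 1 = 1.
Proof. by move=> fM; apply: (mulgI (f 1)); rewrite -fM !mulg1. Qed.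

Lemma morphVg (G H : groupType) (f : G -> H) :
  {morph f : x y / x * y} -> {morph f : x / x^-1}.
Proof.
by move=> fM x; apply: (mulgI (f x)); rewrite -fM !mulgV (morph1g fM).
Qed.

Lemma mulg_continuous2 (T : topologicalType) G (f g : T -> G) :
  continuous f -> continuous g -> continuous (fun t => f t * g t).
Proof.
move=> fc gc t; rewrite /continuous_at.
apply: (@continuous2_cvg _ _ _ _ _ _ f g (fun a b : G => a * b)).
- exact: (@mulg_continuous G (f t, g t)).
- exact: fc.
- exact: gc.
Qed.

Lemma conjg_continuous G (y : G) : continuous (fun x : G => x ^ y).
Proof.
rewrite /conjg; apply: mulg_continuous2; first by move=> x; exact: cvg_cst.
by apply: mulg_continuous2 => x; [exact: cvg_id|exact: cvg_cst].
Qed.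

Lemma closed_gen_subgroup G (A : set G) : is_subgroup (closed_gen A).
Proof.
split=> [N [[_ []]]//|x y Ax Ay N|x Ax N] NP.
- by have [[_ [_ NM _]] _] := NP; apply: NM; [exact: Ax|exact: Ay].
- by have [[_ [_ _ NV]] _] := NP; apply: NV; exact: Ax.
Qed.

Lemma closed_gen_homo G H (f : G -> H) (A : set G) (B : set H) :
  {morph f : x y / x * y} -> continuous f ->
  (forall x, A x -> closed_gen B (f x)) ->
  forall x, closed_gen A x -> closed_gen B (f x).
Proof.
move=> fM fc fAB x Ax N NP.
have [[Ncl [N1 NM NV]] _] := NP.
apply: (Ax (f @^-1` N)); split; last by move=> a /fAB; exact.
split; first by apply: preimage_closed => // ? _; exact: fc.
split=> /= [|a b|a]; first by rewrite (morph1g fM).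
- by rewrite fM; exact: NM.
- by rewrite (morphVg fM); exact: NV.
Qed.

End TopologicalGroupTheory.

Record sigmaNormal (G : sigmaGroupType) := SigmaNormal {
  sn_set : set G;
  sn_normal : is_normal sn_set;
  sn_sigma : forall x, sn_set x -> sn_set (sigma x)
}.

Section Quotient.
Variables (G : sigmaGroupType) (M : sigmaNormal G).
Local Notation N := (sn_set M).
Implicit Types x y z : G.

Let N1 : N 1. Proof. by have [[]] := sn_normal M. Qed.
Let NM x y : N x -> N y -> N (x * y).
Proof. by have [[_ h _] _] := sn_normal M; exact: h. Qed.
Let NV x : N x -> N x^-1.
Proof. by have [[_ _ h] _] := sn_normal M; exact: h. Qed.
Let NJ x y : N x -> N (x ^ y).
Proof. by have [_ h] := sn_normal M; exact: h. Qed.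

Definition coset_rel : rel G := fun x y => `[< N (x^-1 * y) >].

Lemma coset_rel_refl : reflexive coset_rel.
Proof. by move=> x; apply/asboolP; rewrite mulVg. Qed.

Lemma coset_rel_sym : symmetric coset_rel.
Proof.
by move=> x y; apply/asboolP/asboolP => /NV; rewrite invgM invgK.
Qed.

Lemma coset_rel_trans : transitive coset_rel.
Proof.
move=> y x z /asboolP Nxy /asboolP Nyz; apply/asboolP.
by have := NM Nxy Nyz; rewrite -mulgA mulVKg.
Qed.

Canonical coset_equiv :=
  EquivRel coset_rel coset_rel_refl coset_rel_sym coset_rel_trans.

Definition quot : Type := quotient_topology {eq_quot coset_equiv}.

HB.instance Definition _ := Topological.on quot.

Definition proj (x : G) : quot :=
  \pi_(quotient_topology {eq_quot coset_equiv})%qT x.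
Definition lift_quot (a : quot) : G :=
  repr (a : quotient_topology {eq_quot coset_equiv}).

Lemma lift_quotK : cancel lift_quot proj. Proof. exact: reprK. Qed.

Lemma projP x y : proj x = proj y <-> N (x^-1 * y).
Proof.
split=> [/(@eqmodP _ coset_equiv x y) /asboolP //|Nxy].
by apply/(@eqmodP _ coset_equiv x y)/asboolP.
Qed.

Lemma proj_continuous : continuous proj.
Proof. exact: pi_continuous. Qed.

Definition quot_mul (a b : quot) : quot := proj (lift_quot a * lift_quot b).
Definition quot_inv (a : quot) : quot := proj (lift_quot a)^-1.
Definition quot_sigma (a : quot) : quot := proj (sigma (lift_quot a)).

Let liftP x : N (x^-1 * lift_quot (proj x)).
Proof. by apply/projP; rewrite lift_quotK. Qed.

Let proj_mul x y : quot_mul (proj x) (proj y) = proj (x * y).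
Proof.
apply/esym/projP; rewrite invgM.
have -> : y^-1 * x^-1 * (lift_quot (proj x) * lift_quot (proj y)) =
  (x^-1 * lift_quot (proj x)) ^ y * (y^-1 * lift_quot (proj y)).
  by rewrite /conjg !mulgA mulgK.
by apply: NM; [exact/NJ/liftP|exact: liftP].
Qed.

Let proj_inv x : quot_inv (proj x) = proj x^-1.
Proof.
apply/projP; rewrite invgK.
by have := NJ (x^-1) (liftP x); rewrite /conjg invgK mulgA mulVKg.
Qed.

Let proj_sigma x : quot_sigma (proj x) = proj (sigma x).
Proof.
apply/esym/projP; rewrite -(morphVg (@sigmaM G)) -sigmaM.
exact/sn_sigma/liftP.
Qed.

Let quot_mulA : associative quot_mul.
Proof.
move=> a b c; rewrite -(lift_quotK a) -(lift_quotK b) -(lift_quotK c).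
by rewrite !proj_mul mulgA.
Qed.

Let quot_mul1 : left_id (proj 1) quot_mul.
Proof. by move=> a; rewrite -(lift_quotK a) proj_mul mul1g. Qed.

Let quot_mulV : left_inverse (proj 1) quot_inv quot_mul.
Proof. by move=> a; rewrite -(lift_quotK a) proj_inv proj_mul mulVg. Qed.

Let quot_mulr1 : right_id (proj 1) quot_mul.
Proof. by move=> a; rewrite -(lift_quotK a) proj_mul mulg1. Qed.

Let quot_mulVr : right_inverse (proj 1) quot_inv quot_mul.
Proof. by move=> a; rewrite -(lift_quotK a) proj_inv proj_mul mulgV. Qed.

HB.instance Definition _ := isGroup.Build quot
  quot_mulA quot_mul1 quot_mulr1 quot_mulV quot_mulVr.

Lemma projM : {morph proj : x y / x * y}.
Proof. by move=> x y; rewrite -proj_mul. Qed.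


Lemma proj_nbhs (x : G) (U : set G) :
  nbhs x U -> nbhs (proj x) (proj @` U).
Proof.
rewrite nbhsE => -[V [oV Vx] VU].
have oW : open (proj @` V).
  suff oW : open (proj @^-1` (proj @` V)) by [].
  have -> : proj @^-1` (proj @` V) =
      \bigcup_(z in N) ((fun t : G => t * z^-1) @^-1` V).
    apply/seteqP; split=> t /=.
      move=> [v Vv /projP Nv]; exists (v^-1 * t) => //=.
      by rewrite invgM invgK mulVKg.
    move=> [z Nz /= Vt]; exists (t * z^-1) => //; apply/projP.
    by rewrite invgM invgK mulgVK.
  apply: bigcup_open => z _; apply: open_comp => // t _.
  by apply: mulg_continuous2 => ?; [exact: cvg_id|exact: cvg_cst].
rewrite nbhsE; exists (proj @` V); last by move=> _ [v Vv <-]; exists v => //; exact: VU.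
by split=> //; exists x.
Qed.

Let quot_mul_continuous : continuous (fun z : quot * quot => z.1 * z.2).
Proof.
move=> [a b] W /=; rewrite -(lift_quotK a) -(lift_quotK b) -projM => nW.
have /= [[U V] /= [nU nV] UVW] :=
  @mulg_continuous G (lift_quot a, lift_quot b) _ (@proj_continuous _ _ nW).
exists (proj @` U, proj @` V); first by split; exact: proj_nbhs.
move=> [_ _] [/= [u Uu <-] [v Vv <-]] /=; rewrite -projM.
exact: (UVW (u, v)).
Qed.

Let quot_inv_continuous : continuous (fun a : quot => a^-1).
Proof.
apply/(@quotient_continuous _ {eq_quot coset_equiv} _ quot_inv).
rewrite (_ : _ \o _ = proj \o (fun x : G => x^-1)); last first.
  by apply/funext => x /=; exact: proj_inv.
by move=> x; apply: continuous_comp; [exact: invg_continuous|exact: proj_continuous].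
Qed.

HB.instance Definition _ := Group_isTopologicalGroup.Build quot
  quot_mul_continuous quot_inv_continuous.

Let quot_sigmaM : {morph quot_sigma : a b / a * b}.
Proof.
move=> a b; rewrite -(lift_quotK a) -(lift_quotK b) -projM !proj_sigma.
by rewrite -projM sigmaM.
Qed.

Let quot_sigmaK : involutive quot_sigma.
Proof. by move=> a; rewrite -(lift_quotK a) !proj_sigma sigmaK. Qed.

Let quot_sigma_continuous : continuous quot_sigma.
Proof.
apply/(@quotient_continuous _ {eq_quot coset_equiv} _ quot_sigma).
rewrite (_ : _ \o _ = proj \o sigma); last first.
  by apply/funext => x /=; exact: proj_sigma.
by move=> x; apply: continuous_comp; [exact: sigma_continuous|exact: proj_continuous].
Qed.

HB.instance Definition _ := TopologicalGroup_isSigmaGroup.Build quot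
  quot_sigmaM quot_sigmaK quot_sigma_continuous.

Lemma projS : {morph proj : x / sigma x >-> sigma x}.
Proof. by move=> x; rewrite -proj_sigma. Qed.

End Quotient.

Section Zassenhaus.
Variable p : nat.

(* [zass_rec k i] is D_i for every i <= k; below, D_i is [zass i]. *)
Fixpoint zass_rec (G : topGroupType) (k i : nat) : set G :=
  if k is l.+1 then
    if (i <= 1)%N then [set: G] else
    closed_gen
      ([set x ^+ p | x in @zass_rec G l ((i + p.-1) %/ p)%N] `|`
       [set z | exists j k : nat, [/\ (0 < j)%N, (0 < k)%N, (j + k = i)%N &
          exists x y, [/\ @zass_rec G l j x, @zass_rec G l k y & z = [~ x, y]]]])
  else [set: G].
Arguments zass_rec : clear implicits.

Definition zass (G : topGroupType) (i : nat) : set G := zass_rec G i i.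
Arguments zass : clear implicits.

Lemma zass_rec_stable (G : topGroupType) (k i : nat) :
  (1 < p)%N -> (i <= k)%N -> zass_rec G k i = zass G i.
Proof.
move=> p1; rewrite /zass.
suff H n m : (i <= n)%N -> (i <= m)%N -> zass_rec G n i = zass_rec G m i.
  by move=> ik; apply: H.
elim: n m i => [|n IH] [|m] i //=.
- by rewrite leqn0 => /eqP ->.
- by move=> _; rewrite leqn0 => /eqP ->.
move=> i_n i_m; case: leqP => // i1.
have ip : ((i + p.-1) %/ p < i)%N by rewrite ltn_divLR; nia.
congr (closed_gen (_ `|` _)).
- by rewrite (IH m) //; lia.
- apply/seteqP; split=> z [j [k' [j0 k0 jk [x [y [xj yk zE]]]]]];
    exists j, k'; split=> //; exists x, y.
  + by split=> //; [rewrite -(IH m) in xj *|rewrite -(IH m) in yk *] => //; lia.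
  + by split=> //; [rewrite (IH m)|rewrite (IH m)] => //; lia.
Qed.

Lemma zass1 (G : topGroupType) (i : nat) : (i <= 1)%N -> zass G i = [set: G].
Proof. by rewrite /zass; case: i => [|[|i]]. Qed.

Lemma zassE (G : topGroupType) (i : nat) : (1 < p)%N -> (1 < i)%N ->
  zass G i = closed_gen
    ([set x ^+ p | x in zass G ((i + p.-1) %/ p)%N] `|`
     [set z | exists j k : nat, [/\ (0 < j)%N, (0 < k)%N, (j + k = i)%N &
        exists x y, [/\ zass G j x, zass G k y & z = [~ x, y]]]]).
Proof.
case: i => // i p1 i1; rewrite {1}/zass /= leqNgt i1 /=.
have ip : ((i.+1 + p.-1) %/ p < i.+1)%N by rewrite ltn_divLR; nia.
congr (closed_gen (_ `|` _)).
- by rewrite zass_rec_stable //; lia.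
- apply/seteqP; split=> z [j [k' [j0 k0 jk [x [y [xj yk zE]]]]]];
    exists j, k'; split=> //; exists x, y.
  + by split=> //; [rewrite zass_rec_stable in xj|rewrite zass_rec_stable in yk] => //; lia.
  + by split=> //; rewrite zass_rec_stable => //; lia.
Qed.

Lemma zass_homo (G H : topGroupType) (f : G -> H) :
  {morph f : x y / x * y} -> continuous f ->
  forall i x, zass G i x -> zass H i (f x).
Proof.
move=> fM fc i; rewrite /zass; move: {1 3}i => k; elim: k i => [//|k IH] i x /=.
case: ifP => // _; apply: closed_gen_homo => // {}x.
have fX y n : f (y ^+ n) = f y ^+ n.
  by elim: n => [|n IHn]; rewrite ?expg0 ?(morph1g fM)// !expgS fM IHn.
move=> [[y yD <-]|[j [l [j0 l0 jl [a [b [aj bl ->]]]]]]]; apply: sub_gen_smallest.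
- by left; exists (f y); rewrite ?fX //; exact: IH.
- right; exists j, l; split=> //; exists (f a), (f b); split; try exact: IH.
  by rewrite /commg /conjg !fM !(morphVg fM).
Qed.

Lemma zass_subgroup (G : topGroupType) (i : nat) : is_subgroup (zass G i).
Proof.
by rewrite /zass; case: i => [|i] //=; case: ifP => // _; exact: closed_gen_subgroup.
Qed.

Lemma zass_normal (G : topGroupType) (i : nat) : is_normal (zass G i).
Proof.
split=> [|x y xD]; first exact: zass_subgroup.
apply: (@zass_homo _ _ (fun t : G => t ^ y)) xD; last exact: conjg_continuous.
by move=> a b; exact: conjMg.
Qed.

Definition zassenhaus (G : sigmaGroupType) (i : nat) : sigmaNormal G :=
  SigmaNormal (zass_normal G i)
    (@zass_homo G G sigma (@sigmaM G) (@sigma_continuous G) i).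

End Zassenhaus.
Arguments zass p G i _ : clear implicits.

Definition odd_elts (G : sigmaGroupType) : set G := [set a | sigma a = a^-1].

Definition oddT (G : sigmaGroupType) : Type := set_type (@odd_elts G).

HB.instance Definition _ (G : sigmaGroupType) := Topological.on (oddT G).

Lemma odd1 (G : sigmaGroupType) : (1 : G) \in @odd_elts G.
Proof. by rewrite inE /odd_elts /= (morph1g (@sigmaM G)) invg1. Qed.

HB.instance Definition _ (G : sigmaGroupType) :=
  isPointed.Build (oddT G) (exist _ 1 (odd1 G)).

Definition odd_val (G : sigmaGroupType) (a : oddT G) : G := set_val a.

Section Relators.
Variables (G : sigmaGroupType) (n : nat) (r : n.-tuple (oddT G)).

Definition relators : set G :=
  closed_gen [set z | exists (i : 'I_n) (y : G), z = odd_val (tnth r i) ^ y].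

Lemma relators_normal : is_normal relators.
Proof.
split=> [|x y xD]; first exact: closed_gen_subgroup.
apply: (@closed_gen_homo _ _ (fun t : G => t ^ y)) xD.
- by move=> a b; exact: conjMg.
- exact: conjg_continuous.
- move=> _ [i [z ->]]; apply: sub_gen_smallest; exists i, (z * y).
  by rewrite conjgM.
Qed.

Lemma relators_sigma x : relators x -> relators (sigma x).
Proof.
apply: closed_gen_homo; [exact: sigmaM|exact: sigma_continuous|].
move=> _ [i [z ->]]; have [_ _ NV] := closed_gen_subgroup
  [set z | exists (i : 'I_n) (y : G), z = odd_val (tnth r i) ^ y].
have rE : sigma (odd_val (tnth r i)) = (odd_val (tnth r i))^-1.
  by apply: set_mem; exact: (valP (tnth r i)).
rewrite /conjg !sigmaM (morphVg (@sigmaM G)) rE.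
rewrite -/(conjg _ _) conjVg; apply: NV; apply: sub_gen_smallest.
by exists i, (sigma z).
Qed.

Definition presented : sigmaGroupType :=
  quot (SigmaNormal relators_normal relators_sigma).

End Relators.

Lemma sigma_isomorphic_refl (G : sigmaGroupType) : sigma_isomorphic G G.
Proof. by exists id, id; split=> // x; exact: cvg_id. Qed.

Lemma sigma_isomorphic_sym (G H : sigmaGroupType) :
  sigma_isomorphic G H -> sigma_isomorphic H G.
Proof.
move=> [f [g [fM fS fc gc [fK gK]]]]; exists g, f; split=> // x.
- by move=> y; apply: (can_inj fK); rewrite fM !gK.
- by apply: (can_inj fK); rewrite fS !gK.
Qed.

Lemma sigma_isomorphic_trans (G H K : sigmaGroupType) :
  sigma_isomorphic G H -> sigma_isomorphic H K -> sigma_isomorphic G K.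
Proof.
move=> [f [g [fM fS fc gc [fK gK]]]] [f' [g' [f'M f'S f'c g'c [f'K g'K]]]].
exists (f' \o f), (g \o g'); split=> [x y|x|x|x|] /=.
- by rewrite fM f'M.
- by rewrite fS f'S.
- by apply: continuous_comp; [exact: fc|exact: f'c].
- by apply: continuous_comp; [exact: g'c|exact: gc].
- by split; exact: can_comp.
Qed.

(* The class of all weak Schur sigma-groups is too large to carry library
   structures, so Sch is formed as the quotient of the set of all presentations
   (n, r) by sigma-isomorphism of the presented groups G_r; by definition every
   weak Schur sigma-group is sigma-isomorphic to some G_r. The prime p only
   enters through the topology put on Sch. *)
Section Sch.
Variable F : nat -> sigmaGroupType.

Definition presentation : Type := {n : nat & n.-tuple (oddT (F n))}.

HB.instance Definition _ := Choice.on presentation.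

Definition pres_group (P : presentation) : sigmaGroupType :=
  presented (tagged P).

Definition pres_rel : rel presentation :=
  fun P Q => `[< sigma_isomorphic (pres_group P) (pres_group Q) >].

Lemma pres_rel_refl : reflexive pres_rel.
Proof. by move=> P; apply/asboolP; exact: sigma_isomorphic_refl. Qed.

Lemma pres_rel_sym : symmetric pres_rel.
Proof.
by move=> P Q; apply/asboolP/asboolP; exact: sigma_isomorphic_sym.
Qed.

Lemma pres_rel_trans : transitive pres_rel.
Proof.
move=> Q P S /asboolP PQ /asboolP QS; apply/asboolP.
exact: sigma_isomorphic_trans PQ QS.
Qed.

Canonical pres_equiv :=
  EquivRel pres_rel pres_rel_refl pres_rel_sym pres_rel_trans.

Definition Sch (p : nat) : Type := {eq_quot pres_equiv}.

Section SchTheory.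
Variable p : nat.

HB.instance Definition _ := Choice.on (Sch p).

Definition Sch_class (n : nat) (r : n.-tuple (oddT (F n))) : Sch p :=
  \pi_({eq_quot pres_equiv}) (existT _ n r : presentation).

Definition Sch_group (X : Sch p) : sigmaGroupType :=
  pres_group (repr (X : {eq_quot pres_equiv})).

HB.instance Definition _ := isPointed.Build (Sch p) (Sch_class (nil_tuple _)).

Lemma Sch_classP (m n : nat) (r : m.-tuple (oddT (F m)))
    (s : n.-tuple (oddT (F n))) :
  Sch_class r = Sch_class s <-> sigma_isomorphic (presented r) (presented s).
Proof.
pose P : presentation := existT _ m r; pose Q : presentation := existT _ n s.
split=> [e|rs].
  by have /asboolP : pres_rel P Q by apply/(@eqmodP _ pres_equiv P Q).
by apply/(@eqmodP _ pres_equiv P Q)/asboolP.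
Qed.

Definition is_weak_schur (G : sigmaGroupType) : Prop :=
  exists (n : nat) (r : n.-tuple (oddT (F n))), sigma_isomorphic G (presented r).

Lemma Sch_groupP (n : nat) (r : n.-tuple (oddT (F n))) :
  sigma_isomorphic (Sch_group (Sch_class r)) (presented r).
Proof.
set P : presentation := existT _ n r.
suff /asboolP : pres_rel (repr (\pi_{eq_quot pres_equiv} P)) P by [].
by apply/(@eqmodP _ pres_equiv); rewrite reprK.
Qed.

Lemma weak_schur_Sch (G : sigmaGroupType) :
  is_weak_schur G -> exists! X : Sch p, sigma_isomorphic G (Sch_group X).
Proof.
move=> [n [r Gr]]; exists (Sch_class r); split.
  exact: sigma_isomorphic_trans Gr (sigma_isomorphic_sym (Sch_groupP r)).
move=> X GX; rewrite -[X](reprK (X : {eq_quot pres_equiv})).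
apply/(@eqmodP _ pres_equiv)/asboolP.
exact: sigma_isomorphic_trans (sigma_isomorphic_sym Gr) GX.
Qed.

Lemma Sch_group_weak_schur (X : Sch p) : is_weak_schur (Sch_group X).
Proof.
rewrite /Sch_group; case: (repr _) => n r; exists n, r.
exact: sigma_isomorphic_refl.
Qed.

Definition Sch_nbhs (i : nat) (X : Sch p) : set (Sch p) :=
  [set Y | sigma_isomorphic (quot (zassenhaus p (Sch_group Y) i))
                            (quot (zassenhaus p (Sch_group X) i))].

(* The topology generated by the U_{i,G}; these sets are in fact a basis. *)
HB.instance Definition _ := @isSubBaseTopological.Build (Sch p)
  (nat * Sch p)%type [set iX | (1 < iX.1)%N] (fun iX => Sch_nbhs iX.1 iX.2).

End SchTheory.
End Sch.

(* Continuous homomorphisms to F_p, written additively; as F_p is discrete,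
   continuity means that the fibers are open. *)
Definition H1 (p : nat) (G : topGroupType) : set (G -> 'F_p) :=
  [set f | (forall x y, f (x * y) = (f x + f y)%R) /\
           forall c, open (f @^-1` [set c])].

Definition H1_dim (p : nat) (G : topGroupType) (m : nat) : Prop :=
  exists b : 'I_m -> G -> 'F_p, (forall i, H1 (b i)) /\
    forall f : G -> 'F_p, H1 f ->
      exists! c : {ffun 'I_m -> 'F_p},
        forall x, f x = (\sum_(i < m) c i * b i x)%R.

Definition Sch_rank (p : nat) (F : nat -> sigmaGroupType) (m : nat) :
    set (Sch F p) :=
  [set X | H1_dim p (Sch_group X) m].
Arguments Sch_rank : clear implicits.

Notation borel T := (g_sigma_algebraType (@open T)).

Definition is_haar_odd (R : realType) (G : sigmaGroupType)
    (h : set (oddT G) -> \bar R) : Prop :=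
  forall N : sigmaNormal G, open (sn_set N) ->
  forall y : quot N, odd_elts y ->
    h [set a | proj N (odd_val a) = y] =
      (#|` fset_set (@odd_elts (quot N))|%:R^-1)%R%:E.

Section TupleMeasure.
Context {d : measure_display} {T : measurableType d} {R : realType}.
Variable P : probability T R.

Definition tuple_cons (n : nat) (z : T * n.-tuple T) : n.+1.-tuple T :=
  [the n.+1.-tuple T of z.1 :: z.2].

Lemma measurable_tuple_cons n : measurable_fun setT (@tuple_cons n).
Proof. by apply: measurable_cons; [exact: measurable_fst|exact: measurable_snd]. Qed.

HB.instance Definition _ n := isMeasurableFun.Build _ _ _ _ (@tuple_cons n)
  (@measurable_tuple_cons n).

Fixpoint tuple_measure (n : nat) : probability (n.-tuple T) R :=
  if n is k.+1 then distribution (P \x tuple_measure k)%E (@tuple_cons k)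
  else dirac ([tuple] : 0.-tuple T).

Lemma tuple_measure_box (n : nat) (A : 'I_n -> set T) :
  (forall i, measurable (A i)) ->
  tuple_measure n [set t | forall i, A i (tnth t i)] =
    (\prod_(i < n) fine (P (A i)))%R%:E.
Proof.
elim: n A => [|n IH] A mA.
  by rewrite big_ord0 /= diracE mem_set// => -[].
rewrite big_ord_recl EFinM fineK ?fin_num_measure//.
have mB : measurable [set t : n.-tuple T | forall i, A (lift ord0 i) (tnth t i)].
  rewrite (_ : mkset _ =
    \bigcap_(i in [set: 'I_n]) ((fun t => tnth t i) @^-1` A (lift ord0 i))).
    apply: fin_bigcap_measurable => [|i _]; first exact: finite_finset.
    rewrite -[X in measurable X]setTI.
    exact: measurable_tnth.
  apply/seteqP; split=> [t ht i _|t ht i]; first exact: ht.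
  exact: ht.
rewrite -(IH (fun i => A (lift ord0 i)))// -product_measure1E//.
rewrite /= /distribution /pushforward; congr (_ _).
apply/seteqP; split=> -[a t] /=.
- move=> h; split; first by have := h ord0; rewrite tnth0.
  by move=> i; have := h (lift ord0 i); rewrite tnthS.
- move=> [Aa h] i; case: (unliftP ord0 i) => [j|] ->.
    by rewrite tnthS; exact: h.
  by rewrite tnth0.
Qed.

End TupleMeasure.

Section SchMeasure.
Variables (R : realType) (p : nat) (F : nat -> sigmaGroupType).
Variable h : forall n, probability (borel (oddT (F n))) R.

Definition Theta (n : nat) (r : n.-tuple (borel (oddT (F n)))) : borel (Sch F p) :=
  Sch_class p r.

Definition sch_measure (n : nat) : set (borel (Sch F p)) -> \bar R :=
  pushforward (tuple_measure (h n) n) (@Theta n).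

End SchMeasure.
Arguments sch_measure {R} p {F} h n A : rename.

Definition cvg_setwise (R : realType) (d : measure_display)
    (T : measurableType d) (mu_ : nat -> set T -> \bar R) (mu : set T -> \bar R) :=
  forall A, measurable A -> mu_ n A @[n --> \oo] --> mu A.

Definition cvg_weakly (R : realType) (T : ptopologicalType)
    (mu_ : nat -> set (borel T) -> \bar R) (mu : set (borel T) -> \bar R) :=
  forall f : T -> R, continuous f -> bounded_fun f ->
    (\int[mu_ n]_x (f x)%:E)%E @[n --> \oo] --> (\int[mu]_x (f x)%:E)%E.

Definition Cprod (R : realType) (p k : nat) : R :=
  (\prod_(1 <= i < k.+1) (1 - p%:R ^- i))%R.

Definition Cinf (R : realType) (p : nat) : R := lim (Cprod R p k @[k --> \oo]).

(* Main.v *)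
(* Let [q = p^-1], let [Phi n] be the Frattini subgroup of the free group [F n],
   and let [W n k A] be the measure of the tuples of [n] odd relators of [F n]
   whose class lies in [A] and whose first [k] members lie in [Phi n].  Reveal
   the next relator: with probability [q ^ n] it lies in [Phi n]; otherwise it is
   part of a basis of [F n], and killing it leaves a free group on [n - 1]
   generators, onto whose odd elements the Haar measure is projected.  For each
   of the [k] relators constrained so far, lying in [Phi n] has probability [q]
   given that the image lies in [Phi (n - 1)], whence
     [W n k A = W n (k + 1) A + (1 - q ^ n) * q ^ k * W (n - 1) k A].
   The class of a tuple has rank [n] exactly if all the relators are in [Phi n],
   so for [A] within the classes of rank [m] the recursion solves to
     [mu_n A = C_n ^ 2 / (C_m ^ 2 * C_(n - m)) * mu_m A].
   As [mu_m] gives mass [q ^ (m * m)] to rank [m], dominated convergence over the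
   ranks yields the limit, in the setwise and hence in the weak sense.  It is
   unique because the sets [Sch_nbhs i X] are clopen, stable under intersection
   up to the empty set, and generate the Borel sets, being countable in number. *)
Require Import Defs.
From HB Require Import structures.
From mathcomp Require Import all_boot all_order all_algebra finmap all_fingroup.
From mathcomp Require Import all_solvable mxabelem.
Set Implicit Arguments.
Unset Strict Implicit.
Unset Printing Implicit Defensive.
Import Order.TTheory GRing.Theory Num.Theory.
Local Open Scope group_scope.

(** The free group is known only through its universal property, so H^1 does the work of the
    Frattini quotient: a nonzero element of H^1 kills any given proper closed subgroup, and the
    Frattini subgroup is the common kernel [Phi] of the coordinates dual to the generators. The
    factor q^k has its origin here. If [f] kills a relator [a] whose j-th coordinate is nonzero, an
    element lies in [Phi] exactly if its image under [f] does and its own j-th coordinate vanishes;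
    on an odd coset the p values of that coordinate are equally likely.

    The Haar measure is prescribed only on cosets of open subgroups. Finite generation makes every
    D_i open, and G_r/D_i depends only on r modulo D_i; so preimages of Borel sets of Sch lie in the
    sigma-algebra of cylinders, where measures are compared coset by coset.

    The index k makes the recursion close: constraints on relators already seen are passed to the
    smaller group. It is solved downward from k = n, where the rank is forced to be n.

    For p > 2 all C_k are at least 1/2, which bounds the coefficients of mu_m uniformly by 8. *)

Lemma pgroup_proper_hom (gT : finGroupType) (p : nat) (K : {group gT}) :
  prime p -> p.-group [set: gT] -> K != [set: gT]%G ->
  exists f : gT -> 'F_p, [/\ {morph f : x y / x * y >-> (x + y)%R},
    {in K, forall x, f x = 0%R} & exists x, f x != 0%R].
Proof.
move=> pp pG KG.
(* A maximal subgroup above [K] is normal of index p, so a coordinate on the quotient, read as an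
   F_p-vector space, is the functional sought. *)
have [KE|[M maxM KM]] := maximal_exists (subsetT K).
  by case/eqP: KG; apply/group_inj.
have nM := p_maximal_normal pG maxM; have iM := p_maximal_index pG maxM.
have cQ : #|[set: gT] / M| = p by rewrite card_quotient// normal_norm.
have abQ : p.-abelem ([set: gT] / M) := prime_abelem pp cQ.
have nt : [set: gT] / M != 1.
  by apply: contraTneq pp => Q1; rewrite -cQ Q1 cards1.
have inN x : x \in 'N(M) by apply: (subsetP (normal_norm nM)); rewrite inE.
have inQ x : coset M x \in [set: gT] / M by rewrite mem_quotient// inE.
have [x xM] : exists x, x \notin M.
  have /proper_subn/subsetPn[x _ xM] := maxgroupp maxM.
  by exists x.
have /rV0Pn[i xi] : abelem_rV abQ nt (coset M x) != 0%R.
  apply: contraNneq xM => e; apply: coset_idr => //.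
  by apply: (abelem_rV_inj (abelE := abQ) (ntE := nt)); rewrite ?group1// e abelem_rV_1.
exists (fun y => abelem_rV abQ nt (coset M y) 0%R i); split=> [y z|y yK|].
- by rewrite morphM// (abelem_rV_M abQ nt (inQ y) (inQ z)) mxE.
- by rewrite (coset_id (subsetP KM _ yK)) abelem_rV_1 mxE.
- by exists x.
Qed.

Section FiniteGroup.
Variables (Q : groupType) (n : nat) (f : Q -> 'I_n) (g : 'I_n -> Q).
Hypothesis fK : cancel f g.

(** The dummy [let] makes the type depend on [fK], from which its finite structure is built. It
    carries results on [finGroupType] over to a group known only to be finite. *)
Definition fin_group : Type := let _ := fK in Q.

HB.instance Definition _ := Finite.copy fin_group (can_type fK).
HB.instance Definition _ := Finite_isGroup.Build fin_group
  (@mulgA Q) (@mul1g Q) (@mulVg Q).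

End FiniteGroup.

Local Close Scope group_scope.

From mathcomp Require Import all_classical all_reals all_analysis measurable_realfun.
From mathcomp Require Import zify ring lra.
(* Again, since all_analysis shadows [proj]. *)
Require Import Defs.
Import numFieldNormedType.Exports.
Local Open Scope classical_set_scope.
Local Open Scope ring_scope.

(** * Measures on tuples *)

Section ImageRestriction.
Context d d' (T : measurableType d) (T' : measurableType d') (R : realType).
Variables (m : {measure set T -> \bar R}) (D : set T) (mD : measurable D).
Variable f : {mfun T >-> T'}.

(** Bundled as a measure so that it can be compared with another one on a pi-system, as
    [tuple_reduction] does. *)
Definition image_restr : set T' -> \bar R := pushforward (mrestr m mD) f.

Let image_restr0 : image_restr set0 = 0%E.
Proof. exact: measure0. Qed.

Let image_restr_ge0 A : (0 <= image_restr A)%E.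
Proof. exact: measure_ge0. Qed.

Let image_restr_sigma_additive : semi_sigma_additive image_restr.
Proof. exact: measure_semi_sigma_additive. Qed.

HB.instance Definition _ := isMeasure.Build _ _ _ image_restr
  image_restr0 image_restr_ge0 image_restr_sigma_additive.

End ImageRestriction.

Lemma continuous_measurable_borel (S T : ptopologicalType) (f : S -> T) :
  continuous f -> measurable_fun [set: borel S] (f : borel S -> borel T).
Proof.
move=> fc; apply: (@measurability _ _ (borel S) (borel T) setT f (@open T)) => // _ [A oA <-].
rewrite setTI; apply: sub_gen_smallest.
by apply: open_comp => // s _; exact: fc.
Qed.

Section TupleMeasureTheory.
Context {d : measure_display} {T : measurableType d} {R : realType}.
Variable P : probability T R.

Definition box n (A : 'I_n -> set T) : set (n.-tuple T) :=
  [set t | forall i, A i (tnth t i)].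

Definition boxes n : set (set (n.-tuple T)) :=
  [set B | exists2 A : 'I_n -> set T, (forall i, measurable (A i)) & B = box A].

Lemma measurable_box n (A : 'I_n -> set T) :
  (forall i, measurable (A i)) -> measurable (box A).
Proof.
move=> mA; have -> : box A = \bigcap_(i in [set: 'I_n]) ((fun t => tnth t i) @^-1` A i).
  by apply/seteqP; split=> [t ht i _|t ht i]; exact: ht.
apply: fin_bigcap_measurable => [|i _]; first exact: finite_finset.
rewrite -[X in measurable X]setTI; exact: measurable_tnth.
Qed.

Lemma measurable_boxes n : @measurable _ (n.-tuple T) = <<s @boxes n >>.
Proof.
apply/seteqP; split; last first.
  apply: smallest_sub; first exact: sigma_algebra_measurable.
  by move=> _ [A mA ->]; exact: measurable_box.
apply: smallest_sub; first exact: smallest_sigma_algebra.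
rewrite -bigcup_seq => _ [i _ [A mA <-]].
apply: sub_gen_smallest; exists (fun j => if j == i then A else setT) => [j|].
  by case: ifP.
rewrite setTI; apply/seteqP; split=> t /= ht => [j|].
  by case: eqP => // ->.
by have := ht i; rewrite eqxx.
Qed.

Lemma setI_closed_boxes n : setI_closed (@boxes n).
Proof.
move=> _ _ [A mA ->] [B mB ->]; exists (fun i => A i `&` B i).
  by move=> i; exact: measurableI.
apply/seteqP; split=> t /= => [[ht1 ht2] i|ht]; first by split.
by split=> i; have [] := ht i.
Qed.

Lemma boxesT n : @boxes n setT.
Proof. by exists (fun=> setT) => //; apply/seteqP; split. Qed.

Lemma measurable_tuple_perm n (s : {perm 'I_n}) :
  measurable_fun [set: n.-tuple T] (fun t : n.-tuple T => [tuple tnth t (s i) | i < n]).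
Proof.
apply/measurable_fun_tnthP => i.
rewrite (_ : _ \o _ = (fun t => tnth t (s i))); first exact: measurable_tnth.
by apply/funext => t /=; rewrite tnth_mktuple.
Qed.

(** A permutation of the coordinates permutes the factors of a box, and boxes form a generating
    pi-system. It serves to move any relator to the head, the coordinate that [tuple_measureS]
    integrates over. *)
Lemma tuple_measure_perm n (s : {perm 'I_n}) (A : set (n.-tuple T)) : measurable A ->
  tuple_measure P n ((fun t : n.-tuple T => [tuple tnth t (s i) | i < n]) @^-1` A) =
  tuple_measure P n A.
Proof.
move=> mA; set f := (X in X @^-1` _).
have mf : measurable_fun setT f := measurable_tuple_perm s.
pose mf' : {mfun n.-tuple T >-> n.-tuple T} := mfun_Sub (mem_set mf).
pose m2 := distribution (tuple_measure P n) mf'.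
apply/esym/(@measure_unique _ R (n.-tuple T) (@boxes n) (fun=> setT) (measurable_boxes n)
  (@setI_closed_boxes n) (fun=> boxesT n) _ (tuple_measure P n) m2) => //.
- by rewrite bigcup_const.
- move=> _ [B mB ->]; rewrite /m2 /= /distribution /pushforward /=.
  rewrite [LHS]tuple_measure_box// (_ : f @^-1` _ = box (fun i => B (s^-1%g i))).
    rewrite [RHS]tuple_measure_box//.
    by congr _%:E; rewrite (reindex_inj (@perm_inj _ s^-1%g)).
  apply/seteqP; split=> t /= ht i; have := ht (s^-1%g i); have := ht (s i).
    by move=> _; rewrite tnth_mktuple permKV.
  by rewrite permK tnth_mktuple.
- by move=> _; rewrite -ge0_fin_numE// fin_num_measure.
Qed.

Lemma tuple_measureS n (A : set (n.+1.-tuple T)) :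
  tuple_measure P n.+1 A =
  (\int[P]_x tuple_measure P n [set t | A (tuple_cons (x, t))])%E.
Proof.
rewrite /= /distribution /pushforward /=; apply: eq_integral => x _ /=.
by congr (tuple_measure P n _); apply/seteqP; split=> t; rewrite /xsection/= inE.
Qed.

End TupleMeasureTheory.

(** * The constants C_k *)

Section CprodTheory.
Variables (R : realType) (p : nat) (p1 : (1 < p)%N).
Local Notation C := (Cprod R p).
Local Notation q := (p%:R^-1 : R).

Lemma pinv_gt0 : 0 < q. Proof. by rewrite invr_gt0 ltr0n ltnW. Qed.

Lemma pinv_lt1 : q < 1. Proof. by rewrite invf_lt1 ?ltr1n// ltr0n ltnW. Qed.

Lemma pinvX_lt1 k : q ^+ k.+1 < 1.
Proof. by rewrite exprn_ilt1// ?pinv_lt1// ltW// pinv_gt0. Qed.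

Lemma Cprod0 : C 0 = 1. Proof. by rewrite /Cprod big_geq. Qed.

Lemma CprodS k : C k.+1 = C k * (1 - q ^+ k.+1).
Proof. by rewrite /Cprod big_nat_recr//= exprVn. Qed.

Lemma Cprod_gt0 k : 0 < C k.
Proof.
elim: k => [|k IH]; first by rewrite Cprod0.
by rewrite CprodS mulr_gt0// subr_gt0 pinvX_lt1.
Qed.

(* The solution of the recursion [law_recursion] with [law_coef m m k = 1] and
   [law_coef m n n = 0] for [m < n]. *)
Definition law_coef m n k : R :=
  if (k <= m)%N then q ^+ ((n - m) * k) * (C n * C (n - k)) / (C m * C (m - k) * C (n - m))
  else 0.

Lemma law_coef_diag m k : (k <= m)%N -> law_coef m m k = 1.
Proof.
move=> km; rewrite /law_coef km subnn mul0n expr0 mul1r Cprod0 mulr1 divff//.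
by rewrite mulf_neq0// gt_eqF// Cprod_gt0.
Qed.

(** For [k < m] and [d = n - m], dividing by the common factors leaves [1 - q^(d+1+m-k) = q^(d+1) (1
    - q^(m-k)) + (1 - q^(d+1))]. For [k = m] the term with [k.+1] vanishes, and for [k > m] all
    terms do. *)
Lemma law_coef_rec m n k : (m <= n)%N -> (k <= n)%N ->
  law_coef m n.+1 k = law_coef m n.+1 k.+1 + (1 - q ^+ n.+1) * q ^+ k * law_coef m n k.
Proof.
move=> /subnKC <-; move: (n - m)%N => {n} d kn; rewrite /law_coef.
have C0 i : C i != 0 by rewrite gt_eqF// Cprod_gt0.
have q0 i : 1 - q ^+ i.+1 != 0 by rewrite subr_eq0 gt_eqF// pinvX_lt1.
case: (ltngtP k m) => [km|km|->]; last 2 first.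
- by rewrite !mulr0 addr0.
- rewrite -!addnS !addKn subnn Cprod0 add0r mulSn exprD !addnS !CprodS.
  by field; rewrite ?C0 ?q0.
have [e ->] : exists e, m = (k + e.+1)%N by exists (m - k.+1)%N; rewrite -addSnnS subnKC.
have -> : ((k + e.+1 + d).+1 - (k + e.+1) = d.+1)%N by lia.
have -> : ((k + e.+1 + d).+1 - k = (e.+1 + d).+1)%N by lia.
have -> : ((k + e.+1 + d).+1 - k.+1 = (e.+1 + d))%N by lia.
have -> : (k + e.+1 + d - (k + e.+1) = d)%N by lia.
have -> : (k + e.+1 + d - k = e.+1 + d)%N by lia.
have -> : (k + e.+1 - k = e.+1)%N by lia.
have -> : (k + e.+1 - k.+1 = e)%N by lia.
rewrite (CprodS (k + e.+1 + d)) (CprodS (e.+1 + d)) (CprodS e) (CprodS d).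
have -> : q ^+ (k + e.+1 + d).+1 = q ^+ k * q ^+ e.+1 * q ^+ d.+1.
  by rewrite -!exprD; congr (_ ^+ _); lia.
have -> : q ^+ (e.+1 + d).+1 = q ^+ e.+1 * q ^+ d.+1.
  by rewrite -!exprD; congr (_ ^+ _); lia.
have -> : q ^+ (d.+1 * k) = q ^+ (d * k) * q ^+ k.
  by rewrite -!exprD; congr (_ ^+ _); lia.
have -> : q ^+ (d.+1 * k.+1) = q ^+ (d * k) * q ^+ k * q ^+ d.+1.
  by rewrite -!exprD; congr (_ ^+ _); lia.
have := q0 e; have := q0 d; have := C0 e; have := C0 d; have := C0 (k + e.+1)%N.
move: (C (k + e.+1 + d)) (C (e.+1 + d)) (C e) (C d) (C (k + e.+1)%N).
move: (q ^+ k) (q ^+ e.+1) (q ^+ d.+1) (q ^+ (d * k)) => a u v w c1 c2 c3 c4 c5.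
by move=> h1 h2 h3 h4 h5; field; rewrite h1 h2 h3 h4 h5.
Qed.

End CprodTheory.

(** * Limits of mixtures *)

Section Mixture.
Context d (T : measurableType d) (R : realType).
Variables (P : nat -> probability T R) (S : nat -> set T).
Variables (K : nat -> nat -> R) (c b : nat -> R).
Hypotheses (mS : forall m, measurable (S m)) (tS : trivIset setT S)
  (cS : \bigcup_m S m = setT).
Hypothesis K_ge0 : forall n m, 0 <= K n m.
Hypothesis PK : forall n m A, measurable A -> A `<=` S m -> (m <= n)%N ->
  P n A = ((K n m)%:E * P m A)%E.
Hypothesis Kc : forall m, K n m @[n --> \oo] --> c m.
Hypothesis Pb : forall n m, (P n (S m) <= (b m)%:E)%E.
Hypothesis b_sum : (\sum_(m <oo) (b m)%:E < +oo)%E.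

Let c_ge0 m : 0 <= c m.
Proof.
rewrite -(cvg_lim (@Rhausdorff R) (@Kc m)); apply: limr_ge.
  by apply/cvg_ex; exists (c m).
exact: nearW.
Qed.

Let b_ge0 m : 0 <= b m.
Proof. by rewrite -lee_fin; apply: le_trans (Pb 0 m); exact: measure_ge0. Qed.

(** The expected limit on the piece [S m]. That the pieces have total mass 1 is not assumed; it
    comes out in [mixture_limit]. *)
Let component m := mscale (NngNum (c_ge0 m)) (mrestr (P m) (mS m)).

Let componentE k A : component k A = ((c k)%:E * P k (A `&` S k))%E.
Proof. by []. Qed.

Let mix := mseries component 0.

Let mix_component m A : measurable A -> A `<=` S m -> mix A = ((c m)%:E * P m A)%E.
Proof.
move=> mA AS; rewrite /mix /mseries (@nneseriesD1 _ _ m)//.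
rewrite eseries0 ?adde0 => [|k _ km].
  by apply: (etrans (componentE m A)); rewrite setIidl.
apply: (etrans (componentE k A)); rewrite (_ : A `&` S k = set0) ?measure0 ?mule0//.
rewrite -subset0 => z [/AS Sm Sk]; move/trivIsetP : tS => /(_ k m I I km) <-.
by split.
Qed.

Section Integral.
Variables (f : T -> R) (M : R).
Hypotheses (mf : measurable_fun setT f) (f0 : forall z, 0 <= f z)
  (fM : forall z, f z <= M).

Let mf' (D : set T) : measurable D -> measurable_fun D (fun z => (f z)%:E).
Proof.
by move=> mD; apply/measurable_EFinP; apply: measurable_funS mf.
Qed.

Let integral_scale (m1 m2 : {measure set T -> \bar R}) (k : R) m : 0 <= k ->
  (forall A, measurable A -> A `<=` S m -> m1 A = (k%:E * m2 A)%E) ->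
  (\int[m1]_(z in S m) (f z)%:E = k%:E * \int[m2]_(z in S m) (f z)%:E)%E.
Proof.
move=> k0 m12; rewrite -(ge0_integral_mscale m2 (mS m) (NngNum k0))//=; last 2 first.
- exact: mf'.
- by move=> z _; rewrite lee_fin.
by apply: eq_measure_integral => A mA AS; rewrite m12.
Qed.

Let integral_split (m : {measure set T -> \bar R}) :
  (\int[m]_z (f z)%:E = \sum_(k <oo) \int[m]_(z in S k) (f z)%:E)%E.
Proof.
rewrite -cS ge0_integral_bigcup//; first by rewrite cS; exact: mf'.
by move=> z _; rewrite lee_fin.
Qed.

Let a n m : \bar R := (\int[P n]_(z in S m) (f z)%:E)%E.

Let a_ge0 n m : (0 <= a n m)%E.
Proof. by apply: integral_ge0 => z _; rewrite lee_fin. Qed.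

Let a_le n m : (a n m <= (M * b m)%:E)%E.
Proof.
apply: (@le_trans _ _ (\int[P n]_(z in S m) (cst M%:E) z)%E).
  apply: ge0_le_integral => //= [z _||z _]; rewrite ?lee_fin//.
  exact: mf'.
rewrite integral_cst// EFinM lee_wpmul2l//.
- by rewrite lee_fin (le_trans (f0 point)).
- exact: Pb.
Qed.

Let a_cvg m : a n m @[n --> \oo] --> (\int[mix]_(z in S m) (f z)%:E)%E.
Proof.
rewrite (integral_scale (c_ge0 m) (@mix_component m)).
have am : a m m \is a fin_num.
  by rewrite ge0_fin_numE//; apply: le_lt_trans (a_le m m) _; rewrite ltry.
rewrite -/(a m m) -(fineK am) -EFinM.
have : (K n m * fine (a m m))%:E @[n --> \oo] --> (c m * fine (a m m))%:E.
  apply/fine_cvgP; split; first exact: nearW.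
  rewrite (_ : fine \o _ = (fun n => K n m * cst (fine (a m m)) n)); last exact/funext.
  by apply: cvgM; [exact: Kc|exact: cvg_cst].
(* [PK] applies once [m <= n], hence to almost all [n]. *)
apply: cvg_trans; apply: near_eq_cvg; near=> n.
rewrite EFinM fineK//; apply/esym/(integral_scale (K_ge0 n m)) => A mA AS.
by apply: PK => //; near: n; exact: nbhs_infty_ge.
Unshelve. all: by end_near. Qed.

(** Splitting along the [S m] turns each integral into a series, that is, an integral for the
    counting measure; dominated convergence with bound [M * b m] then exchanges limit and sum. *)
Lemma mix_cvg : (\int[P n]_z (f z)%:E @[n --> \oo] --> \int[mix]_z (f z)%:E)%E.
Proof.
have count (u : nat -> \bar R) : (forall k, 0 <= u k)%E ->
    (\sum_(k <oo) u k)%E = (\int[@counting _ R]_k u k)%E.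
  by move=> u0; rewrite ge0_integral_count.
rewrite integral_split count; last first.
  by move=> k; apply: integral_ge0 => z _; rewrite lee_fin.
rewrite (_ : (fun n => _) = (fun n => \int[@counting _ R]_m a n m)%E); last first.
  by apply/funext => n; rewrite integral_split count// => k; exact: a_ge0.
have M0 : 0 <= M := le_trans (f0 point) (fM point).
have [] := @dominated_convergence _ _ R (@counting _ R) setT measurableT a
  (fun m => \int[mix]_(z in S m) (f z)%:E)%E (fun m => (M * b m)%:E) => //.
- by apply: aeW => m _; exact: a_cvg.
- apply/integrableP; split=> //.
  rewrite -count => [|k]; last exact: abse_ge0.
  rewrite (eq_eseriesr (g := fun m => (M%:E * (b m)%:E)%E)) => [|m _].
    rewrite nneseriesZl//; last by move=> k _; rewrite lee_fin.
    by apply: lte_mul_pinfty => //; rewrite lee_fin.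
  by rewrite -EFinM gee0_abs// lee_fin mulr_ge0.
- by apply: aeW => m n _; rewrite gee0_abs.
Qed.

End Integral.

Lemma mixture_limit : exists mu : probability T R,
  (forall (f : T -> R) M, measurable_fun setT f -> (forall z, 0 <= f z) ->
     (forall z, f z <= M) ->
     (\int[P n]_z (f z)%:E @[n --> \oo] --> \int[mu]_z (f z)%:E)%E) /\
  (forall m A, measurable A -> A `<=` S m -> mu A = ((c m)%:E * P m A)%E).
Proof.
(* The constant 1 has integral 1 against every [P n], so the limit of these integrals, the mass of
   [mix], is 1. *)
have mix1 : mix setT = 1%E.
  have E (m : {measure set T -> \bar R}) : (\int[m]_z (cst (1 : R) z)%:E = m setT)%E.
    by rewrite -[LHS]/(\int[m]_(z in setT) cst 1%:E z)%E integral_cst// mul1e.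
  have h : (cst 1%E : nat -> \bar R) @ \oo --> mix setT.
    rewrite -[mix _]E (_ : cst 1%E = (fun n => \int[P n]_z (cst (1 : R) z)%:E)%E).
      apply: (@mix_cvg (cst 1) 1) => // z; exact: ler01.
    by apply/funext => n; apply: esym; apply: (etrans (E _)); exact: probability_setT.
  exact: (cvg_unique (@ereal_hausdorff R) h (cvg_cst _)).
(* [mnormalize] bundles [mix] as a probability: dividing by the mass 1 changes nothing, and the
   fallback [P 0] is not reached. *)
have normE A : mnormalize mix (P 0) A = mix A.
  rewrite -[LHS]/((if (mix setT == 0%E) || (mix setT == +oo%E) then (fun U => P 0 U)
    else (fun U => mix U * ((fine (mix setT))^-1%R)%:E)%E) A).
  by rewrite mix1 onee_eq0 /= invr1 mule1.
exists (mnormalize mix (P 0)); split=> [f M mf f0 fM|m A mA AS]; last first.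
  by apply: (etrans (normE A)); exact: mix_component.
rewrite (eq_measure_integral mix) => [|A _ _]; last exact: normE.
exact: mix_cvg.
Qed.

End Mixture.

Section CprodLimit.
Variables (R : realType) (p : nat) (p2 : (2 < p)%N).
Local Notation C := (Cprod R p).
Local Notation q := (p%:R^-1 : R).

Let p1 : (1 < p)%N. Proof. exact: ltnW. Qed.

Lemma Cprod_le1 k : C k <= 1.
Proof.
elim: k => [|l IHl]; first by rewrite Cprod0.
have qk : 0 <= q ^+ l.+1 by rewrite exprn_ge0// ltW// pinv_gt0.
by rewrite CprodS (le_trans _ IHl)// ler_piMr ?gerBl// ltW// Cprod_gt0.
Qed.

(* The factor [1 + q ^+ k] makes the induction close; it needs [3 * q <= 1]. *)
Lemma Cprod_ge k : 2^-1 * (1 + q ^+ k) <= C k.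
Proof.
elim: k => [|k IH]; first by [rewrite Cprod0 expr0; lra].
have q0 : 0 < q := pinv_gt0 R p1.
have q3 : 3 * q ^+ k.+1 <= q ^+ k.
  have q1 : 3 * q <= 1 by rewrite ler_pdivrMr ?ltr0n ?mul1r ?ler_nat// ltnW.
  by rewrite exprS mulrA ler_piMl// exprn_ge0// ltW.
have C1 := Cprod_le1 k.
have qk : 0 <= q ^+ k.+1 by rewrite exprn_ge0// ltW.
rewrite CprodS; nra.
Qed.

Lemma Cprod_ge_half k : 2^-1 <= C k.
Proof.
apply: le_trans (Cprod_ge k); rewrite ler_pMr ?invr_gt0// lerDl.
by rewrite exprn_ge0// ltW// pinv_gt0.
Qed.

Lemma Cprod_cvg : C k @[k --> \oo] --> Cinf R p.
Proof.
apply: nonincreasing_is_cvgn.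
  apply/nonincreasing_seqP => k; have qk : 0 <= q ^+ k.+1 by rewrite exprn_ge0// ltW// pinv_gt0.
  by rewrite CprodS ler_piMr ?gerBl// ltW// Cprod_gt0.
by exists 2^-1 => _ [k _ <-]; exact: Cprod_ge_half.
Qed.

Lemma Cinf_gt0 : 0 < Cinf R p.
Proof.
apply: (@lt_le_trans _ _ 2^-1); first by rewrite invr_gt0.
apply: limr_ge; first by apply/cvg_ex; exists (Cinf R p); exact: Cprod_cvg.
by apply: nearW => k; exact: Cprod_ge_half.
Qed.

Lemma Cprod_quot_cvg m :
  C n ^+ 2 / (C m ^+ 2 * C (n - m)) @[n --> \oo] --> Cinf R p / C m ^+ 2.
Proof.
have L0 : Cinf R p != 0 by rewrite gt_eqF// Cinf_gt0.
have Cm0 : C m != 0 by rewrite gt_eqF// Cprod_gt0.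
(* An extra [Cinf] above and below lets numerator and denominator converge separately. *)
have -> : Cinf R p / C m ^+ 2 = Cinf R p ^+ 2 / (C m ^+ 2 * Cinf R p).
  by field; rewrite L0 Cm0.
apply: cvgM; first by rewrite expr2; apply: cvgM; exact: Cprod_cvg.
apply: cvgV; first by rewrite mulf_neq0// expf_neq0.
apply: cvgM; first exact: cvg_cst.
by have := Cprod_cvg; rewrite -(cvg_centern m).
Qed.

(** The 8 is 1 / (1/4 * 1/2): [C n] is at most 1, while [C m] and [C (n - m)] are at least 1/2. *)
Lemma Cprod_quot_le m n : C n ^+ 2 / (C m ^+ 2 * C (n - m)) <= 8.
Proof.
rewrite ler_pdivrMr; last by rewrite mulr_gt0 ?exprn_gt0// Cprod_gt0.
have h1 := Cprod_le1 n; have h2 := Cprod_ge_half m; have h3 := Cprod_ge_half (n - m).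
have h4 : C n ^+ 2 <= 1 by rewrite exprn_ile1// ltW// Cprod_gt0.
have h5 : 4^-1 <= C m ^+ 2 by rewrite expr2; nra.
nra.
Qed.

Lemma geometric_sum_lty (a : R) : 0 <= a ->
  (\sum_(m <oo) (a * q ^+ m)%:E < +oo)%E.
Proof.
move=> a0; apply: (@le_lt_trans _ _ (a * (1 - q)^-1)%:E); last exact: ltry.
apply: lime_le.
  by apply: is_cvg_nneseries => n _ _; rewrite lee_fin mulr_ge0// exprn_ge0// ltW// pinv_gt0.
apply: nearW => n; rewrite sumEFin lee_fin.
apply: geometric_le_lim => //; first exact: pinv_gt0.
by rewrite gtr0_norm ?pinv_gt0// pinv_lt1.
Qed.

End CprodLimit.

(** * Continuous and bounded test functions *)

Lemma indic_clopen_continuous (R : realType) (T : topologicalType) (U : set T) :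
  clopen U -> continuous (\1_U : T -> R).
Proof.
move=> [oU cU] z; have [Uz|Uz] := pselect (U z).
  apply: (@near_cst_continuous T R 1); apply: (filterS _ (open_nbhs_nbhs (conj oU Uz))).
  by move=> y Uy; rewrite indicE mem_set.
apply: (@near_cst_continuous T R 0).
apply: (filterS _ (open_nbhs_nbhs (conj (closed_openC cU) Uz))).
by move=> y Uy; rewrite indicE memNset.
Qed.

Lemma continuous_borel_measurable (R : realType) (T : ptopologicalType) (f : T -> R) :
  continuous f -> measurable_fun [set: borel T] (f : borel T -> R).
Proof.
move=> fc; apply: (measurability _ (RGenOpens.measurableE R)).
move=> _ [_ [a [b ->]] <-]; rewrite setTI; apply: sub_gen_smallest.
have /continuousP := fc; apply; exact: interval_open.
Qed.

(** Adding a bound [K] makes [f] nonnegative; as all the measures have mass 1, every integral moves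
    by exactly [K]. *)
Lemma cvg_integral_bounded d (T : measurableType d) (R : realType)
    (P : nat -> probability T R) (mu : probability T R) :
  (forall (f : T -> R) M, measurable_fun setT f -> (forall z, 0 <= f z) ->
     (forall z, f z <= M) ->
     (\int[P n]_z (f z)%:E @[n --> \oo] --> \int[mu]_z (f z)%:E)%E) ->
  forall (f : T -> R), measurable_fun setT f -> bounded_fun f ->
     (\int[P n]_z (f z)%:E @[n --> \oo] --> \int[mu]_z (f z)%:E)%E.
Proof.
move=> lim f mf bf; have [M [_ /(_ (M + 1))]] := bf.
rewrite ltrDl ltr01 => /(_ isT) fM; pose K := M + 1.
have fK z : `|f z| <= K by exact: fM.
have shift (Q : probability T R) :
    (\int[Q]_z (f z)%:E = \int[Q]_z (f z + K)%:E - K%:E)%E.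
  have If : Q.-integrable setT (EFin \o f).
    apply: measurable_bounded_integrable => //.
    exact: (le_lt_trans (probability_le1 Q measurableT) (ltry 1)).
  have IK : Q.-integrable setT (EFin \o cst K).
    by apply: finite_measure_integrable_cst.
  have -> : (\int[Q]_z (f z + K)%:E = \int[Q]_z (f z)%:E + K%:E)%E.
    under eq_integral do rewrite EFinD.
    rewrite (integralD_EFin measurableT If IK); congr (_ + _)%E.
    rewrite -[LHS]/(\int[Q]_(z in setT) cst K%:E z)%E integral_cst//.
    apply: (etrans _ (mule1 _)); congr (_ * _)%E; exact: probability_setT.
  by rewrite addeK.
rewrite shift (_ : (fun n => _) = fun n => (\int[P n]_z (f z + K)%:E - K%:E)%E); last first.
  by apply/funext => n; exact: shift.
apply: cvgeB; first by rewrite fin_num_adde_defl.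
  apply: (lim (fun z => f z + K) (K + K)) => [|z|z]; first exact: measurable_funD.
    by have := fK z; rewrite ler_norml; lra.
  by have := fK z; rewrite ler_norml; lra.
exact: cvg_cst.
Qed.

Local Close Scope ring_scope.
Local Open Scope group_scope.

(** * Open normal subgroups of profinite groups *)

Lemma compact_totally_disconnected_zero_dimensional (T : topologicalType) :
  hausdorff_space T -> compact [set: T] -> totally_disconnected [set: T] ->
  zero_dimensional T.
Proof.
move=> hT cT dT x y /eqP xy; apply: contrapT => /forallNP noU.
(* [Q] is the quasi-component of [x]. In a compact Hausdorff space it is connected, hence equal to
   {x}, which contradicts [Qy]. *)
pose Q := \bigcap_(U in [set U : set T | clopen U /\ U x]) U.
have Qx : Q x by move=> U [].
have Qy : Q y.
  by move=> U [clU Ux]; apply: contrapT => Uy; apply: (noU U).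
have clQ : closed Q by apply: closed_bigI => U [[]].
pose FF := filter_from [set D : set T | D x /\ clopen D] id.
have FFF : Filter FF.
  apply: filter_from_filter; first by exists setT; split => //; exact: clopenT.
  by move=> A B [? ?] [? ?]; exists (A `&` B) => //; split=> //; exact: clopenI.
have PF : ProperFilter FF by apply: filter_from_proper; move=> ? [? _]; exists x.
have QO (O : set T) : open O -> Q `<=` O -> exists D, [/\ clopen D, D x & D `<=` O].
  move=> oO QO; have /(iffLR (compact_near_coveringP _)) : compact (~` O).
    by apply: (subclosed_compact _ cT) => //; exact: open_closedC.
  move=> /(_ _ _ setC (powerset_filter_from_filter PF))[].
    move=> z nOz; have [C [[oC cC] Cx Cy]] : exists C, [/\ clopen C, C x & ~ C z].
      apply: contrapT => /forallNP h; apply/nOz/QO => U [clU Ux].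
      by apply: contrapT => Uz; apply: (h U).
    exists (~` C, [set U | U `<=` C]); first split.
    - by apply: open_nbhs_nbhs; split => //; exact: closed_openC.
    - apply/near_powerset_filter_fromP; first by move=> ? ?; exact: subset_trans.
      by exists C => //; exists C.
    - by case=> i j [? /subsetC]; apply.
  move=> D [DF _ [C DC]]/(_ _ DC)/subsetC2 CO.
  by have [E [Ex clE] EC] := DF _ DC; exists E; split => //; apply: subset_trans CO.
suff cQ : connected Q.
  have : connected_component [set: T] x y by exists Q.
  by rewrite dT// => /esym.
(* By normality the two pieces of a splitting of [Q] lie in disjoint open sets [U] and [V]. A clopen
   set around [x] inside their union meets [U] in a clopen set around [x], which must contain all of
   [Q]. *)
apply/connectedP => E [E0 QE [s1 s2]].
wlog Ex : E E0 QE s1 s2 / E false x.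
  move=> wl; have := Qx; rewrite QE => -[Ex|Ex]; first exact: (wl E).
  apply: (wl (fun b => E (~~ b))) => //=; first by rewrite setUC.
    by rewrite setIC.
  by rewrite setIC.
have clE b : closed (E b).
  move=> z zE; have : Q z.
    by apply: clQ; apply: closure_subset zE; rewrite QE; case: b => ? ?; [right|left].
  rewrite QE; case: b zE => zE [] // Ez; exfalso.
    by suff : set0 z by []; rewrite -s2.
  by suff : set0 z by []; rewrite -s1.
have : set_nbhs (E false) (~` E true).
  apply/set_nbhsP; exists (~` E true); split=> //; first exact: closed_openC.
  move=> z Ez Ez'; suff : set0 z by []; rewrite -s1.
  by split=> //; exact: subset_closure.
move=> /(compact_normal hT cT (clE false)) [W /set_nbhsP[U [oU EU UW]] WE].
pose V := ~` closure W.
have oV : open V by apply: closed_openC; exact: closed_closure.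
have EV : E true `<=` V by move=> z Ez /WE.
have UV : U `&` V = set0.
  by rewrite -subset0 => z [/UW /subset_closure].
have [||D [[oD cD] Dx DUV]] := QO (U `|` V); first exact: openU.
  by rewrite QE; apply: setUSS.
have DU : clopen (D `&` U).
  split; first exact: openI.
  have -> : D `&` U = D `&` ~` V.
    apply/seteqP; split=> z [Dz Uz]; split=> //.
      by move=> Vz; suff : set0 z by []; rewrite -UV.
    by have [] := DUV _ Dz.
  by apply: closedI => //; exact: open_closedC.
have [z Ez] := E0 true.
have Qz : Q z by rewrite QE; right.
have [_ Uz] : (D `&` U) z by apply: Qz; split=> //; split=> //; exact: EU.
by suff : set0 z by []; rewrite -UV; split=> //; exact: EV.
Qed.

Section OpenNormal.
Variable G : topGroupType.
Implicit Types (N : set G) (x y : G).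

Lemma mulgl_continuous x : continuous (fun t : G => x * t).
Proof. by apply: mulg_continuous2 => t; [exact: cvg_cst|exact: cvg_id]. Qed.

Lemma mulgr_continuous x : continuous (fun t : G => t * x).
Proof. by apply: mulg_continuous2 => t; [exact: cvg_id|exact: cvg_cst]. Qed.

Lemma subgroup_open N : is_subgroup N -> nbhs 1 N -> open N.
Proof.
move=> [_ NM _] N1; rewrite openE => x Nx.
have : nbhs x ((fun t : G => x^-1 * t) @^-1` N).
  by apply: mulgl_continuous; rewrite mulVg.
apply: filterS => y /= Ny.
by rewrite -(mulVKg x y); exact: NM.
Qed.

Lemma subgroup_open_closed N : is_subgroup N -> open N -> closed N.
Proof.
move=> [N1 NM NV] oN; rewrite -[N]setCK; apply: open_closedC.
rewrite openE => x Nx; have : nbhs x ((fun t : G => x^-1 * t) @^-1` N).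
  by apply: mulgl_continuous; rewrite mulVg; apply: open_nbhs_nbhs.
apply: filterS => y /= Ny Ny'; apply: Nx.
by rewrite -(mulVKg y x) -[y^-1 * x]invgK invgM invgK; apply/NM/NV.
Qed.

(** Take a clopen [C] around 1 inside [U]. The [V] below, the stabiliser of [C] under right
    translation, is a subgroup inside [C], and [N] is its normal core. Compactness, of [C] and then
    of [G], keeps both neighbourhoods of 1. *)
Lemma open_normal_basis (U : set G) :
  compact [set: G] -> hausdorff_space G -> totally_disconnected [set: G] ->
  nbhs 1 U -> exists N, [/\ open N, is_normal N & N `<=` U].
Proof.
move=> cG hG dG U1.
have zG := compact_totally_disconnected_zero_dimensional hG cG dG.
have [C [C1 [oC cC]] CU] := zero_dimensional_cvg hG zG cG U1.
have /(iffLR (compact_near_coveringP _)) cpC : compact C.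
  exact: (subclosed_compact cC cG).
pose V := [set v | C `<=` fun u => C (u * v) /\ C (u * v^-1)].
have sV : is_subgroup V.
  split=> [u Cu|v w Vv Vw u Cu|v Vv u Cu]; rewrite ?invg1 ?mulg1 ?invgK//.
    split; first by rewrite mulgA; apply Vw; apply Vv.
    by rewrite invgM mulgA; apply Vv; apply Vw.
  by have [] := Vv _ Cu.
have V1 : nbhs 1 V.
  apply: cpC => u Cu.
  have nC : nbhs u C by apply: open_nbhs_nbhs.
  apply: filterI.
    have : nbhs (u * 1) C by rewrite mulg1.
    exact: (@mulg_continuous G (u, 1)).
  have : nbhs (u * 1^-1) C by rewrite invg1 mulg1.
  apply: (@mulg_continuous2 (G * G)%type G fst (fun z => z.2^-1) _ _ (u, 1)).
    by move=> z; exact: cvg_fst.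
  move=> z; apply: (@continuous_comp _ _ _ snd (fun x : G => x^-1)).
    exact: cvg_snd.
  exact: invg_continuous.
pose N := [set v | [set: G] `<=` fun g => V (v ^ g)].
have sN : is_subgroup N.
  have [V1' VM VV] := sV.
  split=> [g _|v w Nv Nw g _|v Nv g _].
  - by rewrite conj1g.
  - by rewrite conjMg; apply: VM; [exact: Nv|exact: Nw].
  - by rewrite conjVg; apply: VV; exact: Nv.
have N1 : nbhs 1 N.
  move/(iffLR (compact_near_coveringP _)) : cG; apply => g _.
  have : nbhs (1 ^ g) V by rewrite conj1g.
  apply: (@mulg_continuous2 (G * G)%type G (fun z => z.1^-1) (fun z => z.2 * z.1)
    _ _ (g, 1)).
    move=> z; apply: (@continuous_comp _ _ _ fst (fun x : G => x^-1)).
      exact: cvg_fst.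
    exact: invg_continuous.
  by apply: mulg_continuous2 => z; [exact: cvg_snd|exact: cvg_fst].
exists N; split; first exact: subgroup_open.
- by split=> // x y Nx g _; rewrite -conjgM; exact: Nx.
- move=> v Nv; apply: CU; have := Nv 1 I; rewrite conjg1 => /(_ _ C1) [].
  by rewrite mul1g.
Qed.

End OpenNormal.

Lemma is_normalI (G : groupType) (M N : set G) :
  is_normal M -> is_normal N -> is_normal (M `&` N).
Proof.
move=> [[M1 MM MV] MJ] [[N1 NM NV] NJ]; split=> [|x y [Mx Nx]].
  split=> // [x y [Mx Nx] [My Ny]|x [Mx Nx]].
    by split; [exact: MM|exact: NM].
  by split; [exact: MV|exact: NV].
by split; [exact: MJ|exact: NJ].
Qed.

Lemma open_sigma_normal_basis (G : sigmaGroupType) (U : set G) :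
  compact [set: G] -> hausdorff_space G -> totally_disconnected [set: G] ->
  nbhs 1 U -> exists N : sigmaNormal G, open (sn_set N) /\ sn_set N `<=` U.
Proof.
move=> cG hG dG /(open_normal_basis cG hG dG) [M [oM nM MU]].
have nS : is_normal (sigma @^-1` M).
  have [[M1 MM MV] MJ] := nM; have s1 := morph1g (@sigmaM G).
  have sV := morphVg (@sigmaM G).
  split=> [|x y]; first split=> [|x y|x]; rewrite /= ?s1 ?sigmaM ?sV//.
  - exact: MM.
  - exact: MV.
  - by rewrite /conjg ?sigmaM ?sV; exact: MJ.
have sS x : (M `&` (sigma @^-1` M)) x -> (M `&` (sigma @^-1` M)) (sigma x).
  by move=> [/= Mx Msx]; rewrite /= sigmaK.
exists (SigmaNormal (is_normalI nM nS) sS); split=> /=; last by move=> x [/MU].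
apply: openI => //; apply: open_comp => // x _; exact: sigma_continuous.
Qed.

(** * Nonzero elements of H^1 and quotients of pro-p groups *)

Lemma finite_pgroup_proper_hom (Q : groupType) (p k : nat) (K : set Q) :
  prime p -> ([set: Q] #= `I_(p ^ k)%N)%card -> is_subgroup K -> K != setT ->
  exists f : Q -> 'F_p, [/\ {morph f : x y / x * y >-> (x + y)%R},
    forall x, K x -> f x = 0%R & exists x, f x != 0%R].
Proof.
move=> pp /card_set_bijP[f [fI finj fsurj]] [K1 KM _] KT.
have lt_f x : (f x < p ^ k)%N by exact: fI.
pose f' (x : Q) : 'I_(p ^ k)%N := Ordinal (lt_f x).
have f'inj : injective f'.
  by move=> x y /(congr1 val) /= e; apply: finj; rewrite ?inE.
have f'surj (i : 'I_(p ^ k)%N) : exists x, f' x = i.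
  by have [x _ xi] := fsurj i (ltn_ord i); exists x; exact: val_inj.
pose g i : Q := projT1 (cid (f'surj i)).
have gK : cancel g f' by move=> i; rewrite /g; case: cid.
have fK : cancel f' g by move=> x; apply: f'inj.
pose gT : finGroupType := fin_group fK.
have cT : #|gT| = (p ^ k)%N.
  rewrite -(card_ord (p ^ k)%N); apply: (bij_eq_card (f := f' : gT -> _)).
  by exists g.
pose A : {set gT} := finset (fun x : gT => `[< K x >]).
have inA x : (x \in A) = `[< K x >] by rewrite finset.in_set.
have gA : group_set A.
  apply/group_setP; split=> [|x y]; first by rewrite inA; apply/asboolP.
  by rewrite !inA => /asboolP Kx /asboolP Ky; apply/asboolP; exact: (KM x y Kx Ky).
have [||h [hM hK [x hx]]] := @pgroup_proper_hom gT p (Group gA) pp.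
- by rewrite /pgroup cardsT cT pnatX pnat_id.
- apply: contra_neq KT => /(congr1 (@gval gT))/= AT.
  rewrite -subTset => x _; have : (x : gT) \in A by rewrite AT finset.in_setT.
  by rewrite inA => /asboolP.
exists h; split=> // [y Ky|]; last by exists x.
by apply: hK; rewrite inA; exact/asboolP.
Qed.

Section QuotientTheory.
Variables (G : sigmaGroupType) (M : sigmaNormal G).
Local Notation N := (sn_set M).

Lemma sn1 : N 1. Proof. by have [[]] := sn_normal M. Qed.

Lemma proj_surj (a : quot M) : exists x, proj M x = a.
Proof. by exists (lift_quot a); exact: lift_quotK. Qed.

Lemma proj1 : proj M 1 = 1. Proof. exact: morph1g (@projM G M). Qed.

Lemma projV : {morph proj M : x / x^-1}.
Proof. exact: morphVg (@projM G M). Qed.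

Lemma proj_eq1 x : proj M x = 1 <-> N x.
Proof.
rewrite -proj1; split=> [/esym/projP|Nx]; first by rewrite invg1 mul1g.
by apply/esym/projP; rewrite invg1 mul1g.
Qed.

Lemma card_quot : ([set: quot M] #= cosets N)%card.
Proof.
have -> : cosets N = (fun a => proj M @^-1` [set a]) @` [set: quot M].
  apply/seteqP; split=> [_ [x _ <-]|_ [a _ <-]].
    exists (proj M x) => //; apply/seteqP; split=> [y /= /esym/projP Ny|_ [z Nz <-]].
      by exists (x^-1 * y); rewrite // mulVKg.
    by apply/esym/projP; rewrite mulKg.
  have [x <-] := proj_surj a.
  exists x => //; apply/seteqP; split=> [_ [z Nz <-]|y /= /esym/projP Ny].
    by apply/esym/projP; rewrite mulKg.
  by exists (x^-1 * y); rewrite // mulVKg.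
apply/card_esym/inj_card_eq => a b _ _ ab.
have [x xa] := proj_surj a; suff : (proj M @^-1` [set b]) x by rewrite /= xa.
by rewrite -ab.
Qed.

Lemma quot_open (A : set (quot M)) : open (proj M @^-1` A) -> open A.
Proof. by []. Qed.

Lemma quot_closed (A : set (quot M)) : closed (proj M @^-1` A) -> closed A.
Proof.
move=> cA; rewrite -[A]setCK; apply: open_closedC; apply: quot_open.
by rewrite preimage_setC; exact: closed_openC.
Qed.

Lemma quot_discrete (A : set (quot M)) : open N -> open A.
Proof.
move=> oN; apply: quot_open.
have -> : proj M @^-1` A = \bigcup_(a in A) \bigcup_(x in proj M @^-1` [set a])
    ((fun t => x^-1 * t) @^-1` N).
  apply/seteqP; split=> [x Ax|x [a Aa [y /= ya Nxy]]].
    by exists (proj M x) => //; exists x => //=; rewrite mulVg; exact: sn1.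
  have e : proj M y = proj M x by apply/projP.
  by rewrite /= -e ya.
apply: bigcup_open => a _; apply: bigcup_open => x _.
by apply: open_comp => // t _; exact: mulgl_continuous.
Qed.

End QuotientTheory.

Section ProP.
Variables (p : nat) (pp : prime p).

(* Every proper closed subgroup lies in the kernel of some nonzero element of
   H^1: this replaces the Frattini argument throughout. *)
Lemma pro_p_proper_H1 (G : sigmaGroupType) (K : set G) :
  is_pro_p p G -> closed K -> is_subgroup K -> K != setT ->
  exists f : G -> 'F_p,
    [/\ H1 f, forall x, K x -> f x = 0%R & exists x, f x != 0%R].
Proof.
move=> [cG hG dG pG] cK [K1 KM KV] KT.
have [g Kg] : exists g, ~ K g.
  apply/not_existsP => h; case/eqP: KT; rewrite -subTset => x _.
  by apply: contrapT => /(h x).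
(* [N] is chosen with the coset g[N] disjoint from [K], so that the image of [K] in the finite
   quotient still misses that of [g]. *)
have : nbhs 1 ((fun t => g * t) @^-1` (~` K)).
  apply: mulgl_continuous; rewrite mulg1; apply: open_nbhs_nbhs; split=> //.
  exact: closed_openC.
move=> /(open_sigma_normal_basis cG hG dG) [N [oN NK]].
have [k ck] := pG _ oN (sn_normal N).
have cQ := card_eq_trans (card_quot N) ck.
have sK : is_subgroup (proj N @` K).
  split=> [|_ _ [x Kx <-] [y Ky <-]|_ [x Kx <-]].
  - by exists 1 => //; exact: proj1.
  - by exists (x * y); [exact: KM|exact: projM].
  - by exists x^-1; [exact: KV|exact: projV].
have [|f [fM fK [a fa]]] := finite_pgroup_proper_hom pp cQ sK.
  apply/eqP => e; have : (proj N @` K) (proj N g) by rewrite e.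
  move=> [x Kx xg]. have Ngx := (iffLR (projP _ _ _) (esym xg)); apply: (NK _ Ngx).
  by rewrite mulVKg.
exists (f \o proj N); split=> [|x Kx|].
- split=> [x y|c] /=; first by rewrite projM fM.
  apply: (@open_comp _ _ (proj N) (f @^-1` [set c])) => [x _|].
    exact: proj_continuous.
  exact: (quot_discrete _ oN).
- by apply: fK; exists x.
- by have [x xa] := proj_surj a; exists x; rewrite /= xa.
Qed.

End ProP.

Lemma bij_card_setT (T U : Type) (f : T -> U) (g : U -> T) :
  cancel f g -> cancel g f -> ([set: T] #= [set: U])%card.
Proof.
move=> fK gK; have <- : f @` [set: T] = setT.
  by rewrite -subTset => y _; exists (g y).
by apply/card_esym/inj_card_eq => x y _ _ /(can_inj fK).
Qed.

Lemma card_setT_fin (T : finType) : ([set: T] #= `I_#|T|)%card.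
Proof.
apply: card_eq_trans (card_esym card_II).
exact: bij_card_setT (@enum_rankK T) (@enum_valK T).
Qed.

(** F_p as a discrete group in multiplicative notation: elements of H^1 become continuous morphisms
    into a pro-p group, to which the universal property of the free group applies. *)
Definition Fp_group (p : nat) : Type := discrete_topology 'F_p.

Section FpGroup.
Variable p : nat.
Local Notation T := (Fp_group p).
Implicit Types x y : T.

HB.instance Definition _ := DiscreteTopology.on T.

HB.instance Definition _ := isGroup.Build T
  (@addrA 'F_p) (@add0r 'F_p) (@addr0 'F_p) (@addNr 'F_p) (@addrN 'F_p).

Lemma FpM x y : x * y = (x + y)%R :> 'F_p. Proof. by []. Qed.

Let Fp_mulg_continuous : continuous (fun z : T * T => z.1 * z.2).
Proof.
move=> [a b] U /= /principal_filterP Uab.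
exists ([set a], [set b]); last by move=> [_ _] [/= -> ->].
by split; apply/principal_filterP.
Qed.

Let Fp_invg_continuous : continuous (fun x : T => x^-1).
Proof.
by move=> a U /= /principal_filterP Ua; apply/principal_filterP.
Qed.

HB.instance Definition _ := Group_isTopologicalGroup.Build T
  Fp_mulg_continuous Fp_invg_continuous.

Lemma finite_setT_Fp : finite_set [set: T].
Proof. exact: (@finite_finset 'F_p). Qed.

Lemma is_pro_p_Fp : prime p -> is_pro_p p T.
Proof.
move=> pp; split.
- exact: finite_compact finite_setT_Fp.
- exact: discrete_hausdorff.
- apply: zero_dimension_totally_disconnected; exact: discrete_zero_dimension.
- move=> N _ [[N1 NM NV] _].
  (* A subgroup of F_p is trivial, with p cosets, or contains a nonzero [a], whose multiples exhaust
     F_p. *)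
  have [N0|[a Na a0]] : N = [set 1] \/ exists2 a, N a & a != 1.
    have [h|/existsNP[a /not_implyP[Na a1]]] :=
      pselect (forall a, N a -> a = 1); last by right; exists a => //; exact/eqP.
    by left; apply/seteqP; split=> [a /h //|_ ->].
    exists 1%N; rewrite N0 expn1.
    have -> : cosets [set (1 : T)] = set1 @` [set: T].
      by apply/seteqP; split=> _ [x _ <-]; exists x; rewrite // image_set1 mulg1.
    apply: (card_eq_trans (inj_card_eq _)).
      by move=> x y _ _ e; have : [set x] x by []; rewrite e.
    by rewrite -[X in `I_X](card_Fp pp); exact: (@card_setT_fin 'F_p).
  exists 0%N; rewrite expn0; have NT : N = setT.
    rewrite -subTset => x _.
    have NX k : N (a ^+ k).
      by elim: k => [|k IH]; [rewrite expg0|rewrite expgS; exact: NM].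
    have aX k : a ^+ k = (k%:R * a)%R :> 'F_p.
      by elim: k => [|k IH]; rewrite ?mul0r// expgS FpM IH -natr1 mulrDl mul1r addrC.
    have := NX (nat_of_ord ((x : 'F_p) / a)%R); rewrite (_ : _ ^+ _ = x)//.
    by rewrite aX natr_Zp mulfVK.
  have -> : cosets N = [set setT]; last exact: card_set1.
  rewrite NT; apply/seteqP; split=> [_ [x _ <-]|_ ->].
    by apply/seteqP; split=> // y _; exists (x^-1 * y); rewrite // mulVKg.
  by exists 1 => //; apply/seteqP; split=> // y _; exists y; rewrite // mul1g.
Qed.

End FpGroup.

(** * Free pro-p groups and elimination of a generator *)

Section ClosedGen.
Variable G : topGroupType.
Implicit Types A N : set G.

Lemma closed_gen_closed A : closed (closed_gen A).
Proof. by apply: closed_bigI => N [[]]. Qed.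

Lemma closed_gen_min A N : closed N -> is_subgroup N -> A `<=` N ->
  closed_gen A `<=` N.
Proof. by move=> cN sN AN z; apply. Qed.

Lemma sub_closed_gen A : A `<=` closed_gen A.
Proof. exact: sub_gen_smallest. Qed.

End ClosedGen.

Lemma range_subgroup (G H : groupType) (f : G -> H) :
  {morph f : a b / a * b} -> is_subgroup (range f).
Proof.
move=> fM; split=> [|_ _ [a _ <-] [b _ <-]|_ [a _ <-]].
- by exists 1 => //; exact: morph1g.
- by exists (a * b).
- by exists a^-1 => //; exact: morphVg.
Qed.

Lemma range_closed (G H : topGroupType) (f : G -> H) :
  compact [set: G] -> hausdorff_space H -> continuous f -> closed (range f).
Proof.
move=> cG hH fc; apply: compact_closed => //.
apply: continuous_compact => //; exact: continuous_subspaceT.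
Qed.

Lemma continuous_comp2 (S T U : topologicalType) (f : S -> T) (g : T -> U) :
  continuous f -> continuous g -> continuous (g \o f).
Proof. by move=> fc gc s; apply: continuous_comp; [exact: fc|exact: gc]. Qed.

Section H1Theory.
Variable p : nat.
Implicit Types G H : topGroupType.

Lemma H1P G (f : G -> 'F_p) :
  H1 f <-> {morph (f : G -> Fp_group p) : a b / a * b} /\
           continuous (f : G -> Fp_group p).
Proof.
split=> -[fM fo]; split=> //.
  move=> a U /principal_filterP Ua.
  have : nbhs a (f @^-1` [set f a]) by apply: open_nbhs_nbhs; split; [exact: fo|].
  by apply: filterS => b /= ->.
move=> c; apply: (@open_comp _ _ (f : G -> Fp_group p) [set c]) => [a _|].
  exact: fo.
exact: discrete_open.
Qed.

Lemma H1_comp G H (g : G -> H) (f : H -> 'F_p) :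
  {morph g : a b / a * b} -> continuous g -> H1 f -> H1 (f \o g).
Proof.
move=> gM gc /H1P[fM fc]; apply/H1P; split=> [a b /=|].
  by rewrite gM fM.
exact: continuous_comp2.
Qed.

Lemma H1_ker G (f : G -> 'F_p) : H1 f ->
  [/\ open (f @^-1` [set 0%R]), closed (f @^-1` [set 0%R]) &
      is_normal (f @^-1` [set 0%R])].
Proof.
move=> [fM fo]; have f1 : f 1 = 0%R.
  by apply: (addrI (f 1)); rewrite -fM mulg1 addr0.
have fV a : f a^-1 = (- f a)%R.
  by apply: (addrI (f a)); rewrite -fM mulgV f1 subrr.
have sK : is_subgroup (f @^-1` [set 0%R]).
  split=> [//|a b /= fa fb|a /= fa]; first by rewrite fM fa fb addr0.
  by rewrite fV fa oppr0.
split=> //; first by apply: subgroup_open_closed => //; exact: fo.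
by split=> // a b /= fa; rewrite /conjg !fM fV fa add0r addNr.
Qed.

Lemma H1_1 G (f : G -> 'F_p) : H1 f -> f 1 = 0%R.
Proof. by move=> /H1_ker[_ _ [[]]]. Qed.

Lemma H1_V G (f : G -> 'F_p) a : H1 f -> f a^-1 = (- f a)%R.
Proof.
by move=> fH; apply: (addrI (f a)); rewrite -fH.1 mulgV H1_1// subrr.
Qed.

Lemma H1_lin G (n : nat) (c : 'I_n -> 'F_p) (b : 'I_n -> G -> 'F_p) :
  (forall i, H1 (b i)) -> H1 (fun a => \sum_(i < n) c i * b i a)%R.
Proof.
move=> bH; split=> [a a'|d].
  by rewrite -big_split/=; apply: eq_bigr => i _; rewrite (bH i).1 mulrDr.
rewrite openE => a /= ad.
have : \forall a' \near a, forall i, b i a' = b i a.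
  by apply: filter_forall => i; apply: open_nbhs_nbhs; split=> //; exact: (bH i).2.
by apply: filterS => a' ha' /=; rewrite -ad; apply: eq_bigr => i _; rewrite ha'.
Qed.

End H1Theory.

Section FreeProP.
Variables (p : nat) (pp : prime p) (F : nat -> sigmaGroupType).
Variable x : forall n, 'I_n -> F n.
Arguments x : clear implicits.
Hypothesis F_free : forall n, is_free_pro_p p (x n).
Hypothesis sigma_x : forall n (i : 'I_n), sigma (x n i) = (x n i)^-1.

Let proF n : is_pro_p p (F n). Proof. exact: (F_free n).1. Qed.

Lemma free_hom n (H : topGroupType) (y : 'I_n -> H) : is_pro_p p H ->
  exists f : F n -> H,
    [/\ {morph f : a b / a * b}, continuous f & forall i, f (x n i) = y i].
Proof. by move=> /((F_free n).2 H y) [f [fP _]]; exists f. Qed.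

Lemma free_hom_unique n (H : topGroupType) (f g : F n -> H) : is_pro_p p H ->
  {morph f : a b / a * b} -> continuous f ->
  {morph g : a b / a * b} -> continuous g ->
  (forall i, f (x n i) = g (x n i)) -> f = g.
Proof.
move=> pH fM fc gM gc fg.
have [h [_ hu]] := (F_free n).2 H (fun i => g (x n i)) pH.
by rewrite -(hu f)// (hu g).
Qed.

Lemma H1_free_unique n (f g : F n -> 'F_p) :
  H1 f -> H1 g -> (forall i, f (x n i) = g (x n i)) -> f = g.
Proof.
move=> /H1P[fM fc] /H1P[gM gc] fg.
exact: (@free_hom_unique n (Fp_group p) f g (is_pro_p_Fp pp)).
Qed.

Lemma crd_exists n : exists e : 'I_n -> F n -> 'F_p,
  (forall j, H1 (e j)) /\ forall i j, e j (x n i) = (i == j)%:R%R.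
Proof.
have eP j : {e : F n -> 'F_p | H1 e /\ forall i, e (x n i) = (i == j)%:R%R}.
  apply: cid; have [e [eM ec ex]] := @free_hom n (Fp_group p)
    (fun i => (i == j)%:R%R : 'F_p) (is_pro_p_Fp pp).
  by exists e; split=> //; apply/H1P.
exists (fun j => projT1 (eP j)); split=> [j|i j]; first by case: (eP j) => /= e [].
by case: (eP j) => /= e [].
Qed.

(** The basis of H^1 dual to the free generators, that is, linear coordinates on [F n] modulo its
    Frattini subgroup. *)
Definition crd n : 'I_n -> F n -> 'F_p := projT1 (cid (crd_exists n)).

Lemma crd_H1 n j : H1 (@crd n j).
Proof. by rewrite /crd; case: cid => /= e []. Qed.

Lemma crd_x n i j : @crd n j (x n i) = (i == j)%:R%R.
Proof. by rewrite /crd; case: cid => /= e []. Qed.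

Lemma H1_crd_x n (c : 'I_n -> 'F_p) i :
  (\sum_(j < n) c j * crd j (x n i))%R = c i.
Proof.
rewrite (bigD1 i)//= crd_x eqxx mulr1 big1 ?addr0// => j ji.
by rewrite crd_x eq_sym (negbTE ji) mulr0.
Qed.

Lemma H1_crd n (f : F n -> 'F_p) : H1 f ->
  forall a, f a = (\sum_(j < n) f (x n j) * crd j a)%R.
Proof.
move=> fH; apply/funeqP; apply: H1_free_unique => //.
  by apply: H1_lin => i; exact: crd_H1.
by move=> i; rewrite H1_crd_x.
Qed.

Lemma H1_free0 n (f : F n -> 'F_p) : H1 f ->
  (forall i, f (x n i) = 0%R) -> forall a, f a = 0%R.
Proof. by move=> fH fx a; rewrite (H1_crd fH) big1// => j _; rewrite fx mul0r. Qed.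

Lemma closed_full n (K : set (F n)) : closed K -> is_subgroup K ->
  (forall f : F n -> 'F_p, H1 f -> (forall a, K a -> f a = 0%R) ->
    forall a, f a = 0%R) -> K = setT.
Proof.
move=> cK sK h; apply: contrapT => /eqP/(pro_p_proper_H1 pp (proF n) cK sK).
by move=> [f [fH fK] [a /eqP]]; apply; exact: h.
Qed.

Lemma free_generated n : closed_gen (range (x n)) = [set: F n].
Proof.
apply: closed_full; [exact: closed_gen_closed|exact: closed_gen_subgroup|].
move=> f fH fx; apply: H1_free0 => // i; apply: fx.
apply: sub_closed_gen. by exists i.
Qed.

(** [sigma] inverts the generators, hence acts by -1 on H^1; consequently every class modulo [Phi]
    is odd. *)
Lemma crd_sigma n j (a : F n) : crd j (sigma a) = (- crd j a)%R.
Proof.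
have := H1_crd (H1_comp (@sigmaM (F n)) (@sigma_continuous (F n)) (crd_H1 j)) a.
move=> /= ->; rewrite (bigD1 j)//= big1 ?addr0 => [|i ij].
  by rewrite sigma_x H1_V ?crd_x ?eqxx ?mulN1r//; exact: crd_H1.
by rewrite sigma_x H1_V ?crd_x ?(negbTE ij) ?oppr0 ?mul0r//; exact: crd_H1.
Qed.

Definition Phi n : set (F n) := [set a | forall j, crd j a = 0%R].

Lemma H1_Phi n (f : F n -> 'F_p) a : H1 f -> Phi a -> f a = 0%R.
Proof. by move=> fH aP; rewrite (H1_crd fH) big1// => j _; rewrite aP mulr0. Qed.

Definition normal_closure (G : topGroupType) (A : set G) : set G :=
  closed_gen [set z | exists2 a, A a & exists y, z = a ^ y].

Lemma normal_closure_normal (G : topGroupType) (A : set G) :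
  is_normal (normal_closure A).
Proof.
split=> [|a b]; first exact: closed_gen_subgroup.
apply: (@closed_gen_homo _ _ (fun t => t ^ b)) => [c d||].
- exact: conjMg.
- exact: conjg_continuous.
- move=> _ [c Ac [y ->]]; apply: sub_closed_gen; exists c => //.
  by exists (y * b); rewrite conjgM.
Qed.

Lemma sub_normal_closure (G : topGroupType) (A : set G) : A `<=` normal_closure A.
Proof.
by move=> a Aa; apply: sub_closed_gen; exists a => //; exists 1; rewrite conjg1.
Qed.

Lemma normal_closure_homo (G H : topGroupType) (f : G -> H) A B :
  {morph f : a b / a * b} -> continuous f -> (forall a, A a -> B (f a)) ->
  forall a, normal_closure A a -> normal_closure B (f a).
Proof.
move=> fM fc fAB; apply: closed_gen_homo => // _ [a Aa [y ->]].
rewrite /conjg !fM (morphVg fM) -/(conjg _ _); apply: (normal_closure_normal B).2.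
by apply: sub_normal_closure; apply: fAB.
Qed.

Lemma normal_closure_min (G : topGroupType) (A N : set G) :
  closed N -> is_normal N -> A `<=` N -> normal_closure A `<=` N.
Proof.
move=> cN [sN NJ] AN; apply: closed_gen_min => // _ [a Aa [y ->]].
exact/NJ/AN.
Qed.

(** The elements that [g] fixes modulo [N] form a closed subgroup, and this one contains the
    generators. *)
Lemma congr_mod_generated n (g : F n -> F n) (N : set (F n)) :
  {morph g : a b / a * b} -> continuous g -> closed N -> is_normal N ->
  (forall i, N ((g (x n i))^-1 * x n i)) -> forall a, N ((g a)^-1 * a).
Proof.
move=> gM gc cN [[N1 NM NV] NJ] gx a.
have : closed_gen (range (x n)) a by rewrite free_generated.
apply: (@closed_gen_min _ _ [set a | N ((g a)^-1 * a)]).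
- apply: (@preimage_closed _ _ (fun a => (g a)^-1 * a) N) => //.
  move=> b _; apply: mulg_continuous2 => c; last exact: cvg_id.
  by apply: (continuous_comp2 gc); exact: invg_continuous.
- split=> [|b c /= Nb Nc|b /= Nb].
  + by rewrite /= (morph1g gM) mulg1 invg1.
  + rewrite gM invgM.
    have -> : (g c)^-1 * (g b)^-1 * (b * c) =
        ((g b)^-1 * b) ^ (g c) * ((g c)^-1 * c).
      by rewrite /conjg !mulgA mulgK.
    by apply: NM => //; exact: NJ.
  + have := NJ _ (g b)^-1 (NV _ Nb); rewrite (morphVg gM) invgK invgM invgK.
    by rewrite /conjg invgK !mulgA mulgK.
- by move=> _ [i _ <-]; exact: gx.
Qed.

(** Exchanging [x_j] for [a] keeps a basis of H^1, so the endomorphism [f] doing this is surjective.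
    Lifting the generators along [f] gives a section [g]; it is surjective by the same test on H^1,
    so [f] and [g] are mutually inverse. *)
Lemma free_automorphism n (j : 'I_n) (a : F n) : crd j a != 0%R ->
  exists f g : F n -> F n, [/\ {morph f : b c / b * c}, {morph g : b c / b * c},
    continuous f, continuous g & [/\ cancel f g, cancel g f, f (x n j) = a &
      forall i, i != j -> f (x n i) = x n i]].
Proof.
move=> aj; have [_ [cF hF _ _]] := (proF n, proF n).
have [f [fM fc fx]] := free_hom (fun i => if i == j then a else x n i) (proF n).
have fj : f (x n j) = a by rewrite fx eqxx.
have fi i : i != j -> f (x n i) = x n i by move=> ij; rewrite fx (negbTE ij).
have f_surj : range f = setT.
  apply: closed_full; [exact: range_closed|exact: range_subgroup|move=> h hH hf].
  have hi i : i != j -> h (x n i) = 0%R by move=> ij; rewrite -fi//; apply: hf; exists (x n i).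
  have hj : h (x n j) = 0%R.
    have : h a = 0%R by rewrite -fj; apply: hf; exists (x n j).
    rewrite (H1_crd hH) (bigD1 j)//= big1 ?addr0 => [|i /hi ->]; last by rewrite mul0r.
    by move/eqP; rewrite mulf_eq0 (negbTE aj) orbF => /eqP.
  by apply: H1_free0 => // i; have [->|/hi] := eqVneq i j.
have z_ex i : exists z, f z = x n i.
  by have : (range f) (x n i) by [rewrite f_surj]; case=> z _; exists z.
pose z i := projT1 (cid (z_ex i)).
have fz i : f (z i) = x n i by rewrite /z; case: cid.
have [g [gM gc gx]] := free_hom z (proF n).
have fgK : cancel g f.
  apply/funeqP; apply: (free_hom_unique (proF n)) => //.
  - by move=> b c /=; rewrite gM fM.
  - exact: continuous_comp2.
  - by move=> b; exact: cvg_id.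
  - by move=> i; rewrite /= gx fz.
have g_surj : range g = setT.
  apply: closed_full; [exact: range_closed|exact: range_subgroup|move=> h hH hg].
  (* [h] is the pullback along [f] of the functional [k] found by solving a
     triangular linear system, and [k] kills the [x_i] since [h] kills [g]. *)
  pose c i := if i == j then ((h (x n j) - \sum_(i < n | i != j) h (x n i) * crd i a)
    / crd j a)%R else h (x n i).
  pose k b := (\sum_(i < n) c i * crd i b)%R.
  have kH : H1 k by apply: H1_lin => i; exact: crd_H1.
  have kf : h = k \o f.
    apply: H1_free_unique => //; first exact: H1_comp.
    move=> i /=; have [->|ij] := eqVneq i j; last by rewrite fi// /k H1_crd_x /c (negbTE ij).
    rewrite fj /k (bigD1 j)//= {1}/c eqxx divfK//.
    by under eq_bigr => l lj do rewrite /c (negbTE lj); rewrite subrK.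
  have k0 i : k (x n i) = 0%R.
    by have : h (z i) = 0%R by [rewrite -gx; apply: hg; exists (x n i)]; rewrite kf /= fz.
  by move=> b; rewrite kf /=; exact: H1_free0.
exists f, g; split=> //; split=> // b.
by have : range g b by [rewrite g_surj]; case=> c _ <-; rewrite fgK.
Qed.

(** [sigma \o f \o sigma] is a morphism that agrees with [f] on the generators. *)
Lemma free_hom_sigma n (H : sigmaGroupType) (f : F n -> H) : is_pro_p p H ->
  {morph f : b c / b * c} -> continuous f ->
  (forall i, sigma (f (x n i)) = (f (x n i))^-1) ->
  {morph f : b / sigma b >-> sigma b}.
Proof.
move=> pH fM fc fx b; rewrite -[f (sigma b)](@sigmaK H); congr sigma.
apply: (congr1 (fun g => g b) (_ : sigma \o f \o sigma = f)).
apply: (free_hom_unique pH) => //.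
- by move=> c d /=; rewrite sigmaM fM sigmaM.
- apply: (continuous_comp2 _ (@sigma_continuous H)).
  exact: (continuous_comp2 (@sigma_continuous _) fc).
- by move=> i /=; rewrite sigma_x (morphVg fM) (morphVg (@sigmaM H)) fx invgK.
Qed.

(** An automorphism [u] with [u x_j = a], equivariant because [a] is odd, reduces the claim to
    killing the free generator [x_j]. Projecting [x_j] away and including again fixes the generators
    modulo the normal closure of [x_j], and [u] carries this closure into that of [a]. *)
Lemma free_reduction n (a : F n.+1) : sigma a = a^-1 -> ~ Phi a ->
  exists (f : F n.+1 -> F n) (g : F n -> F n.+1),
    [/\ {morph f : b c / b * c}, {morph g : b c / b * c}, continuous f,
        continuous g & [/\ {morph f : b / sigma b >-> sigma b}, cancel g f,
          f a = 1 & forall b, normal_closure [set a] ((g (f b))^-1 * b)]].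
Proof.
move=> sa /existsNP[j /eqP aj].
have [u [v [uM vM uc vc [uK vK uj ui]]]] := free_automorphism aj.
have [f [fM fc fx]] := @free_hom n.+1 (F n)
  (fun i => if unlift j i is Some k then x n k else 1) (proF n).
have [g [gM gc gx]] := free_hom (fun k => x n.+1 (lift j k)) (proF n.+1).
have fj : f (x n.+1 j) = 1 by rewrite fx unlift_none.
have fl k : f (x n.+1 (lift j k)) = x n k by rewrite fx liftK.
have gfK : cancel g f.
  apply/funeqP; apply: (free_hom_unique (proF n)) => //.
  - by move=> b c /=; rewrite gM fM.
  - exact: continuous_comp2.
  - by move=> b; exact: cvg_id.
  - by move=> i; rewrite /= gx fl.
have usig : {morph u : b / sigma b >-> sigma b}.
  apply: (free_hom_sigma (proF n.+1)) => // i.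
  by have [->|ij] := eqVneq i j; rewrite ?uj// ui// sigma_x.
have vsig : {morph v : b / sigma b >-> sigma b}.
  by move=> b; apply: (can_inj uK); rewrite usig !vK.
have fsig : {morph f : b / sigma b >-> sigma b}.
  apply: (free_hom_sigma (proF n)) => // i; rewrite fx.
  by case: (unlift j i) => [k|]; rewrite ?sigma_x// (morph1g (@sigmaM _)) invg1.
exists (f \o v), (u \o g); split=> [b c|b c|||].
- by rewrite /= vM fM.
- by rewrite /= gM uM.
- exact: continuous_comp2.
- exact: continuous_comp2.
split=> [b|b||b] /=.
- by rewrite vsig fsig.
- by rewrite uK gfK.
- by rewrite -uj uK fj.
have gf_mod : forall b, normal_closure [set x n.+1 j] ((g (f b))^-1 * b).
  apply: (congr_mod_generated (g := g \o f)) => [c d||||i] /=.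
  - by rewrite fM gM.
  - exact: continuous_comp2.
  - exact: closed_gen_closed.
  - exact: normal_closure_normal.
  case: (unliftP j i) => [k|] ->.
    by rewrite fl gx mulVg; have [[]] := normal_closure_normal [set x n.+1 j].
  by rewrite fj (morph1g gM) invg1 mul1g; exact: sub_normal_closure.
have /= := normal_closure_homo (B := [set a]) uM uc _ (gf_mod (v b)).
by rewrite uM (morphVg uM) vK; apply => _ ->.
Qed.

End FreeProP.

(** * The Zassenhaus filtration *)

Section FiniteIndex.
Variable G : topGroupType.
Implicit Types (A L N K : set G) (s t : seq G).

(** Finite index by means of a list of representatives, which may repeat cosets and may leave
    [A]. *)
Definition coset_cover N A t := forall g, A g -> exists2 u, u \in t & N (u^-1 * g).

Lemma closed_cosets N t : closed N ->
  closed [set g | exists2 u, u \in t & N (u^-1 * g)].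
Proof.
move=> cN; have -> : [set g | exists2 u, u \in t & N (u^-1 * g)] =
    \bigcup_(u in [set` t]) ((fun g => u^-1 * g) @^-1` N).
  by apply/seteqP; split=> g [u ut Nu]; exists u.
apply: closed_bigcup => [|u _]; first exact: finite_seq.
apply: preimage_closed => // g _.
exact: mulgl_continuous.
Qed.

Lemma coset_cover_open N t : is_subgroup N -> closed N ->
  coset_cover N [set: G] t -> open N.
Proof.
move=> [N1 NM NV] cN tN; rewrite -[N]setCK; apply: closed_openC.
suff -> : ~` N = [set g | exists2 u, u \in [seq u <- t | `[< ~ N u >]] & N (u^-1 * g)].
  exact: closed_cosets.
apply/seteqP; split=> [g Ng|g [u]].
  have [//|u ut Nug] := tN g; exists u => //; rewrite mem_filter ut andbT.
  by apply/asboolP => Nu; apply: Ng; rewrite -(mulVKg u g); exact: NM.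
rewrite mem_filter => /andP[/asboolP Nu _] Nug Ng; apply: Nu.
by rewrite -(mulVKg g u) -[g^-1 * u]invgK invgM invgK; exact/NM/NV.
Qed.

(** The [g] for which left multiplication by [g] and by its inverse preserves [L] form a closed
    subgroup; apply such a [g] to 1. *)
Lemma closed_gen_stable A L : closed L -> L 1 ->
  (forall a l, A a -> L l -> L (a * l) /\ L (a^-1 * l)) -> closed_gen A `<=` L.
Proof.
move=> cL L1 AL g Ag.
pose S : set G := [set g | L `<=` fun l => L (g * l) /\ L (g^-1 * l)].
suff /(_ _ L1)[] : S g by rewrite mulg1.
suff : closed_gen A `<=` S by apply.
apply: closed_gen_min => [||a Aa l Ll]; last exact: AL.
- have -> : S = \bigcap_(l in L) (((fun g => g * l) @^-1` L) `&`
                                  ((fun g => g^-1 * l) @^-1` L)).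
    by apply/seteqP; split=> h Sh l /Sh.
  apply: closed_bigI => l _; apply: closedI; apply: preimage_closed => // h _.
    exact: mulgr_continuous.
  exact: (continuous_comp2 (@invg_continuous G) (@mulgr_continuous G l)) h.
- split=> [l Ll|a b Sa Sb l Ll|a Sa l Ll]; first by rewrite invg1 mul1g.
  + by rewrite invgM -!mulgA; split; [apply Sa; apply Sb|apply Sb; apply Sa].
  + by rewrite invgK; have [] := Sa _ Ll.
Qed.

(* Schreier's lemma. *)
Lemma coset_cover_generated N s t : closed N -> is_subgroup N ->
  closed_gen [set` s] = [set: G] -> coset_cover N [set: G] t ->
  exists s', N = closed_gen [set` s'].
Proof.
move=> cN [N1 NM NV] sG tN.
have /choice[rep repP] : forall g, exists u, u \in t /\ N (u^-1 * g).
  by move=> g; have [//|u ut Nu] := tN g; exists u.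
pose sV := s ++ map (fun a => a^-1) s.
(* The Schreier generators, together with the representatives lying in [N]: the list [t] need not
   represent [N] by 1. Inverses of [s] are included because [closed_gen_stable] translates by them
   too. *)
pose s' := [seq (rep (a * u))^-1 * (a * u) | a <- sV, u <- t] ++
           [seq u <- t | `[< N u >]].
exists s'; set K := closed_gen [set` s'].
have [K1 KM KV] : is_subgroup K := closed_gen_subgroup _.
have NK : K `<=` N.
  apply: closed_gen_min => // a /=; rewrite mem_cat => /orP[|].
    by move=> /allpairsP[[b u] /= [bs ut ->]]; exact: (repP _).2.
  by rewrite mem_filter => /andP[/asboolP].
have tK u : u \in t -> N u -> K u.
  move=> ut Nu; apply: sub_closed_gen; rewrite /= mem_cat mem_filter ut andbT.
  by apply/orP; right; apply/asboolP.
pose L : set G := [set g | exists2 u, u \in t & K (u^-1 * g)].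
have aL a l : a \in sV -> L l -> L (a * l).
  move=> aV [u ut Kul]; exists (rep (a * u)); first exact: (repP _).1.
  rewrite (_ : _ * _ = (rep (a * u))^-1 * (a * u) * (u^-1 * l)); last first.
    by rewrite !mulgA mulgK.
  apply: KM => //; apply: sub_closed_gen => /=; rewrite mem_cat.
  by apply/orP; left; apply/allpairsP; exists (a, u).
have LT : [set: G] `<=` L.
  rewrite -sG; apply: closed_gen_stable => [||a l /= sa Ll].
  - by apply: closed_cosets; exact: closed_gen_closed.
  - have [ut Nu] := repP 1; exists (rep 1) => //; rewrite mulg1.
    have N1' : N (rep 1) by rewrite -[rep 1]invgK; apply: NV; rewrite -[_^-1]mulg1.
    by apply: KV; exact: tK.
  - by split; apply: aL => //; rewrite mem_cat ?sa// map_f ?orbT.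
apply/seteqP; split=> // g Ng; have [u ut Kug] := LT g I.
rewrite -(mulVKg u g); apply: KM => //; apply: tK => //.
by rewrite -(mulVKg g u) -[g^-1 * u]invgK invgM invgK; apply/NM/NV/NK.
Qed.

(** Generators are adjoined one at a time to a closed subgroup [L] between [K] and [N]. Modulo [K]
    the group is abelian of exponent p, so adjoining [a] gives the union of the p cosets of [L] by
    powers of [a], again closed. Being closed, the last [L] contains all of [N]. *)
Lemma elementary_abelian_cover (p : nat) (N K : set G) s : (0 < p)%N ->
  closed K -> is_normal K -> K `<=` N -> N = closed_gen [set` s] ->
  (forall a b, N a -> N b -> K [~ a, b]) -> (forall a, N a -> K (a ^+ p)) ->
  exists t, coset_cover K N t.
Proof.
move=> p0 cK [[K1 KM KV] KJ] KN NE Kcom Kp.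
have [N1 NM NV] : is_subgroup N by rewrite NE; exact: closed_gen_subgroup.
have NX a k : N a -> N (a ^+ k).
  by move=> Na; elim: k => [|k IH]; [rewrite expg0|rewrite expgS; exact: NM].
have KX a k : K a -> K (a ^+ k).
  by move=> Ka; elim: k => [|k IH]; [rewrite expg0|rewrite expgS; exact: KM].
suff H : forall s', {subset s' <= s} -> exists (L : set G) t,
    [/\ closed L /\ is_subgroup L, L `<=` N, K `<=` L, (forall a, a \in s' -> L a) &
        coset_cover K L t].
  have [//|L [t [[cL sL] LN KL sL' tL]]] := H s; exists t => g Ng; apply: tL.
  by rewrite NE in Ng; apply: (closed_gen_min cL sL _ Ng).
elim=> [|a s' IH] ss.
  exists K, [:: 1]; split=> //.
  by move=> g Kg; exists 1; rewrite ?inE// invg1 mul1g.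
have [|L [t [[cL [L1 LM LV]] LN KL sL tL]]] := IH.
  by move=> b bs; apply: ss; rewrite inE bs orbT.
have Na : N a by rewrite NE; apply: sub_closed_gen => /=; apply: ss; exact: mem_head.
have LX k l : L l -> L (a ^+ (k * p) * l) /\ L ((a ^+ (k * p))^-1 * l).
  move=> Ll; have Kk : K (a ^+ (k * p)).
    by rewrite mulnC expgM; apply/KX/Kp.
  by split; apply: LM => //; apply: KL => //; exact: KV.
have swap b l h : N b -> L l -> L (l * (b * h)) -> L (b * (l * h)).
  move=> Nb Ll Llbh; have -> : b * (l * h) = l * (b * h) * [~ b, l] ^ h.
    by rewrite /commg /conjg !mulgA !mulgK mulgV mul1g.
  by apply: LM => //; apply/KL/KJ/Kcom => //; exact: LN.
pose L' : set G := [set g | exists k, L (a ^+ k * g)].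
have L'p g : L' g -> exists2 k, (k < p)%N & L (a ^+ k * g).
  move=> [k Lkg]; exists (k %% p)%N; first by rewrite ltn_mod.
  have [_] := LX (k %/ p)%N _ Lkg.
  by rewrite {2}(divn_eq k p) expgD -mulgA mulKg.
exists L', [seq (a ^+ k)^-1 * u | k <- iota 0 p, u <- t]; split.
- split; last split=> [|g h [k Lg] [m Lh]|g [k Lg]].
  + have -> : L' = \bigcup_(k in `I_p) ((fun g => a ^+ k * g) @^-1` L).
      by apply/seteqP; split=> [g /L'p[k kp Lg]|g [k _ Lg]]; exists k.
    apply: closed_bigcup => // k _; apply: preimage_closed => // g _.
    exact: mulgl_continuous.
  + by exists 0%N; rewrite mulg1 expg0.
  + exists (k + m)%N; rewrite addnC expgD -!mulgA (mulgA (a ^+ k)).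
    apply: swap => //; first exact: NX.
    exact: LM.
  + exists (k * p.-1)%N; have -> : g^-1 = (a ^+ k * g)^-1 * a ^+ k by rewrite invgM mulgVK.
    have e : (k * p.-1 + k = k * p)%N by rewrite -mulnSr prednK.
    apply: swap; [exact: NX|exact: LV|].
    rewrite -expgD e; apply: LM; first exact: LV.
    by have [] := LX k 1 L1; rewrite mulg1.
- move=> g [k Lg]; rewrite -(mulKg (a ^+ k) g); apply: NM; last exact: LN.
  exact/NV/NX.
- by move=> g Kg; exists 0%N; rewrite expg0 mul1g; exact: KL.
- move=> b; rewrite inE => /predU1P[->|bs]; last first.
    by exists 0%N; rewrite expg0 mul1g; exact: sL.
  exists p.-1; rewrite -expgSr prednK//; exact/KL/Kp.
- move=> g /L'p[k kp Lg]; have [u ut Ku] := tL _ Lg.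
  exists ((a ^+ k)^-1 * u); last by rewrite invgM invgK -mulgA.
  by apply/allpairsP; exists (k, u); rewrite mem_iota.
Qed.

End FiniteIndex.

Section ZassenhausTheory.
Variables (p : nat) (p1 : (1 < p)%N).
Implicit Types G H : topGroupType.

Lemma zass_closed G i : closed (zass p G i).
Proof.
case: (leqP i 1) => i1; first by rewrite zass1//; exact: closedT.
by rewrite zassE//; exact: closed_gen_closed.
Qed.

(** Strong induction on [i]. For the p-th powers, the ceiling of i/p grows by at most 1 when i does;
    for the commutators, one of the two indices is lowered by 1. *)
Lemma zassS G i : zass p G i.+1 `<=` zass p G i.
Proof.
have [n] := ubnP i; elim: n => // n IH in i *; rewrite ltnS => ilen.
case: (leqP i 1) => i1; first by rewrite [zass p G i]zass1.
have [sI sJ] := zass_normal p G i.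
rewrite (zassE G (i := i.+1))//; last exact: ltnW.
apply: closed_gen_min => //; first exact: zass_closed.
move=> _ [[a ca <-]|[j [k [j0 k0 jk [a [b [aj bk ->]]]]]]].
  rewrite (zassE G p1 i1); apply: sub_closed_gen; left; exists a => //.
  have c_i : ((i + p.-1) %/ p < i)%N by rewrite ltn_divLR; nia.
  have : ((i.+1 + p.-1) %/ p = (i + p.-1) %/ p \/
          (i.+1 + p.-1) %/ p = ((i + p.-1) %/ p).+1)%N.
    have : ((i + p.-1) %/ p <= (i.+1 + p.-1) %/ p)%N by apply: leq_div2r; lia.
    have : ((i.+1 + p.-1) %/ p <= ((i + p.-1) %/ p).+1)%N.
      have <- : ((i + p.-1 + p) %/ p = ((i + p.-1) %/ p).+1)%N.
        by rewrite divnDr ?dvdnn// divnn (ltnW p1) addn1.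
      by apply: leq_div2r; lia.
    lia.
  move=> [ce|ce]; rewrite ce in ca => //; apply: IH ca; lia.
(* An index [j = 1] cannot be lowered within the positive ones, but then [b] lies in D_i, which is
   normal. *)
case: j => // -[|j] in j0 k0 jk aj *.
  have ki : k = i by lia.
  have [_ iM iV] := sI; rewrite ki in bk.
  rewrite (_ : [~ a, b] = b^-1 ^ a * b); last by rewrite /commg /conjg !mulgA.
  by apply: iM => //; apply: sJ; exact: iV.
rewrite (zassE G p1 i1); apply: sub_closed_gen; right; exists j.+1, k.
split=> //; first by lia.
by exists a, b; split=> //; apply: IH => //; lia.
Qed.

Lemma zass_le G i j : (i <= j)%N -> zass p G j `<=` zass p G i.
Proof.
move=> /subnKC <-; elim: (j - i)%N => [|k IH]; first by rewrite addn0.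
by rewrite addnS; apply: subset_trans IH; exact: zassS.
Qed.

Lemma zass_com G i a b : (0 < i)%N -> zass p G i a -> zass p G i b ->
  zass p G i.+1 [~ a, b].
Proof.
move=> i0 ai bi; apply: (@zass_le G i.+1 (i + i)); first lia.
rewrite zassE//; last lia.
by apply: sub_closed_gen; right; exists i, i; split=> //; exists a, b.
Qed.

Lemma zass_exp G i a : (0 < i)%N -> zass p G i a -> zass p G i.+1 (a ^+ p).
Proof.
move=> i0 ai; rewrite zassE//; apply: sub_closed_gen; left; exists a => //.
apply: zass_le ai; rewrite -ltnS ltn_divLR; nia.
Qed.

(** By Schreier's lemma D_i is again topologically finitely generated, and D_i modulo D_(i+1) is
    elementary abelian. *)
Lemma zass_finite_index G (s : seq G) i : closed_gen [set` s] = [set: G] ->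
  exists t, coset_cover (zass p G i) [set: G] t.
Proof.
move=> sG; elim: i => [|i [t tG]].
  by exists [:: 1] => g _; exists 1; rewrite ?inE// zass1.
have [i0|i0] := posnP i.
  by exists [:: 1] => g _; exists 1; rewrite ?inE// i0 zass1.
have [s' sE] := coset_cover_generated (@zass_closed G i) (zass_subgroup p G i) sG tG.
have [t' t'G] : exists t', coset_cover (zass p G i.+1) (zass p G i) t'.
  apply: (elementary_abelian_cover (ltnW p1) _ _ _ sE).
  - exact: zass_closed.
  - exact: zass_normal.
  - exact: zassS.
  - by move=> a b; exact: zass_com.
  - by move=> a; exact: zass_exp.
exists [seq u * v | u <- t, v <- t'] => g _.
have [//|u ut ug] := tG g; have [v vt vg] := t'G _ ug.
exists (u * v); last by rewrite invgM -mulgA.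
by apply/allpairsP; exists (u, v).
Qed.

Lemma zass_open G (s : seq G) i : closed_gen [set` s] = [set: G] ->
  open (zass p G i).
Proof.
move=> sG; have [t] := zass_finite_index i sG; apply: coset_cover_open.
- exact: zass_subgroup.
- exact: zass_closed.
Qed.

(* For [k <= i] the image of D_k(G) in G/D_i(G) is closed, so it contains
   D_k(G/D_i(G)). *)
Lemma zass_quot_trivial (G : sigmaGroupType) i (a : quot (zassenhaus p G i)) :
  zass p _ i a -> a = 1.
Proof.
set M := zassenhaus p G i.
suff H k : (k <= i)%N -> zass p (quot M) k `<=` proj M @` zass p G k.
  by move=> /(H i (leqnn i))[b bi <-]; apply/proj_eq1.
have [n] := ubnP k; elim: n => // n IH in k *; rewrite ltnS => kn ki.
case: (leqP k 1) => k1.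
  by rewrite !zass1// => b _; have [c <-] := proj_surj b; exists c.
rewrite (zassE (quot M) p1 k1); have [N1 NM NV] := zass_subgroup p G k.
apply: closed_gen_min => [||z].
- apply: quot_closed.
  suff -> : proj M @^-1` (proj M @` zass p G k) = zass p G k by exact: zass_closed.
  apply/seteqP; split=> b; last by exists b.
  move=> [c ck /projP/(zass_le ki) cb]; rewrite -(mulVKg c b).
  exact: NM.
- split=> [|_ _ [b bk <-] [c ck <-]|_ [b bk <-]].
  + by exists 1 => //; exact: proj1.
  + by exists (b * c); [exact: NM|exact: projM].
  + by exists b^-1; [exact: NV|exact: projV].
have c_k : ((k + p.-1) %/ p < k)%N by rewrite ltn_divLR; nia.

move=> [[b bk <-]|[j [l [j0 l0 jl [b [c [bj cl ->]]]]]]].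
  have [||b' b'k <-] := IH _ _ _ _ bk; [lia|lia|].
  have pX m : proj M (b' ^+ m) = proj M b' ^+ m.
    by elim: m => [|m IHm]; rewrite ?expg0 ?proj1// !expgS projM IHm.
  exists (b' ^+ p); last exact: pX.
  by rewrite zassE//; apply: sub_closed_gen; left; exists b'.
have [||b' b'j <-] := IH _ _ _ _ bj; [lia|lia|].
have [||c' c'l <-] := IH _ _ _ _ cl; [lia|lia|].
exists [~ b', c']; last by rewrite /commg /conjg !projM !projV.
by rewrite zassE//; apply: sub_closed_gen; right; exists j, l; split=> //; exists b', c'.
Qed.

End ZassenhausTheory.

(** * Isomorphisms between quotients *)

Lemma quot_factor (G : sigmaGroupType) (M : sigmaNormal G) (H : topGroupType)
    (f : G -> H) :
  {morph f : a b / a * b} -> continuous f -> (forall a, sn_set M a -> f a = 1) ->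
  exists f' : quot M -> H, [/\ {morph f' : a b / a * b}, continuous f' &
    forall a, f' (proj M a) = f a].
Proof.
move=> fM fc fN; pose f' (a : quot M) := f (lift_quot a).
have f'P a : f' (proj M a) = f a.
  have /projP : proj M (lift_quot (proj M a)) = proj M a by rewrite lift_quotK.
  by move=> /fN; rewrite fM (morphVg fM) => /(canRL (mulKVg _)); rewrite mulg1.
exists f'; split=> // [a b|].
  have [[c <-] [d <-]] := (proj_surj a, proj_surj b).
  by rewrite -projM !f'P fM.
apply/continuousP => A oA; apply: quot_open.
rewrite (_ : _ @^-1` _ = f @^-1` A); first by apply: open_comp => // b _; exact: fc.
by apply/seteqP; split=> b /=; rewrite f'P.
Qed.

Lemma proj_sn (G : sigmaGroupType) (M : sigmaNormal G) a : sn_set M a -> proj M a = 1.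
Proof. by move/proj_eq1. Qed.

Lemma sigma_isomorphic_cover (G Q Q' : sigmaGroupType) (q : G -> Q) (q' : G -> Q')
    (f : Q -> Q') (g : Q' -> Q) :
  (forall a, exists b, q b = a) -> (forall a, exists b, q' b = a) ->
  {morph q : a / sigma a >-> sigma a} -> {morph q' : a / sigma a >-> sigma a} ->
  {morph f : a b / a * b} -> continuous f -> continuous g ->
  (forall a, f (q a) = q' a) -> (forall a, g (q' a) = q a) ->
  sigma_isomorphic Q Q'.
Proof.
move=> qs q's qS q'S fM fc gc fq gq'; exists f, g; split=> //.
  by move=> a; have [b <-] := qs a; rewrite -qS !fq q'S.
split=> a; first by have [b <-] := qs a; rewrite fq gq'.
by have [b <-] := q's a; rewrite gq' fq.
Qed.

Lemma quot_isomorphic (G H : sigmaGroupType) (M : sigmaNormal G) (N : sigmaNormal H)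
    (f : G -> H) (g : H -> G) :
  {morph f : a b / a * b} -> {morph g : a b / a * b} ->
  continuous f -> continuous g -> {morph f : a / sigma a >-> sigma a} ->
  (forall a, sn_set M a -> sn_set N (f a)) ->
  (forall a, sn_set N a -> sn_set M (g a)) ->
  (forall a, sn_set M ((g (f a))^-1 * a)) ->
  (forall a, sn_set N ((f (g a))^-1 * a)) -> sigma_isomorphic (quot M) (quot N).
Proof.
move=> fM gM fc gc fS fMN gNM gfM fgN.
have [||a /fMN|f' [f'M f'c f'P]] := @quot_factor _ M _ (proj N \o f).
- by move=> a b /=; rewrite fM projM.
- exact: (continuous_comp2 fc (@proj_continuous _ N)).
- exact: proj_sn.
have [||a /gNM|g' [g'M g'c g'P]] := @quot_factor _ N _ (proj M \o g).
- by move=> a b /=; rewrite gM projM.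
- exact: (continuous_comp2 gc (@proj_continuous _ M)).
- exact: proj_sn.
exists f', g'; split=> //.
  move=> a; have [b <-] := proj_surj a.
  by rewrite -projS !f'P /= fS projS.
split=> a; have [b <-] := proj_surj a.
  by rewrite f'P g'P; apply/projP; exact: gfM.
by rewrite g'P f'P; apply/projP; exact: fgN.
Qed.

Section ZassenhausIsomorphism.
Variables (p : nat) (p1 : (1 < p)%N).
Implicit Types G H : sigmaGroupType.

Lemma zass_quot_isomorphic G H i : sigma_isomorphic G H ->
  sigma_isomorphic (quot (zassenhaus p G i)) (quot (zassenhaus p H i)).
Proof.
move=> [f [g [fM fS fc gc [fK gK]]]].
have gM : {morph g : a b / a * b}.
  by move=> a b; apply: (can_inj fK); rewrite fM !gK.
apply: (@quot_isomorphic _ _ _ _ f g) => //= a.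
- exact: zass_homo.
- exact: zass_homo.
- by rewrite fK mulVg; have [] := zass_subgroup p G i.
- by rewrite gK mulVg; have [] := zass_subgroup p H i.
Qed.

(** Shows that G/D_j determines G/D_i for [i <= j], which makes the basic neighbourhoods in Sch
    nested. *)
Lemma zass_quot_quot G i j : (i <= j)%N ->
  sigma_isomorphic (quot (zassenhaus p G i))
    (quot (zassenhaus p (quot (zassenhaus p G j)) i)).
Proof.
move=> ij; pose q := proj (zassenhaus p G i); pose q' := proj (zassenhaus p G j).
pose q'' := proj (zassenhaus p (quot (zassenhaus p G j)) i).
have q'P := @proj_continuous _ (zassenhaus p G j).
have q''P := @proj_continuous _ (zassenhaus p (quot (zassenhaus p G j)) i).
have [|||f [fM fc fP]] := @quot_factor _ (zassenhaus p G i) _ (q'' \o q').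
- by move=> a b; rewrite /q' /q'' /= !projM.
- exact: continuous_comp2 q'P q''P.
- by move=> a ai; apply: proj_sn => /=; exact: (zass_homo (@projM _ _) q'P ai).
have [||a /(zass_le p1 ij) ai|g [gM gc gP]] := @quot_factor _ (zassenhaus p G j) _ q.
- exact: projM.
- exact: proj_continuous.
- exact: proj_sn.
have [|||h [hM hc hP]] := @quot_factor _ (zassenhaus p (quot (zassenhaus p G j)) i) _ g.
- exact: gM.
- exact: gc.
- by move=> a /(zass_homo gM gc)/(zass_quot_trivial p1).
apply: (@sigma_isomorphic_cover G _ _ q (q'' \o q') f h) => //.
- exact: proj_surj.
- move=> a; have [b <-] := proj_surj a; have [c <-] := proj_surj b.
  by exists c.
- exact: projS.
- by move=> a; rewrite /q' /q'' /= !projS.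
- by move=> a /=; rewrite hP gP.
Qed.

Lemma zass_quot_isomorphic_le G H i j : (i <= j)%N ->
  sigma_isomorphic (quot (zassenhaus p G j)) (quot (zassenhaus p H j)) ->
  sigma_isomorphic (quot (zassenhaus p G i)) (quot (zassenhaus p H i)).
Proof.
move=> ij /(zass_quot_isomorphic i) e.
apply: (sigma_isomorphic_trans (zass_quot_quot G ij)).
exact: (sigma_isomorphic_trans e (sigma_isomorphic_sym (zass_quot_quot H ij))).
Qed.

End ZassenhausIsomorphism.

(** * Presentations and the space of weak Schur groups *)

Section Presented.
Implicit Types F : sigmaGroupType.

(** The kernel must be closed to contain the closed subgroup [relators]. The second alternative
    serves quotients by D_i, whose trivial subgroup is closed because D_i is. *)
Lemma presented_factor F n (r : n.-tuple (oddT F)) (H : topGroupType) (f : F -> H) :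
  hausdorff_space H \/ closed [set (1 : H)] ->
  {morph f : a b / a * b} -> continuous f ->
  (forall i, f (odd_val (tnth r i)) = 1) ->
  forall a, relators r a -> f a = 1.
Proof.
move=> cH fM fc fr; have c1 : closed [set (1 : H)].
  by case: cH => // /hausdorff_accessible/accessible_closed_set1.
apply: closed_gen_min => [||_ [i [y ->]] /=].
- by apply: (@preimage_closed _ _ f [set 1]) => // a _; exact: fc.
- split=> [|a b /= fa fb|a /= fa]; first exact: morph1g.
    by rewrite fM fa fb mulg1.
  by rewrite (morphVg fM) fa invg1.
by rewrite /conjg !fM (morphVg fM) fr mul1g mulVg.
Qed.

Lemma presented_proj1 F n (r : n.-tuple (oddT F)) i :
  proj _ (odd_val (tnth r i)) = 1 :> presented r.
Proof.
by apply: proj_sn; apply: sub_closed_gen; exists i, 1; rewrite conjg1.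
Qed.

Lemma presented_isomorphic F F' n n' (r : n.-tuple (oddT F)) (r' : n'.-tuple (oddT F'))
    (f : F -> F') (g : F' -> F) :
  {morph f : a b / a * b} -> {morph g : a b / a * b} ->
  continuous f -> continuous g -> {morph f : a / sigma a >-> sigma a} ->
  (forall i, relators r' (f (odd_val (tnth r i)))) ->
  (forall i, relators r (g (odd_val (tnth r' i)))) ->
  (forall a, relators r ((g (f a))^-1 * a)) ->
  (forall a, relators r' ((f (g a))^-1 * a)) ->
  sigma_isomorphic (presented r) (presented r').
Proof.
move=> fM gM fc gc fS fr gr gf fg.
apply: (@quot_isomorphic _ _ _ _ f g) => //=.
  apply: closed_gen_homo => // _ [i [y ->]]; rewrite /conjg !fM (morphVg fM).
  rewrite -/(conjg _ _); exact: (relators_normal r').2.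
apply: closed_gen_homo => // _ [i [y ->]]; rewrite /conjg !gM (morphVg gM).
rewrite -/(conjg _ _); exact: (relators_normal r).2.
Qed.

(** In the quotient of one presented group by D_i the relators of the other die too, since they
    differ by elements of D_i(F). This gives maps both ways, which descend modulo D_i because D_i of
    the target is trivial. It is the local constancy of r -> [G_r]. *)
Lemma zass_presented_congr (p : nat) (p1 : (1 < p)%N) F n (r r' : n.-tuple (oddT F)) i :
  (forall j, zass p F i ((odd_val (tnth r j))^-1 * odd_val (tnth r' j))) ->
  sigma_isomorphic (quot (zassenhaus p (presented r) i))
                   (quot (zassenhaus p (presented r') i)).
Proof.
have factor (s s' : n.-tuple (oddT F)) :
    (forall j, zass p F i ((odd_val (tnth s j))^-1 * odd_val (tnth s' j))) ->
    exists f : quot (zassenhaus p (presented s) i) ->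
               quot (zassenhaus p (presented s') i),
      [/\ {morph f : a b / a * b}, continuous f & forall a : F,
        f (proj _ (proj _ a : presented s)) = proj _ (proj _ a : presented s')].
  move=> ss'.
  pose q (a : F) : quot (zassenhaus p (presented s') i) :=
    proj _ (proj _ a : presented s').
  have qM : {morph q : a b / a * b} by move=> a b; rewrite /q !projM.
  have qc : continuous q.
    exact: (continuous_comp2 (@proj_continuous _ _) (@proj_continuous _ _)).
  have qs j : q (odd_val (tnth s j)) = 1.
    have : q ((odd_val (tnth s j))^-1 * odd_val (tnth s' j)) = 1.
      apply: proj_sn; apply: zass_homo (ss' j); first exact: projM.
      exact: proj_continuous.
    rewrite qM (morphVg qM) {2}/q presented_proj1 proj1 mulg1 => /(congr1 (fun a => a^-1)).
    by rewrite invgK invg1.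
  have c1 : closed [set (1 : quot (zassenhaus p (presented s') i))].
    apply: quot_closed; rewrite (_ : _ @^-1` _ = zass p (presented s') i).
      exact: zass_closed.
    by apply/seteqP; split=> a /= ai; [exact/(proj_eq1 (zassenhaus p _ i))|exact: proj_sn].
  have [f [fM fc fP]] :=
    quot_factor qM qc (presented_factor (r := s) (or_intror c1) qM qc qs
      : forall a, sn_set (SigmaNormal (relators_normal s) (@relators_sigma F n s)) a ->
          q a = 1).
  have [||a ai|g [gM gc gP]] := @quot_factor _ (zassenhaus p (presented s) i) _ f.
  - exact: fM.
  - exact: fc.
  - by apply: (zass_quot_trivial p1); exact: (zass_homo fM fc).
  by exists g; split=> // a; rewrite gP fP.
move=> rr'; have [f [fM fc fP]] := factor _ _ rr'.
have [j|g [gM gc gP]] := factor r' r.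
  have [_ _ NV] := zass_subgroup p F i.
  by rewrite -[X in zass _ _ _ X]invgK invgM invgK; exact: NV.
apply: (@sigma_isomorphic_cover F _ _ (fun a => proj _ (proj _ a : presented r))
  (fun a => proj _ (proj _ a : presented r')) f g) => //.
- by move=> a; have [b <-] := proj_surj a; have [c <-] := proj_surj b; exists c.
- by move=> a; have [b <-] := proj_surj a; have [c <-] := proj_surj b; exists c.
- by move=> a /=; rewrite !projS.
- by move=> a /=; rewrite !projS.
Qed.

End Presented.

(** * The dimension of H^1 *)

Section H1Dimension.
Variables (p : nat) (pp : prime p).
Implicit Types G H : topGroupType.

(** A basis of length k gives H^1 exactly p^k elements. *)
Lemma H1_dim_unique G m n : H1_dim p G m -> H1_dim p G n -> m = n.
Proof.
have H1c k : H1_dim p G k -> ([set f | @H1 p G f] #= `I_(p ^ k)%N)%card.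
  move=> [b [bH bP]].
  pose lin (c : {ffun 'I_k -> 'F_p}) a := (\sum_(i < k) c i * b i a)%R.
  have -> : [set f | @H1 p G f] = lin @` [set: {ffun 'I_k -> 'F_p}].
    apply/seteqP; split=> [f /bP[c [fc _]]|_ [c _ <-]].
      by exists c => //; apply/funext => a; rewrite fc.
    exact: H1_lin.
  apply: card_eq_trans; last first.
    rewrite -[X in `I_X](_ : #|{ffun 'I_k -> 'F_p}| = _); first exact: card_setT_fin.
    by rewrite card_ffun card_Fp// card_ord.
  apply: inj_card_eq => c d _ _ cd.
  have [e [_ eu]] := bP _ (H1_lin c bH).
  by rewrite -(eu c)// -(eu d)// => a; exact: (congr1 (fun f => f a) cd).
move=> /H1c cm /H1c cn; have /card_eq_II := card_eq_trans (card_esym cm) cn.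
by move/eqP; rewrite eqn_exp2l ?prime_gt1// => /eqP.
Qed.

Lemma H1_dim_transport G H (q : G -> H) m :
  {morph q : a b / a * b} -> continuous q -> (forall a, exists b, q b = a) ->
  (forall f : G -> 'F_p, H1 f -> exists2 f' : H -> 'F_p, H1 f' & f = f' \o q) ->
  H1_dim p G m <-> H1_dim p H m.
Proof.
move=> qM qc qs qH; split=> -[b [bH bP]].
  have /choice[b' b'P] : forall i, exists f' : H -> 'F_p, H1 f' /\ b i = f' \o q.
    by move=> i; have [f' ? ?] := qH _ (bH i); exists f'.
  exists b'; split=> [i|f fH]; first by have [] := b'P i.
  have [c [fc cu]] := bP _ (H1_comp qM qc fH); exists c; split=> [a|d fd].
    have [a' <-] := qs a; rewrite -[f _]/((f \o q) a') fc; apply: eq_bigr => i _.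
    by rewrite (b'P i).2.
  apply: cu => a /=; rewrite fd; apply: eq_bigr => i _.
  by rewrite (b'P i).2.
exists (fun i => b i \o q); split=> [i|f /qH[f' f'H ->]]; first exact: H1_comp.
have [c [fc cu]] := bP _ f'H; exists c; split=> [a|d fd]; first by rewrite /= fc.
by apply: cu => a; have [a' <-] := qs a; exact: fd.
Qed.

Lemma H1_dim_isomorphic (G H : sigmaGroupType) m : sigma_isomorphic G H ->
  H1_dim p G m <-> H1_dim p H m.
Proof.
move=> [f [g [fM _ fc gc [fK gK]]]]; apply: (@H1_dim_transport G H f m) => //.
  by move=> a; exists (g a).
move=> h hH; exists (h \o g); last by apply/funext => a /=; rewrite fK.
apply: H1_comp => // a b; apply: (can_inj fK); by rewrite fM !gK.
Qed.

Lemma H1_dim_quot (G : sigmaGroupType) (M : sigmaNormal G) m :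
  (forall f : G -> 'F_p, H1 f -> forall a, sn_set M a -> f a = 0%R) ->
  H1_dim p (quot M) m <-> H1_dim p G m.
Proof.
move=> fN; apply: iff_sym; apply: (@H1_dim_transport G (quot M) (proj M) m); first exact: projM.
- exact: proj_continuous.
- exact: proj_surj.
move=> f fH; have /H1P[fM fc] := fH.
have [f' [f'M f'c f'P]] := quot_factor fM fc (fN f fH : forall a, sn_set M a -> _ = 1).
by exists f'; [apply/H1P|apply/funext => a; rewrite /= f'P].
Qed.

Lemma H1_zass2 G (f : G -> 'F_p) a : H1 f -> zass p G 2 a -> f a = 0%R.
Proof.
move=> fH; have [_ cK [sK _]] := H1_ker fH.
rewrite zassE ?prime_gt1//; apply: (@closed_gen_min _ _ (f @^-1` [set 0%R])) => // z.
have f1 := H1_1 fH; have fV b := H1_V b fH.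
move=> [[b _ <-]|[j [k [_ _ _ [b [c [_ _ ->]]]]]]] /=.
  have -> n : f (b ^+ n) = (n%:R * f b)%R.
    elim: n => [|n IH]; first by rewrite expg0 f1 mul0r.
    by rewrite expgS fH.1 IH -natr1 mulrDl mul1r addrC.
  by rewrite pchar_Fp_0 ?mul0r.
by rewrite /commg /conjg !fH.1 !fV (addrCA (- f c)%R) addNr addr0 addNr.
Qed.

Lemma H1_dim_zass2 (G : sigmaGroupType) m :
  H1_dim p (quot (zassenhaus p G 2)) m <-> H1_dim p G m.
Proof. by apply: H1_dim_quot => f fH a; exact: H1_zass2. Qed.

End H1Dimension.

Definition odd_map (G H : sigmaGroupType) (f : G -> H)
    (fM : {morph f : a b / a * b}) (fS : {morph f : a / sigma a >-> sigma a})
    (a : oddT G) : oddT H.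
Proof.
exists (f (odd_val a)); apply/mem_set; rewrite /odd_elts /=.
by rewrite -fS -(morphVg fM) (set_mem (valP a)).
Defined.

Lemma odd_valP (G : sigmaGroupType) (a : oddT G) : sigma (odd_val a) = (odd_val a)^-1.
Proof. exact: set_mem (valP a). Qed.

Lemma countable_bigcup_measurable d (T : measurableType d) (I : Type) (D : set I)
    (A : I -> set T) : countable D -> (forall i, D i -> measurable (A i)) ->
  measurable (\bigcup_(i in D) A i).
Proof.
move=> cD mA; rewrite bigcup_set_type; apply: countable_bigcupT_measurable.
  by rewrite (eq_countable (card_setT _)).
by move=> i; apply: mA; exact: set_valP.
Qed.

Section SchTheory.
Variables (p : nat) (pp : prime p) (F : nat -> sigmaGroupType).
Variable x : forall n, 'I_n -> F n.
Arguments x : clear implicits.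
Hypothesis F_free : forall n, is_free_pro_p p (x n).
Hypothesis sigma_x : forall n (i : 'I_n), sigma (x n i) = (x n i)^-1.

Local Notation crd := (crd pp F_free).
Local Notation Phi := (Phi pp F_free).
Local Notation Sch := (Sch F p).
Local Notation cls := (Sch_class p).

Let p1 : (1 < p)%N. Proof. exact: prime_gt1. Qed.

Lemma Sch_class_surj (X : Sch) : exists n (r : n.-tuple (oddT (F n))), X = cls r.
Proof.
have [n [r Xr]] := Sch_group_weak_schur X; exists n, r.
have [Y [_ YU]] := weak_schur_Sch p (Sch_group_weak_schur X).
rewrite -(YU X); last exact: sigma_isomorphic_refl.
by apply: YU; apply: (sigma_isomorphic_trans Xr); apply: sigma_isomorphic_sym; exact: Sch_groupP.
Qed.

Lemma Sch_nbhsP i n n' (r : n.-tuple (oddT (F n))) (r' : n'.-tuple (oddT (F n'))) :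
  Sch_nbhs i (cls r) (cls r') <->
  sigma_isomorphic (quot (zassenhaus p (presented r') i))
                   (quot (zassenhaus p (presented r) i)).
Proof.
have e m (s : m.-tuple (oddT (F m))) := zass_quot_isomorphic p i (Sch_groupP p s).
split=> h.
  apply: (sigma_isomorphic_trans (sigma_isomorphic_sym (e _ r'))).
  exact: (sigma_isomorphic_trans h (e _ r)).
apply: (sigma_isomorphic_trans (e _ r')).
exact: (sigma_isomorphic_trans h (sigma_isomorphic_sym (e _ r))).
Qed.

Lemma Sch_nbhs_refl i (X : Sch) : Sch_nbhs i X X.
Proof. exact: sigma_isomorphic_refl. Qed.

Lemma Sch_nbhs_sym i (X Y : Sch) : Sch_nbhs i X Y -> Sch_nbhs i Y X.
Proof. exact: sigma_isomorphic_sym. Qed.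

Lemma Sch_nbhs_trans i (X Y Z : Sch) :
  Sch_nbhs i X Y -> Sch_nbhs i Y Z -> Sch_nbhs i X Z.
Proof. by move=> XY YZ; exact: sigma_isomorphic_trans YZ XY. Qed.

Lemma Sch_nbhs_le i j (X Y : Sch) : (i <= j)%N -> Sch_nbhs j X Y -> Sch_nbhs i X Y.
Proof. by move=> ij; exact: zass_quot_isomorphic_le. Qed.

Lemma Sch_nbhs_eq i (X Y : Sch) : Sch_nbhs i X Y -> Sch_nbhs i X = Sch_nbhs i Y.
Proof.
move=> XY; apply/seteqP; split=> Z; apply: Sch_nbhs_trans => //.
exact: Sch_nbhs_sym.
Qed.

Lemma Sch_nbhs_open i (X : Sch) : (1 < i)%N -> open (Sch_nbhs i X).
Proof.
move=> i1; exists [set Sch_nbhs i X]; last by rewrite bigcup_set1.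
move=> _ ->; exists [fset (i, X)]%fset; first by move=> j /fset1P ->; rewrite inE.
by rewrite set_fset1 bigcap_set1.
Qed.

Lemma open_Sch_nbhs (A : set Sch) (X : Sch) : open A -> A X ->
  exists2 i, (1 < i)%N & Sch_nbhs i X `<=` A.
Proof.
move=> [D DA <-] [B DB BX]; have [J Jb JB] := DA _ DB.
have [i i1 iB] : exists2 i, (1 < i)%N & Sch_nbhs i X `<=` B.
  (* The sum dominates every level in the finite intersection, and neighbourhoods shrink with the
     level; the 2 keeps the level above 1 even for empty [J]. *)
  exists (2 + \sum_(j <- J) j.1)%N => // Y XY; rewrite -JB => j jJ /=.
  rewrite -JB in BX; apply: Sch_nbhs_trans (BX j jJ) _.
  by apply: Sch_nbhs_le XY; rewrite (big_fsetD1 j)//= addnCA leq_addr.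
by exists i => // Y /iB BY; exists B.
Qed.

Lemma Sch_nbhs_clopen i (X : Sch) : (1 < i)%N -> clopen (Sch_nbhs i X).
Proof.
move=> i1; split; first exact: Sch_nbhs_open.
rewrite -[Sch_nbhs i X]setCK; apply: open_closedC.
rewrite (_ : ~` _ = \bigcup_(Y in ~` Sch_nbhs i X) Sch_nbhs i Y).
  by apply: bigcup_open => Y _; exact: Sch_nbhs_open.
apply/seteqP; split=> [Y XY|Y [Z XZ ZY] XY].
  by exists Y => //; exact: Sch_nbhs_refl.
by apply: XZ; apply: Sch_nbhs_trans XY _; exact: Sch_nbhs_sym.
Qed.

Lemma Sch_nbhsI i j (X Y : Sch) : (i <= j)%N ->
  Sch_nbhs i X `&` Sch_nbhs j Y = set0 \/
  Sch_nbhs i X `&` Sch_nbhs j Y = Sch_nbhs j Y.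
Proof.
move=> ij; have [XY|XY] := pselect (Sch_nbhs i X Y); [right|left].
  by rewrite (Sch_nbhs_eq XY); apply: setIidr => Z; exact: Sch_nbhs_le.
rewrite -subset0 => Z [XZ YZ]; apply: XY; apply: Sch_nbhs_trans XZ _.
by apply: Sch_nbhs_sym; exact: Sch_nbhs_le YZ.
Qed.

Lemma F_generated n : exists s : seq (F n), closed_gen [set` s] = [set: F n].
Proof.
exists [seq x n i | i <- enum 'I_n]; rewrite -(free_generated pp F_free n).
congr closed_gen; apply/seteqP; split=> a /=.
  by move=> /mapP[i _ ->]; exists i.
by move=> [i _ <-]; apply/map_f; rewrite mem_enum.
Qed.

Lemma F_zass_open n i : open (zass p (F n) i).
Proof. by have [s sF] := F_generated n; exact: zass_open sF. Qed.

Lemma Sch_nbhs_congr n i (r r' : n.-tuple (oddT (F n))) :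
  (forall j, zass p (F n) i ((odd_val (tnth r j))^-1 * odd_val (tnth r' j))) ->
  Sch_nbhs i (cls r) (cls r').
Proof.
move=> rr'; apply/Sch_nbhsP; apply: sigma_isomorphic_sym.
exact: zass_presented_congr.
Qed.

Lemma F_zass_cover n i : exists t, coset_cover (zass p (F n) i) [set: F n] t.
Proof. by have [s sF] := F_generated n; exact: zass_finite_index sF. Qed.

(** F_n modulo D_i is finite, so a map that depends only on the relators modulo D_i takes finitely
    many values. Each tuple is coded by its coset representatives. *)
Lemma finite_zass_image n i (S : Type) (f : n.-tuple (oddT (F n)) -> S) :
  (forall r r', (forall j,
     zass p (F n) i ((odd_val (tnth r j))^-1 * odd_val (tnth r' j))) -> f r = f r') ->
  finite_set (range f).
Proof.
move=> f_congr.
have [t tF] := F_zass_cover n i.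
have /choice[u uP] : forall g, exists u, u \in t /\ zass p (F n) i (u^-1 * g).
  by move=> g; have [//|v vt ug] := tF g; exists v.
have uC (a b : F n) : u a = u b -> zass p (F n) i (a^-1 * b).
  have [_ ZM ZV] := zass_subgroup p (F n) i.
  move=> uab; rewrite -(mulKVg (u a) b) mulgA {2}uab.
  apply: ZM; last exact: (uP b).2.
  by rewrite -[a^-1 * _]invgK invgM invgK; apply: ZV; exact: (uP a).2.
pose v (r : n.-tuple (oddT (F n))) : {ffun 'I_n -> seq_sub t} :=
  [ffun j => SeqSub (uP (odd_val (tnth r j))).1].
(* Codes that no tuple attains are sent to the value at the trivial tuple. *)
pose w (c : {ffun 'I_n -> seq_sub t}) : S :=
  f (if pselect (exists r, v r = c) is left e then projT1 (cid e)
     else nseq_tuple n (point : oddT (F n))).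
apply: (@sub_finite_set _ _ (w @` [set: _])); last first.
  apply: finite_image; exact: (@finite_finset {ffun 'I_n -> seq_sub t}).
move=> _ [r _ <-]; exists (v r) => //; rewrite /w; case: pselect => [e|[]]; last by exists r.
apply: f_congr => j; apply: uC.
case: cid => r' /= /ffunP/(_ j); rewrite !ffunE.
by move/(congr1 (@ssval _ _)).
Qed.

Lemma finite_Sch_nbhs n i :
  finite_set [set Sch_nbhs i (cls r) | r in [set: n.-tuple (oddT (F n))]].
Proof.
by apply: (@finite_zass_image n i) => r r' rr'; apply/Sch_nbhs_eq/Sch_nbhs_congr.
Qed.

Definition Sch_basis : set (set Sch) :=
  [set A | exists i X, (1 < i)%N /\ A = Sch_nbhs i X].

(** For each level and each number of generators there are only finitely many neighbourhoods. *)
Lemma countable_Sch_basis : countable Sch_basis.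
Proof.
apply: (@sub_countable _ _ _ (\bigcup_(i in [set: nat]) \bigcup_(n in [set: nat])
  [set Sch_nbhs i (cls r) | r in [set: n.-tuple (oddT (F n))]])); last first.
  apply: bigcup_countable => // i _; apply: bigcup_countable => // n _.
  exact/finite_set_countable/finite_Sch_nbhs.
apply: subset_card_le => _ [i [X [_ ->]]]; have [n [r ->]] := Sch_class_surj X.
by exists i => //; exists n => //; exists r.
Qed.

Lemma sigma_algebra_Sch_basis : @open Sch `<=` <<s Sch_basis >>.
Proof.
move=> A oA.
have -> : A = \bigcup_(B in [set B | Sch_basis B /\ B `<=` A]) B.
  apply/seteqP; split=> [X AX|X [B [_]]]; last by apply.
  have [i i1 iA] := open_Sch_nbhs oA AX; exists (Sch_nbhs i X).
    by split=> //; exists i, X.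
  exact: Sch_nbhs_refl.
pose T := g_sigma_algebraType Sch_basis.
suff : measurable (\bigcup_(B in [set B | Sch_basis B /\ B `<=` A]) (B : set T)) by [].
apply: countable_bigcup_measurable => [|B [+ _]].
  by apply: sub_countable countable_Sch_basis; apply: subset_card_le => B [].
exact: sub_gen_smallest.
Qed.

Lemma Sch_rankP m n (r : n.-tuple (oddT (F n))) :
  Sch_rank p F m (cls r) <-> H1_dim p (presented r) m.
Proof. by have := @H1_dim_isomorphic p _ _ m (Sch_groupP p r). Qed.

Lemma Sch_rank_unique m n (X : Sch) : Sch_rank p F m X -> Sch_rank p F n X -> m = n.
Proof. exact: H1_dim_unique. Qed.

Lemma Sch_rank_nbhs m (X Y : Sch) : Sch_nbhs 2 X Y -> Sch_rank p F m X ->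
  Sch_rank p F m Y.
Proof.
move=> XY; rewrite /Sch_rank /= => /(H1_dim_zass2 pp) Xm; apply/(H1_dim_zass2 pp).
by have [_] := @H1_dim_isomorphic p _ _ m XY; apply.
Qed.

Lemma Sch_rank_open m : open (Sch_rank p F m).
Proof.
rewrite (_ : Sch_rank p F m = \bigcup_(X in Sch_rank p F m) Sch_nbhs 2 X).
  by apply: bigcup_open => X _; exact: Sch_nbhs_open.
apply/seteqP; split=> [X Xm|X [Y Ym YX]]; last exact: Sch_rank_nbhs Ym.
by exists X => //; exact: Sch_nbhs_refl.
Qed.

(** H^1 of the free group kills relators in [Phi], so it is also the H^1 of the presented group. *)
Lemma Sch_rank_Phi n (r : n.-tuple (oddT (F n))) :
  (forall i, Phi (odd_val (tnth r i))) -> Sch_rank p F n (cls r).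
Proof.
move=> rP; apply/Sch_rankP.
suff [_] : H1_dim p (presented r) n <-> H1_dim p (F n) n.
  apply; exists (fun i => crd i); split=> [i|f fH]; first exact: crd_H1.
  exists [ffun j => f (x n j)]; split=> [a|c fc].
    by rewrite (H1_crd pp F_free fH); apply: eq_bigr => j _; rewrite ffunE.
  by apply/ffunP => j; rewrite ffunE fc H1_crd_x.
apply: H1_dim_quot => f fH a /= ra.
have [_ fK [fN fJ]] := H1_ker fH.
  apply: (closed_gen_min fK fN _ ra) => _ [i [y ->]] /=.
  by apply: fJ; exact: (H1_Phi (F_free := F_free) fH).
Qed.

Lemma Sch_class_perm n (r : n.-tuple (oddT (F n))) (s : {perm 'I_n}) :
  cls [tuple tnth r (s i) | i < n] = cls r.
Proof.
have mem (a : F n) : relators r (a^-1 * a).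
  by rewrite mulVg; have [[]] := relators_normal r.
have mem' (a : F n) : relators [tuple tnth r (s i) | i < n] (a^-1 * a).
  by rewrite mulVg; have [[]] := relators_normal [tuple tnth r (s i) | i < n].
have idc : continuous (@id (F n)) by move=> a; exact: cvg_id.
apply/Sch_classP; apply: (@presented_isomorphic _ _ _ _ _ _ id id) => // i.
- by apply: sub_closed_gen; exists (s i), 1; rewrite conjg1 tnth_mktuple.
- apply: sub_closed_gen; exists (s^-1%g i), 1; rewrite conjg1 tnth_mktuple.
  by rewrite permKV.
Qed.

(* A relator outside [Phi n.+1] eliminates a generator. *)
Lemma Sch_class_reduction n (a : oddT (F n.+1)) : ~ Phi (odd_val a) ->
  exists (f : F n.+1 -> F n) (fM : {morph f : b c / b * c})
      (fS : {morph f : b / sigma b >-> sigma b}) (g : F n -> F n.+1),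
    [/\ {morph g : b c / b * c}, continuous f, continuous g, cancel g f & [/\
      f (odd_val a) = 1,
      (forall h : F n.+1 -> 'F_p, H1 h -> h (odd_val a) = 0%R -> h = h \o g \o f) &
      forall t : n.-tuple (oddT (F n.+1)),
        cls [tuple of a :: t] = cls [tuple odd_map fM fS (tnth t i) | i < n]]].
Proof.
move=> aP; have [f [g [fM gM fc gc [fS gfK fa gf]]]] :=
  free_reduction sigma_x (odd_valP a) aP.
exists f, fM, fS, g; split=> //; split=> // [h hH ha|t].
  (* The kernel of [h] is a closed normal subgroup containing [a], hence contains
     [(g (f b))^-1 * b]. *)
  apply/funext => b /=; have [_ cK nK] := H1_ker hH.
  have : h ((g (f b))^-1 * b) = 0%R.
    by apply: (normal_closure_min cK nK _ (gf b)) => _ ->.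
  by rewrite hH.1 (H1_V _ hH) => /eqP; rewrite addrC subr_eq0 => /eqP.
set r := [tuple of a :: t]; set r' := [tuple _ | i < n].
have ar : normal_closure [set odd_val a] `<=` relators r.
  apply: normal_closure_min => [||_ ->]; [exact: closed_gen_closed|exact: relators_normal|].
  by apply: sub_closed_gen; exists ord0, 1; rewrite conjg1 tnth0.
have [[r1 rM rV] rJ] := relators_normal r; have [[r'1 _ _] _] := relators_normal r'.
have r'E i : odd_val (tnth r' i) = f (odd_val (tnth t i)) by rewrite tnth_mktuple.
apply/Sch_classP; apply: (@presented_isomorphic _ _ _ _ _ _ f g) => // [i|i|b|b].
- case: (unliftP ord0 i) => [j|] ->; last by rewrite tnth0 fa.
  rewrite tnthS; apply: sub_closed_gen; exists j, 1.
  by rewrite conjg1 r'E.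
- have ti : relators r (odd_val (tnth t i)).
    by apply: sub_closed_gen; exists (lift ord0 i), 1; rewrite conjg1 tnthS.
  rewrite r'E -[g _]invgK; apply: (rV); rewrite -[_^-1](mulgK (odd_val (tnth t i))).
  by apply: rM; [apply: ar; exact: gf|exact: rV].
- by apply: ar; exact: gf.
- by rewrite gfK mulVg.
Qed.

(** Generators are eliminated until all relators lie in [Phi]. The last clause records that [m = n]
    means no elimination took place; existence of the rank, the bound by n and the criterion for
    rank n all follow. *)
Lemma Sch_class_descent n (r : n.-tuple (oddT (F n))) :
  exists2 m, (m <= n)%N & exists r' : m.-tuple (oddT (F m)),
    [/\ cls r = cls r', forall i, Phi (odd_val (tnth r' i)) &
        m = n -> forall i, Phi (odd_val (tnth r i))].
Proof.
elim: n => [|n IH] in r *.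
  by exists 0%N => //; exists r; split=> // [[]|_ []].
have [rP|/existsNP[i ri]] := pselect (forall i, Phi (odd_val (tnth r i))).
  by exists n.+1 => //; exists r.
(* The relator outside [Phi] is swapped to the head, where [Sch_class_reduction] expects it. *)
pose r1 := [tuple tnth r (tperm ord0 i j) | j < n.+1].
have r1E : r1 = [tuple of thead r1 :: behead r1].
  exact: tuple_eta.
have [|f [fM [fS [g [_ _ _ _ [_ _ fr]]]]]] := @Sch_class_reduction n (thead r1).
  by rewrite /thead tnth_mktuple tpermL.
have [m mn [r' [rr' r'P _]]] := IH [tuple odd_map fM fS (tnth [tuple of behead r1] j) | j < n].
exists m; first exact: leq_trans mn _.
exists r'; split=> //; last by move=> mE; rewrite mE ltnn in mn.
by rewrite -rr' -fr -r1E Sch_class_perm.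
Qed.

Lemma Sch_rank_exists (X : Sch) : exists m, Sch_rank p F m X.
Proof.
have [n [r ->]] := Sch_class_surj X; have [m _ [r' [-> r'P _]]] := Sch_class_descent r.
by exists m; exact: Sch_rank_Phi.
Qed.

Lemma Sch_rank_class n (r : n.-tuple (oddT (F n))) :
  Sch_rank p F n (cls r) <-> forall i, Phi (odd_val (tnth r i)).
Proof.
split; last exact: Sch_rank_Phi.
have [m _ [r' [-> r'P h]]] := Sch_class_descent r.
by move=> /(Sch_rank_unique (Sch_rank_Phi r'P)).
Qed.

Lemma Sch_rank_le m n (r : n.-tuple (oddT (F n))) : Sch_rank p F m (cls r) -> (m <= n)%N.
Proof.
have [k kn [r' [-> r'P _]]] := Sch_class_descent r.
by move=> /(Sch_rank_unique (Sch_rank_Phi r'P)) <-.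
Qed.

End SchTheory.

Lemma odd_val_continuous (G : sigmaGroupType) : continuous (@odd_val G).
Proof. exact: initial_continuous. Qed.

(** * Haar measure on odd elements *)

Section Preimage.
Variables (G H : sigmaGroupType) (f : G -> H) (N : sigmaNormal H).
Hypotheses (fM : {morph f : a b / a * b}) (fS : {morph f : a / sigma a >-> sigma a}).

Let preimage_normal : is_normal (f @^-1` sn_set N).
Proof.
have [[N1 NM NV] NJ] := sn_normal N.
split=> [|a b /= Na]; last by rewrite /conjg !fM (morphVg fM); exact: NJ.
split=> [|a b /= Na Nb|a /= Na] /=; first by rewrite (morph1g fM).
  by rewrite fM; exact: NM.
by rewrite (morphVg fM); exact: NV.
Qed.

Let preimage_sigma a : (f @^-1` sn_set N) a -> (f @^-1` sn_set N) (sigma a).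
Proof. by move=> /= Na; rewrite fS; exact: sn_sigma. Qed.

Definition sn_preimage : sigmaNormal G := SigmaNormal preimage_normal preimage_sigma.

End Preimage.

Section Intersection.
Variables (G : sigmaGroupType) (M N : sigmaNormal G).

Let setI_sigma a : (sn_set M `&` sn_set N) a -> (sn_set M `&` sn_set N) (sigma a).
Proof. by move=> [Ma Na]; split; exact: sn_sigma. Qed.

Definition sn_setI : sigmaNormal G :=
  SigmaNormal (is_normalI (sn_normal M) (sn_normal N)) setI_sigma.

End Intersection.

Lemma sn_setT_subproof (G : sigmaGroupType) : is_normal [set: G].
Proof. by []. Qed.

Definition sn_setT (G : sigmaGroupType) : sigmaNormal G :=
  SigmaNormal (@sn_setT_subproof G) (fun _ _ => I).

Section Coset.
Variables (G : sigmaGroupType) (N : sigmaNormal G).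

Lemma sn_coset_eq (a b : G) : sn_set N (a^-1 * b) ->
  forall c, sn_set N (a^-1 * c) <-> sn_set N (b^-1 * c).
Proof.
have [[N1 NM NV] _] := sn_normal N; move=> ab c; split=> ac.
  by have := NM _ _ (NV _ ab) ac; rewrite invgM invgK -mulgA mulKVg.
by have := NM _ _ ab ac; rewrite -mulgA mulKVg.
Qed.

(** The base point [a] need not be odd, only its class modulo [N] has to be for the coset to be
    charged; this admits base points such as [g (odd_val r)] for a section [g]. *)
Definition odd_coset (a : G) : set (oddT G) := [set b | sn_set N (a^-1 * odd_val b)].

Lemma odd_coset_open a : open (sn_set N) -> open (odd_coset a).
Proof.
move=> oN; apply: (@open_comp _ _ (fun b : oddT G => a^-1 * odd_val b)) => // b _.
exact: (continuous_comp2 (@odd_val_continuous G) (@mulgl_continuous G a^-1)).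
Qed.

Lemma odd_cosetE a : odd_coset a = [set b | proj N (odd_val b) = proj N a].
Proof.
by apply/seteqP; split=> b; [move/projP/esym|move=> /= /esym/projP].
Qed.

End Coset.

Lemma sigma_isomorphic_card_odd (G H : sigmaGroupType) :
  sigma_isomorphic G H -> (@odd_elts G #= @odd_elts H)%card.
Proof.
move=> [f [g [fM fS _ _ [fK gK]]]].
have <- : f @` @odd_elts G = @odd_elts H.
  apply/seteqP; split=> [_ [a aG <-]|a aH].
    by rewrite /odd_elts /= -fS aG (morphVg fM).
  exists (g a) => //; apply: (can_inj fK).
  by rewrite fS (morphVg fM) !gK.
by apply/card_esym/inj_card_eq => a b _ _ /(can_inj fK).
Qed.

Section Haar.
Variables (R : realType) (p : nat) (pp : prime p).
Implicit Type G : sigmaGroupType.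

Lemma finite_quot_open G (N : sigmaNormal G) : is_pro_p p G -> open (sn_set N) ->
  exists k, ([set: quot N] #= `I_(p ^ k)%N)%card.
Proof.
move=> [_ _ _ pG] oN; have [k ck] := pG _ oN (sn_normal N).
by exists k; exact: card_eq_trans (card_quot N) ck.
Qed.

Definition odd_index G (N : sigmaNormal G) : nat := #|` fset_set (@odd_elts (quot N))|.

Variables (G : sigmaGroupType) (proG : is_pro_p p G).
Variable h : probability (borel (oddT G)) R.
Hypothesis h_haar : is_haar_odd h.

Lemma haar_odd_coset (N : sigmaNormal G) a : open (sn_set N) ->
  odd_elts (proj N a) -> h (odd_coset N a) = ((odd_index N)%:R^-1)%R%:E.
Proof. by move=> oN aN; rewrite odd_cosetE; exact: h_haar. Qed.

Lemma odd_proj (N : sigmaNormal G) (a : oddT G) : odd_elts (proj N (odd_val a)).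
Proof. by rewrite /odd_elts /= -projS odd_valP projV. Qed.

End Haar.

Lemma odd_index_isomorphic (p : nat) (G H : sigmaGroupType) (M : sigmaNormal G)
    (N : sigmaNormal H) : is_pro_p p G -> is_pro_p p H ->
  open (sn_set M) -> open (sn_set N) ->
  sigma_isomorphic (quot M) (quot N) -> odd_index M = odd_index N.
Proof.
move=> pG pH oM oN MN.
have fin (K : sigmaGroupType) (L : sigmaNormal K) : is_pro_p p K -> open (sn_set L) ->
    finite_set (@odd_elts (quot L)).
  move=> pK oL; have [k ck] := finite_quot_open pK oL.
  by apply: (@sub_finite_set _ _ [set: quot L]) => //; exists (p ^ k)%N.
by apply/(fcard_eq (fin _ M pG oM) (fin _ N pH oN)); exact: sigma_isomorphic_card_odd.
Qed.

Section FreeHaar.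
Variables (R : realType) (p : nat) (pp : prime p) (F : nat -> sigmaGroupType).
Variable x : forall n, 'I_n -> F n.
Arguments x : clear implicits.
Hypothesis F_free : forall n, is_free_pro_p p (x n).
Hypothesis sigma_x : forall n (i : 'I_n), sigma (x n i) = (x n i)^-1.
Variable h : forall n, probability (borel (oddT (F n))) R.
Hypothesis h_haar : forall n, is_haar_odd (h n).

Local Notation crd := (crd pp F_free).
Local Notation Phi := (Phi pp F_free).
Local Notation odd n := (borel (oddT (F n))).

Let proF n : is_pro_p p (F n). Proof. exact: (F_free n).1. Qed.

Lemma ker_crd_sigma n (j : 'I_n) (a : F n) :
  (crd j @^-1` [set 0%R]) a -> (crd j @^-1` [set 0%R]) (sigma a).
Proof. by move=> /= aj; rewrite (crd_sigma pp F_free sigma_x) aj oppr0. Qed.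

Definition ker_crd n (j : 'I_n) : sigmaNormal (F n) :=
  let: And3 _ _ nj := H1_ker (crd_H1 pp F_free j) in
  SigmaNormal nj (@ker_crd_sigma n j).

Lemma ker_crdE n (j : 'I_n) a : sn_set (ker_crd j) a = (crd j a = 0%R).
Proof. by rewrite /ker_crd; case: (H1_ker _). Qed.

Lemma ker_crd_open n (j : 'I_n) : open (sn_set (ker_crd j)).
Proof.
rewrite (_ : sn_set _ = crd j @^-1` [set 0%R]); last first.
  by apply/funext => a; rewrite ker_crdE.
by have [] := H1_ker (crd_H1 pp F_free j).
Qed.

Lemma Phi_normal n : is_normal (@Phi n).
Proof.
have K j := sn_normal (@ker_crd n j).
split=> [|a b aP j].
  split=> [j|a b aP bP j|a aP j]; rewrite -ker_crdE; have [[K1 KM KV] _] := K j.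
  - exact: K1.
  - by apply: KM; rewrite ker_crdE.
  - by apply: KV; rewrite ker_crdE.
by rewrite -ker_crdE; apply: (K j).2; rewrite ker_crdE.
Qed.

Lemma Phi_sigma n a : @Phi n a -> Phi (sigma a).
Proof. by move=> aP j; rewrite (crd_sigma pp F_free sigma_x) aP oppr0. Qed.

Definition PhiN n : sigmaNormal (F n) := SigmaNormal (@Phi_normal n) (@Phi_sigma n).

Lemma Phi_open n : open (@Phi n).
Proof.
rewrite openE => a aP.
have : \forall b \near a, forall j, crd j b = 0%R.
  apply: filter_forall => j; apply: open_nbhs_nbhs; split; last exact: aP.
  exact: (crd_H1 pp F_free j).2.
exact.
Qed.

Lemma crd_surj n (v : {ffun 'I_n -> 'F_p}) : exists c : F n, forall j, crd j c = v j.
Proof.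
suff H (s : seq 'I_n) : uniq s ->
    exists c : F n, forall j, crd j c = if j \in s then v j else 0%R.
  have [c cE] := H _ (enum_uniq 'I_n); exists c => j.
  by rewrite cE mem_enum.
elim: s => [_|i s IH /= /andP[iN /IH[c cE]]].
  by exists 1 => j; rewrite (H1_1 (crd_H1 pp F_free j)).
exists (x n i ^+ (v i : nat) * c) => j; rewrite (crd_H1 pp F_free j).1 cE inE.
have -> m : crd j (x n i ^+ m) = (m%:R * (i == j)%:R)%R.
  elim: m => [|m IHm]; first by rewrite expg0 mul0r (H1_1 (crd_H1 pp F_free j)).
  by rewrite expgS (crd_H1 pp F_free j).1 IHm crd_x -natr1 mulrDl mul1r addrC.
have [->|ij] := eqVneq j i; first by rewrite (negbTE iN) mulr1 natr_Zp addr0.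
by rewrite mulr0 add0r.
Qed.

(** The quotient by [Phi] has p^n elements, and all are odd since [sigma] acts on it by
    inversion. *)
Lemma haar_Phi n : h n [set b | Phi (odd_val b)] = ((p ^ n)%:R^-1)%R%:E.
Proof.
have -> : [set b | Phi (odd_val b)] = odd_coset (PhiN n) 1.
  by apply/seteqP; split=> b; rewrite /odd_coset /= invg1 mul1g.
rewrite (haar_odd_coset (@h_haar n)); first last.
- by rewrite /odd_elts /= -projS (morph1g (@sigmaM _)) proj1 invg1.
- exact: Phi_open.
congr ((_%:R)^-1%R)%:E; rewrite /odd_index.
have -> : @odd_elts (quot (PhiN n)) = setT.
  rewrite -subTset => y _; have [a <-] := proj_surj y.
  rewrite /odd_elts /= -projS -projV; apply/projP => /= j.
  rewrite (crd_H1 pp F_free j).1 (H1_V _ (crd_H1 pp F_free j)).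
  by rewrite (H1_V _ (crd_H1 pp F_free j)) (crd_sigma pp F_free sigma_x) opprK addrC addNr.
apply: card_fset_set.
have -> : (p ^ n = #|{ffun 'I_n -> 'F_p}|)%N by rewrite card_ffun card_Fp// card_ord.
apply: card_eq_trans (card_setT_fin _).
pose u (y : quot (PhiN n)) : {ffun 'I_n -> 'F_p} := [ffun j => crd j (lift_quot y)].
have uP a : u (proj _ a) = [ffun j => crd j a].
  apply/ffunP => j; rewrite !ffunE.
  have /projP/(_ j) := lift_quotK (proj (PhiN n) a).
  rewrite (crd_H1 pp F_free j).1 (H1_V _ (crd_H1 pp F_free j)) => /eqP.
  by rewrite addrC subr_eq0 => /eqP ->.
have u_surj : u @` setT = setT.
  rewrite -subTset => v _; have [c cv] := crd_surj v.
  by exists (proj _ c) => //; rewrite uP; apply/ffunP => j; rewrite ffunE cv.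
rewrite -u_surj; apply/card_esym/inj_card_eq => y z _ _.
have [[a <-] [b <-]] := (proj_surj y, proj_surj z).
rewrite !uP => /ffunP ab; apply/projP => j /=.
have := ab j; rewrite !ffunE (crd_H1 pp F_free j).1 (H1_V _ (crd_H1 pp F_free j)) => ->.
by rewrite addNr.
Qed.

(* A relator [a] outside [Phi n.+1] and the associated projection [f], with its
   section [g], onto the free group on [n] generators. *)
Section Reduction.
Variables (n : nat) (a : oddT (F n.+1)) (j : 'I_n.+1).
Hypothesis aj : crd j (odd_val a) != 0%R.
Variables (f : F n.+1 -> F n) (g : F n -> F n.+1).
Hypotheses (fM : {morph f : b c / b * c}) (fS : {morph f : b / sigma b >-> sigma b}).
Hypotheses (gM : {morph g : b c / b * c}).
Hypotheses (fc : continuous f) (gc : continuous g) (gK : cancel g f).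
Hypothesis fa : f (odd_val a) = 1.
Hypothesis f_ker : forall u : F n.+1 -> 'F_p, H1 u -> u (odd_val a) = 0%R ->
  u = u \o g \o f.

Let crdM k b c : crd (n := n.+1) k (b * c) = (crd k b + crd k c)%R.
Proof. exact: (crd_H1 pp F_free k).1. Qed.

Let crdV k b : crd (n := n.+1) k b^-1 = (- crd k b)%R.
Proof. exact: H1_V (crd_H1 pp F_free k). Qed.

(** H^1 of the smaller group gives the functionals that kill [a]; together with the coordinate
    [crd j], nonzero at [a], they span H^1 of the larger one. *)
Lemma Phi_reduction b : Phi b <-> Phi (f b) /\ crd j b = 0%R.
Proof.
split=> [bP|[fb bj] k].
  split=> [k|]; last exact: bP.
  by apply: (H1_Phi (F_free := F_free) (H1_comp fM fc (crd_H1 pp F_free k))).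
(* [u], the coordinate [crd k] minus [c] times [crd j], vanishes at [a] and so factors through
   [f]. *)
pose c := (crd k (odd_val a) / crd j (odd_val a))%R.
pose u b := (\sum_(i < n.+1) ((i == k)%:R - c * (i == j)%:R) * crd i b)%R.
have uE b' : u b' = (crd k b' - c * crd j b')%R.
  rewrite /u; under eq_bigr do rewrite mulrBl; rewrite sumrB; congr (_ - _)%R.
    rewrite (bigD1 k)//= eqxx mul1r big1 ?addr0// => i /negbTE ->.
    by rewrite mul0r.
  rewrite (bigD1 j)//= eqxx mulr1 big1 ?addr0// => i /negbTE ->.
  by rewrite mulr0 mul0r.
have uH : H1 u by apply: H1_lin => i; exact: crd_H1.
have : u b = 0%R.
  have ua : u (odd_val a) = 0%R by rewrite uE /c divfK// subrr.
  rewrite (congr1 (fun w => w b) (f_ker uH ua)) /=.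
  exact: (H1_Phi (F_free := F_free) (H1_comp gM gc uH)).
by rewrite uE bj mulr0 subr0.
Qed.

Section Cosets.
Variable N : sigmaNormal (F n).
Hypothesis oN : open (sn_set N).
Local Notation M := (sn_preimage N fM fS).

Let oM : open (sn_set M).
Proof. by apply: open_comp => // b _; exact: fc. Qed.

(** [f] induces an isomorphism from F_(n+1) modulo the preimage [M] onto F_n modulo [N], so both
    sides are inverses of the same number of odd elements. *)
Lemma haar_reduction (r : oddT (F n)) :
  h n.+1 [set b | odd_coset N (odd_val r) (odd_map fM fS b)] =
  h n (odd_coset N (odd_val r)).
Proof.
have -> : [set b | odd_coset N (odd_val r) (odd_map fM fS b)] =
          odd_coset M (g (odd_val r)).
  by apply/seteqP; split=> b; rewrite /odd_coset /= fM (morphVg fM) gK.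
rewrite (haar_odd_coset (@h_haar n.+1))//.
  rewrite (haar_odd_coset (@h_haar n))//; last exact: odd_proj.
  congr ((_%:R)^-1%R)%:E; apply: (odd_index_isomorphic (proF n.+1) (proF n)) => //.
  apply: (@quot_isomorphic _ _ M N f g) => //=.
  - by move=> b; rewrite gK.
  - by move=> b; rewrite fM (morphVg fM) gK mulVg; exact: sn1.
  - by move=> b; rewrite gK mulVg; exact: sn1.
rewrite /odd_elts /= -projS -projV; apply/projP => /=.
rewrite fM (morphVg fM) fS (morphVg fM) gK odd_valP invgK mulgV; exact: sn1.
Qed.

Let L k : set (oddT (F n.+1)) := [set b | crd j (odd_val b) = k].

Let crd_fiber (r : oddT (F n)) (k : 'F_p) : exists c : F n.+1,
  [/\ f c = odd_val r, crd j c = k &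
    odd_coset M (g (odd_val r)) `&` L k = odd_coset (sn_setI M (ker_crd j)) c].
Proof.
have aX m : crd j (odd_val a ^+ m) = (m%:R * crd j (odd_val a))%R.
  elim: m => [|m IH]; first by rewrite expg0 mul0r (H1_1 (crd_H1 pp F_free j)).
  by rewrite expgS crdM IH -natr1 mulrDl mul1r addrC.
have faX m : f (odd_val a ^+ m) = 1.
  by elim: m => [|m IH]; rewrite ?expg0 ?(morph1g fM)// expgS fM IH fa mulg1.
(* Multiplying [g (odd_val r)] by a power of [a] leaves its image under [f] unchanged; this exponent
   brings coordinate [j] to [k]. *)
pose m : nat := ((k - crd j (g (odd_val r))) / crd j (odd_val a))%R.
exists (g (odd_val r) * odd_val a ^+ m).
have fE : f (g (odd_val r) * odd_val a ^+ m) = odd_val r.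
  by rewrite fM gK faX mulg1.
have jE : crd j (g (odd_val r) * odd_val a ^+ m) = k.
  by rewrite crdM aX natr_Zp divfK// addrC subrK.
split=> //; apply/seteqP; split=> b; rewrite /odd_coset /L /= ker_crdE.
  by move=> [+ bk]; rewrite crdM crdV jE bk addNr !fM !(morphVg fM) fE gK.
rewrite crdM crdV jE !fM !(morphVg fM) fE gK => -[? /eqP].
by rewrite addrC subr_eq0 => /eqP.
Qed.

(** The values of coordinate [j] split the coset into p pieces, each an odd coset of the same open
    subgroup [M0], hence of equal measure. *)
Lemma haar_reduction_fiber (r : oddT (F n)) :
  h n.+1 (odd_coset M (g (odd_val r)) `&` L 0%R) =
  ((p%:R^-1)%:E * h n (odd_coset N (odd_val r)))%E.
Proof.
set M0 := sn_setI M (ker_crd j).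
have oM0 : open (sn_set M0) by apply: openI; [exact: oM|exact: ker_crd_open].
have L_haar k : measurable (odd_coset M (g (odd_val r)) `&` L k : set (odd n.+1)) /\
    h n.+1 (odd_coset M (g (odd_val r)) `&` L k) = ((odd_index M0)%:R^-1)%:E%R.
  have [c [cr ck ->]] := crd_fiber r k; split.
    by apply: sub_gen_smallest; exact: odd_coset_open.
  apply: (haar_odd_coset (@h_haar n.+1)) => //.
  rewrite /odd_elts /= -projS -projV; apply/projP; split.
    by rewrite /= fM (morphVg fM) fS (morphVg fM) cr odd_valP invgK mulgV; exact: sn1.
  by rewrite ker_crdE crdM !crdV (crd_sigma pp F_free sigma_x) opprK addrN.
rewrite -haar_reduction.
(* [(Zp_trunc (pdiv p)).+2] is the bound of the ordinal type underlying ['F_p]; [Fp_cast] later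
   turns it into p. *)
have -> : [set b | odd_coset N (odd_val r) (odd_map fM fS b)] =
    \big[setU/set0]_(k < (Zp_trunc (pdiv p)).+2)
      (odd_coset M (g (odd_val r)) `&` L k).
  rewrite -bigcup_seq; apply/seteqP; split=> [b|b [k _ []]].
    rewrite /odd_coset /= => Nb; exists (crd j (odd_val b)); first by rewrite /= mem_index_enum.
    by rewrite /L /= fM (morphVg fM) gK.
  by rewrite /odd_coset /= fM (morphVg fM) gK.
rewrite (measure_bigsetU_ord (h n.+1)); first last.
- by apply/trivIsetP => k l _ _ kl; rewrite -subset0 => b [[_ bk] [_ bl]]; case/eqP: kl; rewrite -bk.
- by move=> k; have [] := L_haar k.
rewrite (eq_bigr (fun=> ((odd_index M0)%:R^-1)%:E%R)); last first.
  by move=> k _; exact: (L_haar k).2.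
rewrite (L_haar _).2 sumEFin sumr_const card_ord -EFinM Fp_cast//.
by rewrite -[X in (_^-1 * X)%R]mulr_natl mulKf// pnatr_eq0 -lt0n prime_gt0.
Qed.

End Cosets.

(** If the coset meets [Phi], say in [r0], their intersection is a coset of the smaller group [N'];
    by [Phi_reduction] the left-hand side is then its preimage cut down to coordinate [j] equal to
    0. *)
Lemma haar_reduction_Phi (N : sigmaNormal (F n)) (r : oddT (F n)) : open (sn_set N) ->
  h n.+1 [set b | odd_coset N (odd_val r) (odd_map fM fS b) /\ Phi (odd_val b)] =
  ((p%:R^-1)%:E * h n [set b | odd_coset N (odd_val r) b /\ Phi (odd_val b)])%E.
Proof.
move=> oN; have [[r0 [Nr0 Pr0]]|/forallNP E0] :=
    pselect (exists b, odd_coset N (odd_val r) b /\ Phi (odd_val b)); last first.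
  rewrite (_ : mkset _ = set0); last first.
    rewrite -subset0 => b [Nb /Phi_reduction[Pb _]].
    by apply: (E0 (odd_map fM fS b)).
  rewrite [X in (_ * h n X)%E](_ : _ = set0); last by rewrite -subset0 => b /E0.
  by rewrite !measure0 mule0.
pose N' := sn_setI N (PhiN n).
have oN' : open (sn_set N') by apply: openI => //; exact: Phi_open.
have PE (b : F n) : Phi b <-> sn_set (PhiN n) ((odd_val r0)^-1 * b).
  have [[P1 PM PV] _] := Phi_normal n; split=> /= Pb.
    by apply: PM => //; exact: PV.
  by rewrite -(mulVKg (odd_val r0) b); exact: PM.
have E (b : oddT (F n)) : odd_coset N' (odd_val r0) b <->
    odd_coset N (odd_val r) b /\ Phi (odd_val b).
  have [h1 h2] := sn_coset_eq Nr0 (odd_val b); have [h3 h4] := PE (odd_val b).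
  by split=> -[b1 b2]; split; [exact: h2|exact: h4|exact: h1|exact: h3].
have -> : [set b | odd_coset N (odd_val r) b /\ Phi (odd_val b)] =
    odd_coset N' (odd_val r0).
  by apply/seteqP; split=> b /E.
rewrite -haar_reduction_fiber//; congr (h _ _).
apply/seteqP; split=> b /=.
  move=> [Nb /Phi_reduction[Pb jb]]; split=> //.
  have /E : odd_coset N (odd_val r) (odd_map fM fS b) /\
    Phi (odd_val (odd_map fM fS b)) by [].
  by rewrite /odd_coset /= !fM !(morphVg fM) gK.
rewrite /odd_coset /= fM (morphVg fM) gK => -[Nb jb].
have /E[Nb' Pb'] : odd_coset N' (odd_val r0) (odd_map fM fS b) by [].
by split=> //; apply/Phi_reduction.
Qed.

End Reduction.

(* A sub-pi-system of the Borel sets of tuples on which the Haar measure is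
   explicit and which suffices to measure the preimages of Borel sets of Sch. *)
Definition cylinder n (N : sigmaNormal (F n)) (r : n.-tuple (oddT (F n))) :
    set (n.-tuple (odd n)) :=
  [set t | forall i, odd_coset N (odd_val (tnth r i)) (tnth t i)].

Definition cylinders n : set (set (n.-tuple (odd n))) :=
  [set A | A = set0 \/ exists N r, open (sn_set N) /\ A = cylinder N r].

Lemma cylinderE n (N : sigmaNormal (F n)) (r s : n.-tuple (oddT (F n))) :
  cylinder N r s -> cylinder N r = cylinder N s.
Proof.
move=> rs; apply/seteqP; split=> t rt i.
  by apply/(sn_coset_eq (rs i)); exact: rt.
by apply/(sn_coset_eq (rs i)); exact: rt.
Qed.

Lemma cylinder_refl n (N : sigmaNormal (F n)) r : cylinder N r r.
Proof. by move=> i; rewrite /odd_coset /= mulVg; exact: sn1. Qed.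

Lemma setI_closed_cylinders n : setI_closed (@cylinders n).
Proof.
move=> A B [->|[N [r [oN ->]]]]; first by left; rewrite set0I.
move=> [->|[M [s [oM ->]]]]; first by left; rewrite setI0.
have [[t [rt st]]|/forallNP E0] := pselect (exists t, (cylinder N r `&` cylinder M s) t).
  right; exists (sn_setI N M), t; split; first exact: openI.
  rewrite (cylinderE rt) (cylinderE st); apply/seteqP; split=> u.
    by move=> [h1 h2] i; split; [exact: h1|exact: h2].
  by move=> tu; split=> i; have [] := tu i.
by left; rewrite -subset0 => t; exact: E0.
Qed.

Lemma cylindersT n : @cylinders n setT.
Proof.
right; exists (sn_setT (F n)), (nseq_tuple n (point : oddT (F n))).
by split; [exact: openT|apply/seteqP; split].
Qed.

Lemma odd_coset_measurable n (N : sigmaNormal (F n)) (a : F n) : open (sn_set N) ->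
  measurable (odd_coset N a : set (odd n)).
Proof. by move=> oN; apply: sub_gen_smallest; exact: odd_coset_open. Qed.

Lemma Phi_measurable n : measurable ([set b | Phi (odd_val b)] : set (odd n)).
Proof.
apply: sub_gen_smallest; apply: (@open_comp _ _ (@odd_val (F n)) (@Phi n)).
  by move=> b _; exact: odd_val_continuous.
exact: Phi_open.
Qed.

Lemma cylinders_measurable n : @cylinders n `<=` measurable.
Proof.
move=> _ [->|[N [r [oN ->]]]]; first exact: measurable0.
apply: (@measurable_box _ (odd n) n (fun i => odd_coset N (odd_val (tnth r i)))) => i.
exact: odd_coset_measurable.
Qed.

End FreeHaar.

(** * The law of [Theta] on cylinders *)

Section SchMeasureTheory.
Variables (R : realType) (p : nat) (pp : prime p) (F : nat -> sigmaGroupType).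
Variable x : forall n, 'I_n -> F n.
Arguments x : clear implicits.
Hypothesis F_free : forall n, is_free_pro_p p (x n).
Hypothesis sigma_x : forall n (i : 'I_n), sigma (x n i) = (x n i)^-1.
Variable h : forall n, probability (borel (oddT (F n))) R.
Hypothesis h_haar : forall n, is_haar_odd (h n).

Local Notation crd := (crd pp F_free).
Local Notation Phi := (Phi pp F_free).
Local Notation odd n := (borel (oddT (F n))).
Local Notation Sch := (Sch F p).

Let p1 : (1 < p)%N. Proof. exact: prime_gt1. Qed.

Lemma measurable_Sch_basis (A : set (borel Sch)) : measurable A -> <<s @Sch_basis p F >> A.
Proof.
apply: smallest_sub; first exact: smallest_sigma_algebra.
exact: (sigma_algebra_Sch_basis pp F_free).
Qed.

(** The preimage of a basic neighbourhood of level i is a finite union of cylinders for D_i, because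
    G_r/D_i depends only on r modulo D_i. *)
Lemma Theta_cylinders n (A : set (borel Sch)) : measurable A ->
  <<s @cylinders F n >> (@Theta p F n @^-1` A).
Proof.
have [s0 sD sU] := smallest_sigma_algebra setT (@cylinders F n).
move=> /measurable_Sch_basis; move: A; apply: smallest_sub.
  split=> [|A mA|A mA] /=; first by rewrite preimage_set0.
    exact: (sD (@Theta p F n @^-1` A)).
  by rewrite preimage_bigcup; exact: sU.
move=> _ [i [X [i1 ->]]].
pose D := [set cylinder (zassenhaus p (F n) i) r | r in
  @Theta p F n @^-1` Sch_nbhs i X].
have -> : @Theta p F n @^-1` Sch_nbhs i X = \bigcup_(C in D) C.
  apply/seteqP; split=> [r rX|r [_ [s sX <-]] sr].
    by exists (cylinder (zassenhaus p (F n) i) r); [exists r|exact: cylinder_refl].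
  apply: (Sch_nbhs_trans sX); exact: (Sch_nbhs_congr pp sr).
pose T := g_sigma_algebraType (@cylinders F n).
suff : measurable (\bigcup_(C in D) (C : set T)) by [].
apply: countable_bigcup_measurable => [|_ [r _ <-]].
  apply/finite_set_countable.
  apply: (@sub_finite_set _ _ (range (cylinder (zassenhaus p (F n) i)))).
    by move=> _ [r _ <-]; exists r.
  by apply: (@finite_zass_image p pp F x F_free n i) => r s rs; exact: cylinderE.
apply: sub_gen_smallest; right; exists (zassenhaus p (F n) i), r; split=> //.
exact: (F_zass_open pp F_free).
Qed.

Lemma measurable_Theta n : measurable_fun [set: n.-tuple (odd n)] (@Theta p F n).
Proof.
move=> _ A mA; rewrite setTI.
have : <<s @cylinders F n >> `<=` @measurable _ (n.-tuple (odd n)).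
  apply: smallest_sub; first exact: sigma_algebra_measurable.
  exact: cylinders_measurable.
by apply; exact: Theta_cylinders.
Qed.

(** The length [m] is independent of [n]: once the head of a tuple over [F n.+1] is revealed, [n]
    entries remain. *)
Definition first_Phi n m k : set (m.-tuple (odd n)) :=
  [set t | forall i : 'I_m, (i < k)%N -> Phi (odd_val (tnth t i))].

Lemma first_Phi_box n m k : @first_Phi n m k =
  box (fun i : 'I_m => if (i < k)%N then ([set b | Phi (odd_val b)] : set (odd n)) else setT).
Proof.
apply/seteqP; split=> t tP i; have := tP i; first by case: ifP => // _; apply.
by move=> + ik; rewrite ik.
Qed.

Lemma measurable_first_Phi n m k : measurable (@first_Phi n m k).
Proof.
rewrite first_Phi_box; apply: measurable_box => i.
by case: ifP => // _; exact: Phi_measurable.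
Qed.

Lemma odd_map_measurable (G H : sigmaGroupType) (f : G -> H)
    (fM : {morph f : a b / a * b}) (fS : {morph f : a / sigma a >-> sigma a}) :
  continuous f ->
  measurable_fun [set: borel (oddT G)] (odd_map fM fS : borel (oddT G) -> borel (oddT H)).
Proof.
move=> fc; apply: continuous_measurable_borel.
apply: continuous_comp_initial.
exact: (continuous_comp2 (@odd_val_continuous G) fc).
Qed.

(** Both sides are values of measures on n-tuples at the preimage of [A]: [m1], the image of the
    constrained law under [f], and [m2], the scaled constrained law. On cylinders they agree factor
    by factor, each constrained entry contributing q; this suffices because the preimage of [A]
    belongs to the sigma-algebra of cylinders. *)
Lemma tuple_reduction n (a : oddT (F n.+1)) k (A : set (borel Sch)) :
  ~ Phi (odd_val a) -> measurable A -> (k <= n)%N ->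
  tuple_measure (h n.+1) n
    [set t | A (@Theta p F n.+1 (tuple_cons (a : odd n.+1, t))) /\ @first_Phi n.+1 n k t] =
  (((p%:R^-1) ^+ k)%R%:E * tuple_measure (h n) n (@Theta p F n @^-1` A `&` @first_Phi n n k))%E.
Proof.
move=> aP mA kn; have /existsNP[j /eqP aj] := aP.
have [f [fM [fS [g [gM fc gc gK [fa fker fcls]]]]]] := Sch_class_reduction sigma_x aP.
pose mapf (t : n.-tuple (odd n.+1)) : n.-tuple (odd n) :=
  [tuple odd_map fM fS (tnth t i) | i < n].
have mapf_meas : measurable_fun setT mapf.
  apply/measurable_fun_tnthP => i.
  rewrite (_ : _ \o _ = (odd_map fM fS : odd n.+1 -> odd n) \o (fun t => tnth t i)).
    apply: measurableT_comp; last exact: measurable_tnth.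
    exact: odd_map_measurable.
  by apply/funext => t /=; rewrite tnth_mktuple.
pose mapf' : {mfun n.-tuple (odd n.+1) >-> n.-tuple (odd n)} := mfun_Sub (mem_set mapf_meas).
pose m1 := image_restr (tuple_measure (h n.+1) n) (@measurable_first_Phi n.+1 n k) mapf'.
have pk0 : (0 <= (p%:R^-1) ^+ k :> R)%R by rewrite exprn_ge0// invr_ge0.
pose m2 := mscale (NngNum pk0)
  (mrestr (tuple_measure (h n) n) (@measurable_first_Phi n n k)).
have -> : [set t | A (@Theta p F n.+1 (tuple_cons (a : odd n.+1, t))) /\
    @first_Phi n.+1 n k t] =
    mapf' @^-1` (@Theta p F n @^-1` A) `&` @first_Phi n.+1 n k.
  by apply/seteqP; split=> t /= [At tk]; split=> //; move: At; rewrite /Theta fcls.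
suff : m1 (@Theta p F n @^-1` A) = m2 (@Theta p F n @^-1` A) by [].
apply: (@g_sigma_algebra_measure_unique _ R (n.-tuple (odd n)) (@cylinders F n)
  (@cylinders_measurable _ _) (fun=> setT) (fun=> @cylindersT _ _)).
- by rewrite bigcup_const.
- exact: setI_closed_cylinders.
- move=> _ [->|[N [r [oN ->]]]]; first by rewrite !measure0.
  pose B m (C : 'I_n -> set (odd m)) (i : 'I_n) : set (odd m) :=
    C i `&` (if (i < k)%N then [set b | Phi (odd_val b)] else setT).
  pose C1 (i : 'I_n) : set (odd n.+1) :=
    [set b | odd_coset N (odd_val (tnth r i)) (odd_map fM fS b)].
  pose C2 (i : 'I_n) : set (odd n) := odd_coset N (odd_val (tnth r i)).
  have mC2 i : measurable (C2 i) by exact: odd_coset_measurable.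
  have mC1 i : measurable (C1 i).
    rewrite -[C1 i]setTI; have := odd_map_measurable fM fS fc.
    by move=> /(_ measurableT _ (mC2 i)).
  have mB m C i : (forall i, measurable (C i)) -> measurable (B m C i).
    move=> mC; apply: measurableI => //.
    by case: ifP => // _; exact: Phi_measurable.
  have E1 : m1 (cylinder N r) = tuple_measure (h n.+1) n (box (B n.+1 C1)).
    rewrite /m1 /image_restr /pushforward /mrestr; congr (tuple_measure _ _ _).
    apply/seteqP; split=> t.
      move=> [tN tP] i; split.
        by have := tN i; rewrite /C1 /= tnth_mktuple.
      by case: ifP => // ik; exact: tP.
    move=> tB; split=> i; first by have [+ _] := tB i; rewrite /C1 /= tnth_mktuple.
    by move=> ik; have [_] := tB i; rewrite ik.
  have E2 : m2 (cylinder N r) =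
      (((p%:R^-1) ^+ k)%R%:E * tuple_measure (h n) n (box (B n C2)))%E.
    rewrite /m2 /mscale /mrestr /=; congr (_ * tuple_measure _ _ _)%E.
    apply/seteqP; split=> t.
      by move=> [tN tP] i; split; [exact: tN|case: ifP => // ik; exact: tP].
    move=> tB; split=> i; first by have [+ _] := tB i.
    by move=> ik; have [_] := tB i; rewrite ik.
  apply: (etrans E1); apply: (etrans _ (esym E2)).
  rewrite !tuple_measure_box -?EFinM; [|by move=> i; exact: mB|by move=> i; exact: mB].
  congr _%:E.
  (* The power is spread over all entries, with factor 1 beyond the first [k], to match the two
     products. *)
  have -> : ((p%:R^-1) ^+ k = \prod_(i < n) (if (i < k)%N then p%:R^-1 else 1) :> R)%R.
    by rewrite -big_mkcond -(big_ord_widen _ (fun=> p%:R^-1%R) kn) prodr_const card_ord.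
  rewrite -big_split; apply: eq_bigr => i _ /=; rewrite /B; case: ifP => ik; last first.
    by rewrite !setIT mul1r (haar_reduction F_free h_haar fM fS gM fc gc gK).
  have -> : C1 i `&` [set b | Phi (odd_val b)] = [set b |
      odd_coset N (odd_val (tnth r i)) (odd_map fM fS b) /\ Phi (odd_val b)] by [].
  rewrite (haar_reduction_Phi sigma_x h_haar aj fM fS gM fc gc gK fa fker)//.
  rewrite fineM//; apply: fin_num_measure.
  have mBi := mB n C2 i mC2; rewrite /B ik in mBi.
  exact: mBi.
- move=> _; rewrite -ge0_fin_numE ?measure_ge0//.
  apply: (@fin_num_measure _ _ _ (tuple_measure (h n.+1) n)).
  by rewrite preimage_setT setTI; exact: measurable_first_Phi.
- exact: (Theta_cylinders mA).
Qed.

End SchMeasureTheory.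

Local Close Scope group_scope.
Local Open Scope ring_scope.

(** * The recursion for the number of relators in the Frattini subgroup *)

Section Recursion.
Variables (R : realType) (p : nat) (pp : prime p) (F : nat -> sigmaGroupType).
Variable x : forall n, 'I_n -> F n.
Arguments x : clear implicits.
Hypothesis F_free : forall n, is_free_pro_p p (x n).
Hypothesis sigma_x : forall n (i : 'I_n), sigma (x n i) = ((x n i)^-1)%g.
Variable h : forall n, probability (borel (oddT (F n))) R.
Hypothesis h_haar : forall n, is_haar_odd (h n).

Local Notation Phi := (Phi pp F_free).
Local Notation fPhi n m k := (@first_Phi p pp F x F_free n m k).
Local Notation odd n := (borel (oddT (F n))).
Local Notation Sch := (Sch F p).
Local Notation q := (p%:R^-1 : R).

(* The quantity [W n k] of the recursion. *)
Definition law n k (A : set (borel Sch)) : \bar R :=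
  tuple_measure (h n) n (@Theta p F n @^-1` A `&` fPhi n n k).

Let measurable_preimage n (A : set (borel Sch)) : measurable A ->
  measurable (@Theta p F n @^-1` A).
Proof.
by move=> mA; rewrite -[X in measurable X]setTI; apply: (measurable_Theta pp F_free).
Qed.

Let mPhi n : measurable ([set b | Phi (odd_val b)] : set (odd n)).
Proof. exact: Phi_measurable. Qed.

Lemma law_recursion n k (A : set (borel Sch)) : measurable A -> (k <= n)%N ->
  law n.+1 k A = (law n.+1 k.+1 A + ((1 - q ^+ n.+1) * q ^+ k)%:E * law n k A)%E.
Proof.
move=> mA kn; have kn' : (k < n.+1)%N by [].
(* Counting from 0, [ik] is the first entry not yet constrained, the relator to be revealed. *)
pose ik : 'I_n.+1 := Ordinal kn'.
pose Q : set (n.+1.-tuple (odd n.+1)) := [set t | Phi (odd_val (tnth t ik))].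
have mQ : measurable Q.
  have := @measurable_tnth _ (odd n.+1) n.+1 ik.
  by move=> /(_ measurableT _ (@mPhi n.+1)); rewrite setTI.
have mD : measurable (@Theta p F n.+1 @^-1` A `&` fPhi n.+1 n.+1 k).
  by apply: measurableI; [exact: measurable_preimage|exact: measurable_first_Phi].
rewrite /law (measureDI _ mD mQ) addeC; congr (_ + _)%E.
  congr (tuple_measure _ _ _); rewrite -setIA; congr (_ `&` _).
  apply/seteqP; split=> t.
    move=> [tk tQ] i; rewrite ltnS leq_eqVlt => /predU1P[e|]; last exact: tk.
    by have -> : i = ik by exact: val_inj.
  by move=> tk; split=> [i ilt|]; apply: tk; rewrite ?leqnn// ltnW.
(* The event off [Q] once entry [ik] and the head are exchanged: the head lies outside [Phi], and
   the next [k] entries lie inside. *)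
pose B : set (n.+1.-tuple (odd n.+1)) := [set t | A (@Theta p F n.+1 t) /\
  (~ Phi (odd_val (tnth t ord0)) /\
   forall i : 'I_n, (i < k)%N -> Phi (odd_val (tnth t (lift ord0 i))))].
have mB : measurable B.
  apply: measurableI; first exact: measurable_preimage.
  apply: measurableI.
    apply: measurableC; have := @measurable_tnth _ (odd n.+1) n.+1 ord0.
    by move=> /(_ measurableT _ (@mPhi n.+1)); rewrite setTI.
  pose T1 : set (n.+1.-tuple (odd n.+1)) :=
    [set t | forall i : 'I_n, (i < k)%N -> Phi (odd_val (tnth t (lift ord0 i)))].
  suff : measurable T1 by [].
  rewrite (_ : T1 = \bigcap_(i in [set: 'I_n])
      ((fun t => tnth t (lift ord0 i)) @^-1`
       (if (i < k)%N then ([set b | Phi (odd_val b)] : set (odd n.+1)) else setT))).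
    apply: fin_bigcap_measurable => [|i _]; first exact: finite_finset.
    rewrite -[X in measurable X]setTI; apply: measurable_tnth => //.
    by case: ifP => // _; exact: Phi_measurable.
  apply/seteqP; split=> t tP i; first by move=> _ /=; case: ifP => // ilt; exact: tP.
  by move=> ilt; have := tP i I; rewrite /= ilt.
pose s : {perm 'I_n.+1} := tperm ord0 ik.
have -> : @Theta p F n.+1 @^-1` A `&` fPhi n.+1 n.+1 k `\` Q =
    (fun t : n.+1.-tuple (odd n.+1) => [tuple tnth t (s i) | i < n.+1]) @^-1` B.
  apply/seteqP; split=> t; rewrite /B /Q /= /Theta
    (Sch_class_perm p (t : n.+1.-tuple (oddT (F n.+1))) s).
    move=> [[At tk] tQ]; split=> //; split; first by rewrite tnth_mktuple tpermL.
    move=> i ilt; rewrite tnth_mktuple; apply: tk.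
    rewrite /s; case: tpermP => [e|_|_ ie].
    - by have := congr1 val e; rewrite /= /bump.
    - exact: leq_ltn_trans ilt.
    rewrite /= /bump /= add1n ltn_neqAle ilt andbT.
    by apply/eqP => e; apply: ie; apply: val_inj.
  move=> [At [t0 tk]]; rewrite tnth_mktuple tpermL in t0.
  split=> //; split=> // l lk; case: (unliftP ord0 l) => [i|] le.
    have := tk i; rewrite tnth_mktuple -le tpermD; last 2 first.
    - by apply/eqP => e; have := congr1 val le; rewrite -e.
    - by apply/eqP => e; move: lk; rewrite -e /= ltnn.
    by apply; move: lk; rewrite le /= /bump /= add1n => /ltnW.
  have k0 : (0 < k)%N by move: lk; rewrite le.
  have k1n : (k.-1 < n)%N by rewrite prednK.
  have := tk (Ordinal k1n); rewrite tnth_mktuple.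
  have -> : lift ord0 (Ordinal k1n) = ik.
    by apply: val_inj; rewrite /= /bump /= add1n prednK.
  by rewrite tpermR -le; apply; rewrite /= prednK.
apply: (etrans (tuple_measure_perm (h n.+1) s mB)); rewrite tuple_measureS.
(* Given the head, the inner measure is 0 on [Phi] and, by [tuple_reduction], one and the same
   constant off it. *)
rewrite (eq_integral (fun b => ((cst ((q ^+ k)%:E * law n k A)%E) \_
  (~` [set b : odd n.+1 | Phi (odd_val b)])) b)); last first.
  move=> b _; rewrite patchE; case: ifPn => [/set_mem/= bP|/negP bP].
    rewrite -(tuple_reduction sigma_x h_haar bP mA kn).
    congr (tuple_measure _ _ _); apply/seteqP; split=> t.
      move=> [At [_ tP]]; split=> // i ilt.
      by have := tP i ilt; rewrite tnthS.
    move=> [At tP]; split=> //; split; first by rewrite tnth0.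
    by move=> i ilt; rewrite tnthS; exact: tP.
  rewrite (_ : mkset _ = set0) ?measure0//.
  rewrite -subset0 => t [_ [+ _]]; rewrite tnth0 => bP'.
  by apply: bP; rewrite inE.
rewrite -integral_mkcond integral_cst; last by apply: measurableC; exact: mPhi.
have PC : h n.+1 (~` ([set b | Phi (odd_val b)] : set (odd n.+1))) = (1 - q ^+ n.+1)%:E.
  apply: (etrans (probability_setC _ _)); first exact: mPhi.
  by rewrite (haar_Phi pp F_free sigma_x h_haar) natrX -exprVn -EFinB.
apply: (etrans (congr1 _ PC)).
by rewrite -/(law n k A) muleC muleA -EFinM.
Qed.

End Recursion.

(** * The measures restricted to a single rank *)

Section RankLaw.
Variables (R : realType) (p : nat) (pp : prime p) (F : nat -> sigmaGroupType).
Variable x : forall n, 'I_n -> F n.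
Arguments x : clear implicits.
Hypothesis F_free : forall n, is_free_pro_p p (x n).
Hypothesis sigma_x : forall n (i : 'I_n), sigma (x n i) = ((x n i)^-1)%g.
Variable h : forall n, probability (borel (oddT (F n))) R.
Hypothesis h_haar : forall n, is_haar_odd (h n).

Local Notation Phi := (Phi pp F_free).
Local Notation fPhi n m k := (@first_Phi p pp F x F_free n m k).
Local Notation odd n := (borel (oddT (F n))).
Local Notation Sch := (Sch F p).
Local Notation q := (p%:R^-1 : R).
Local Notation law := (law pp F_free h).
Local Notation C := (Cprod R p).

Let p1 : (1 < p)%N. Proof. exact: prime_gt1. Qed.

Let first_Phi_full n (t : n.-tuple (odd n)) :
  fPhi n n n t <-> Sch_rank p F n (@Theta p F n t).
Proof.
rewrite /Theta; split=> [tP|/(Sch_rank_class pp F_free sigma_x) tP].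
  by apply/(Sch_rank_class pp F_free sigma_x) => i; exact: tP.
by move=> i _; exact: tP.
Qed.

(** With n generators the rank is at most n, and for [n = m] rank m already puts every relator in
    [Phi], whatever [k] is. *)
Lemma law_rank_le m n k (A : set (borel Sch)) : A `<=` Sch_rank p F m -> (n <= m)%N ->
  law n k A = if n == m then law m m A else 0%E.
Proof.
move=> Am nm; case: eqVneq => [->|nm'].
  congr (tuple_measure _ _ _); apply/seteqP; split=> t [At tk]; split=> //.
    by apply/first_Phi_full; exact: Am.
  by move=> i _; exact: tk.
rewrite /law (_ : _ `&` _ = set0) ?measure0//; rewrite -subset0 => t [/Am At _].
have := Sch_rank_le pp F_free sigma_x At.
by rewrite leqNgt ltn_neqAle nm' nm.
Qed.

Lemma law_rank_diag m n (A : set (borel Sch)) : A `<=` Sch_rank p F m -> n != m ->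
  law n n A = 0%E.
Proof.
move=> Am nm; rewrite /law (_ : _ `&` _ = set0) ?measure0//; rewrite -subset0.
move=> t [/Am At /first_Phi_full tn].
by case/eqP: nm; exact: (Sch_rank_unique pp tn At).
Qed.

(** Induction on n - m and, inside it, downward induction on [k]. The latter starts at [k = n],
    where for [n > m] both sides vanish: all relators in [Phi] force rank n. *)
Lemma law_rank m n k (A : set (borel Sch)) : measurable A -> A `<=` Sch_rank p F m ->
  (m <= n)%N -> (k <= n)%N -> law n k A = ((law_coef R p m n k)%:E * law m m A)%E.
Proof.
move=> mA Am /subnKC <-; move: (n - m)%N => {n} d.
elim: d k => [|d IH] k.
  rewrite addn0 => km; rewrite (law_rank_le _ Am)// eqxx.
  by rewrite law_coef_diag// mul1e.
(* Downward induction is run on the distance [l] of [k] from its maximal value. *)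
rewrite addnS => kn; rewrite -(subKn kn); move: (_ - k)%N (leq_subr k (m + d).+1) => {kn} l.
elim: l => [|l IHl] ln.
  rewrite subn0 (law_rank_diag Am); last by rewrite gtn_eqF// ltnS leq_addr.
  by rewrite /law_coef leqNgt ltnS leq_addr mul0e.
have kS : ((m + d).+1 - l.+1).+1 = ((m + d).+1 - l)%N by rewrite subnSK.
set k' := ((m + d).+1 - l.+1)%N in kS *.
have k'n : (k' <= m + d)%N by rewrite /k' subSS leq_subr.
rewrite (law_recursion pp F_free sigma_x h_haar mA k'n) kS IHl; last exact: ltnW.
rewrite IH// (law_coef_rec R p1 (leq_addr d m) k'n) muleA -EFinM EFinD muleDl//.
  by rewrite kS.
apply: (@fin_num_measure _ _ _ (tuple_measure (h m) m)).
apply: measurableI; last exact: measurable_first_Phi.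
by rewrite -[X in measurable X]setTI; apply: (measurable_Theta pp F_free).
Qed.

Lemma sch_measureE n (A : set (borel Sch)) : sch_measure p h n A = law n 0 A.
Proof.
by rewrite /sch_measure /pushforward /law (_ : fPhi n n 0 = setT) ?setIT//; apply/seteqP; split.
Qed.

Lemma sch_measure_rank m n (A : set (borel Sch)) : measurable A ->
  A `<=` Sch_rank p F m -> (m <= n)%N ->
  sch_measure p h n A = ((C n ^+ 2 / (C m ^+ 2 * C (n - m)))%:E * sch_measure p h m A)%E.
Proof.
move=> mA Am mn; rewrite !sch_measureE (law_rank mA Am mn)//.
rewrite [law m 0 A](law_rank_le _ Am)// eqxx; congr (_%:E * _)%E.
by rewrite /law_coef leq0n muln0 expr0 mul1r !subn0 -!expr2.
Qed.

Lemma sch_measure_rank_lt m n (A : set (borel Sch)) :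
  A `<=` Sch_rank p F m -> (n < m)%N -> sch_measure p h n A = 0%E.
Proof. by move=> Am nm; rewrite sch_measureE (law_rank_le _ Am) ?ltn_eqF// ltnW. Qed.

Lemma sch_measure_rank_mass m :
  sch_measure p h m (Sch_rank p F m) = (q ^+ (m * m))%:E.
Proof.
have -> : sch_measure p h m (Sch_rank p F m) = tuple_measure (h m) m (fPhi m m m).
  rewrite /sch_measure /pushforward; congr (tuple_measure _ _ _).
  by apply/seteqP; split=> t /first_Phi_full.
rewrite first_Phi_box tuple_measure_box => [|i]; last first.
  by case: ifP => // _; exact: Phi_measurable.
congr _%:E; rewrite (eq_bigr (fun=> q ^+ m)) ?prodr_const ?card_ord ?exprM// => i _.
by rewrite ltn_ord (haar_Phi pp F_free sigma_x h_haar) /= natrX exprVn.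
Qed.

End RankLaw.

Lemma bounded_indic (R : realType) (T : Type) (A : set T) : bounded_fun (\1_A : T -> R)%R.
Proof.
exists 1%R; split=> // M /ltW M1 z _; apply: le_trans M1.
by rewrite indicE ger0_norm ?lern1 ?leq_b1.
Qed.

(** * The limit measure *)

Section Limit.
Variables (R : realType) (p : nat) (pp : prime p) (p2 : (2 < p)%N).
Variables (F : nat -> sigmaGroupType) (x : forall n, 'I_n -> F n).
Arguments x : clear implicits.
Hypothesis F_free : forall n, is_free_pro_p p (x n).
Hypothesis sigma_x : forall n (i : 'I_n), sigma (x n i) = ((x n i)^-1)%g.
Variable h : forall n, probability (borel (oddT (F n))) R.
Hypothesis h_haar : forall n, is_haar_odd (h n).

Local Notation Sch := (Sch F p).
Local Notation q := (p%:R^-1 : R).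
Local Notation C := (Cprod R p).

Let p1 : (1 < p)%N. Proof. exact: ltnW. Qed.

Lemma measurable_Sch_rank m : measurable (Sch_rank p F m : set (borel Sch)).
Proof. apply: sub_gen_smallest; exact: Sch_rank_open. Qed.

Lemma measure_unique_Sch_nbhs (m1 m2 : probability (borel Sch) R) :
  (forall i X, (1 < i)%N -> m1 (Sch_nbhs i X) = m2 (Sch_nbhs i X)) ->
  forall A : set (borel Sch), measurable A -> m1 A = m2 A.
Proof.
(* The empty set is adjoined for disjoint neighbourhoods, the full set to have a covering member of
   the pi-system. *)
move=> m12 A mA; pose G : set (set (borel Sch)) := [set set0; setT] `|` @Sch_basis p F.
have m12T : m1 setT = m2 setT by rewrite !probability_setT.
apply: (@g_sigma_algebra_measure_unique _ _ (borel Sch) G _ (fun=> setT)).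
- move=> B [[->|->]//|[i [X [i1 ->]]]].
  by apply: sub_gen_smallest; exact: Sch_nbhs_open.
- by move=> _; left; right.
- by apply/seteqP; split=> // X _; exists 0%N.
- move=> B D [[->|->]|[i [X [i1 ->]]]].
  + by move=> _; rewrite set0I; left; left.
  + by rewrite setTI.
  move=> [[->|->]|[j [Y [j1 ->]]]].
  + by rewrite setI0; left; left.
  + by rewrite setIT; right; exists i, X.
  have [ij|/ltnW ji] := leqP i j.
  + have [->|->] := Sch_nbhsI pp X Y ij; first by left; left.
    by right; exists j, Y.
  + rewrite setIC; have [->|->] := Sch_nbhsI pp Y X ji; first by left; left.
    by right; exists i, X.
- move=> B [[->|->]|[i [X [i1 ->]]]] //; first by rewrite !measure0.
  exact: m12.
- by move=> _; apply: (@le_lt_trans _ _ 1%E); [exact: probability_le1|exact: ltry].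
have := measurable_Sch_basis pp F_free mA.
apply: sub_smallest2r; first exact: smallest_sigma_algebra.
by move=> B BS; right.
Qed.

Let mTheta n := @measurable_Theta _ pp _ _ F_free n.

(** [sch_measure] is a bare set function; this is the same function, by conversion, bundled as a
    probability. *)
Let P n : probability (borel Sch) R :=
  distribution (tuple_measure (h n) n) (mfun_Sub (mem_set (@mTheta n))).

Let PE n A : P n A = sch_measure p h n A. Proof. by []. Qed.

Lemma sch_measure_indic n (A : set (borel Sch)) : measurable A ->
  (\int[sch_measure p h n]_z (\1_A z)%:E = sch_measure p h n A)%E.
Proof.
by move=> mA; apply: (etrans (integral_indic (P n) measurableT mA)); rewrite setIT.
Qed.

Lemma sch_measure_limit : exists mu : probability (borel Sch) R,
  (forall f : borel Sch -> R, measurable_fun setT f -> bounded_fun f ->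
     (\int[sch_measure p h n]_z (f z)%:E @[n --> \oo] --> \int[mu]_z (f z)%:E)%E) /\
  (forall m (A : set (borel Sch)), measurable A -> A `<=` Sch_rank p F m ->
     mu A = ((Cinf R p / C m ^+ 2)%:E * sch_measure p h m A)%E).
Proof.
have q0 := pinv_gt0 R p1.
have K_ge0 n m : 0 <= C n ^+ 2 / (C m ^+ 2 * C (n - m)).
  by rewrite divr_ge0 ?mulr_ge0 ?exprn_ge0// ltW// Cprod_gt0.
suff [mu [lim rank]] : exists mu : probability (borel Sch) R,
  (forall (f : borel Sch -> R) M, measurable_fun setT f -> (forall z, 0 <= f z) ->
     (forall z, f z <= M) ->
     (\int[P n]_z (f z)%:E @[n --> \oo] --> \int[mu]_z (f z)%:E)%E) /\
  (forall m (A : set (borel Sch)), measurable A -> A `<=` Sch_rank p F m ->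
     mu A = ((Cinf R p / C m ^+ 2)%:E * P m A)%E).
  by exists mu; split=> // f mf bf; exact: (cvg_integral_bounded lim).
apply: (@mixture_limit _ _ R P (Sch_rank p F)
  (fun n m => C n ^+ 2 / (C m ^+ 2 * C (n - m))) _ (fun m => 8 * q ^+ m)).
- exact: measurable_Sch_rank.
- apply/trivIsetP => m n _ _ mn; rewrite -subset0 => X [Xm Xn].
  by case/eqP: mn; exact: (Sch_rank_unique pp Xm Xn).
- apply/seteqP; split=> // X _.
  by have [m Xm] := Sch_rank_exists pp F_free sigma_x X; exists m.
- exact: K_ge0.
- by move=> n m A mA Am mn; exact: (sch_measure_rank pp F_free sigma_x h_haar).
- exact: Cprod_quot_cvg.
(* For [n < m] the mass is 0; otherwise it is the coefficient, at most 8, times [q ^+ (m * m)],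
   which is at most [q ^+ m], with equality for [m = 0]. *)
- move=> n m; have b0 : 0 <= 8 * q ^+ m by rewrite mulr_ge0// exprn_ge0// ltW// pinv_gt0.
  have [mn|nm] := leqP m n; last first.
    by rewrite PE (sch_measure_rank_lt pp F_free sigma_x h _ nm)// lee_fin.
  rewrite PE (sch_measure_rank pp F_free sigma_x h_haar _ _ mn)//; last first.
    exact: measurable_Sch_rank.
  rewrite (sch_measure_rank_mass pp F_free sigma_x h_haar) -EFinM lee_fin.
  apply: ler_pM; [exact: K_ge0|by rewrite exprn_ge0// ltW|exact: Cprod_quot_le|].
  by apply: ler_wiXn2l; [exact: ltW|exact/ltW/pinv_lt1|case: (m) => // k; rewrite leq_pmulr].
- exact: geometric_sum_lty.
Qed.

End Limit.

Local Close Scope ring_scope.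

Theorem theorem9p7 (R : realType) (p : nat) (F : nat -> sigmaGroupType)
    (x : forall n, 'I_n -> F n)
    (h : forall n, probability (borel (oddT (F n))) R)
    (p_prime : prime p) (p_gt2 : (2 < p)%N)
    (F_free : forall n, is_free_pro_p p (x n))
    (sigma_x : forall n (i : 'I_n), sigma (x n i) = ((x n i)^-1)%g)
    (h_haar : forall n, is_haar_odd (h n)) :
  exists mu : probability (borel (Sch F p)) R,
    [/\ cvg_setwise (sch_measure p h) mu,
        cvg_weakly (sch_measure p h) mu,
        (forall nu : probability (borel (Sch F p)) R,
           cvg_weakly (sch_measure p h) nu ->
           forall A : set (borel (Sch F p)), measurable A -> nu A = mu A) &
        (forall (m : nat) (A : set (borel (Sch F p))), measurable A ->
           mu (A `&` Sch_rank p F m) =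
             (((Cinf R p / Cprod R p m ^+ 2)%R)%:E *
              sch_measure p h m (A `&` Sch_rank p F m))%E)].
Proof.
have [mu [lim rank]] := sch_measure_limit p_prime p_gt2 F_free sigma_x h_haar.
have weak : cvg_weakly (sch_measure p h) mu.
  move=> f fc bf; apply: lim bf.
  exact: continuous_borel_measurable.
exists mu; split=> //.
- move=> A mA.
  have := lim (\1_A)%R (measurable_indic mA) (bounded_indic R A); rewrite integral_indic// setIT.
  apply: cvg_trans; apply: near_eq_cvg; apply: nearW => n.
  exact: (sch_measure_indic p_prime F_free).
- move=> nu nuP; apply: measure_unique_Sch_nbhs => // i X i1.
  have mU : measurable (Sch_nbhs i X : set (borel (Sch F p))).
    by apply: sub_gen_smallest; exact: Sch_nbhs_open.
  (* Indicators of clopen sets are admissible test functions, so two weak limits agree on the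
     neighbourhoods. *)
  have cI : continuous (\1_(Sch_nbhs i X) : Sch F p -> R)%R.
    exact/indic_clopen_continuous/Sch_nbhs_clopen.
  have bI := @bounded_indic R _ (Sch_nbhs i X).
  have := cvg_unique (@ereal_hausdorff R) (nuP _ cI bI) (weak _ cI bI).
  by rewrite !integral_indic// setIT => ->.
- move=> m A mA; apply: rank; last by move=> X [].
  by apply: measurableI => //; exact: measurable_Sch_rank.
Qed.
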